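(* Let $K\in\mathcal T_n$ and let $S^K(u,v)=(u,v)_{\frac12,\partial K}$ for $u,v\in\ker(\Pi^\nabla)$. Then $$S^K(v,v)\approx|v|_{1,K}^2\qquad\forall v\in\ker(\Pi^\nabla),$$ i.e. there are constants $0<c_*\le c^*<\infty$, independent of $p$ and of $h_K$, with $c_*|v|_{1,K}^2\le S^K(v,v)\le c^*|v|_{1,K}^2$ for all $v\in\ker(\Pi^\nabla)$.
   Context: $\mathcal T_n$ is a polygonal decomposition of a bounded polygonal domain $\Omega\subset\mathbb R^2$ (so $h_K=\mathrm{diam}(K)\le\mathrm{diam}(\Omega)$); $\mathcal E^K$ is the set of edges of $K$. It is assumed that each $K\in\mathcal T_n$ is star-shaped with respect to a ball of radius $\ge\rho_0h_K$ for a universal $\rho_0\in(0,1/2)$, every edge of $K$ has length $\ge\rho_0h_K$, and the number of edges of $K$ is uniformly bounded. $|\cdot|_{1,K}$ is the $H^1(K)$ seminorm. For $p\in\mathbb N$, $V^\Delta(K)=\{v\in H^1(K):\Delta v=0,\ v|_{\partial K}\in C^0(\partial K),\ v|_s\in\mathbb P_p(s)\ \forall s\in\mathcal E^K\}$. $\mathbb H_p(K)$ is the space of harmonic polynomials of degree (at most) $p$ on $K$. The projector $\Pi^\nabla:V^\Delta(K)\to\mathbb H_p(K)$ is defined by $\int_K\nabla q\cdot\nabla(v-\Pi^\nabla v)=0$ for all $q\in\mathbb H_p(K)$ and $\int_{\partial K}(v-\Pi^\nabla v)\,ds=0$; $\ker(\Pi^\nabla)\subset V^\Delta(K)$ is its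 kernel. The inner product on $H^{1/2}(\partial K)$ is $$(u,v)_{\frac12,\partial K}=(u,v)_{0,\partial K}+\int_{\partial K}\int_{\partial K}\frac{(u(\xi)-u(\eta))(v(\xi)-v(\eta))}{|\xi-\eta|^2}\,d\xi\,d\eta .$$ *)

(* Defs.v *)
From HB Require Import structures.
From mathcomp Require Import all_boot all_order all_algebra.
From mathcomp Require Import all_classical all_reals all_analysis.
Set Implicit Arguments.
Unset Strict Implicit.
Unset Printing Implicit Defensive.
Import Order.TTheory GRing.Theory Num.Theory.
Import numFieldNormedType.Exports.
Local Open Scope classical_set_scope.
Local Open Scope ring_scope.

Section Plane.
Context {R : realType}.
Local Notation plane := (R * R)%type.

(* The normed structure of [R * R] carries the sup norm (same topology), hence
   an explicit Euclidean distance. *)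
Definition edist (x y : plane) : R :=
  Num.sqrt ((x.1 - y.1) ^+ 2 + (x.2 - y.2) ^+ 2).

Definition segpt (a b : plane) (t : R) : plane := a + t *: (b - a).

Definition segment (a b : plane) : set plane := segpt a b @` `[0, 1].

Definition eball (z : plane) (r : R) : set plane := [set x | edist z x < r].

Definition ediam (A : set plane) : R :=
  sup [set d | exists x y, [/\ A x, A y & d = edist x y]].

Definition frontier (A : set plane) : set plane := closure A `\` A°.

Definition polygonal_domain (Omega : set plane) : Prop :=
  [/\ open Omega, connected Omega, Omega !=set0, bounded_set Omega &
    exists s : seq (plane * plane),
      frontier Omega = \bigcup_(e in [set` s]) segment e.1 e.2].

Definition edge_pt (a : seq plane) (i : nat) (t : R) : plane :=
  segpt (nth 0 a i) (nth 0 a (i.+1 %% size a)) t.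

(* Consecutive edges may be collinear, so that hanging nodes count as
   vertices; the edges of an element are those of its vertex list, not of the
   underlying point set.  [verts_simple] says that the closed polygonal line is
   a simple closed curve, and [inner] is then the domain it bounds. *)
Record polygon : Type := Polygon {
  verts : seq plane ;
  inner : set plane ;
  verts_size : (2 < size verts)%N ;
  verts_simple : forall (i j : nat) (s t : R),
    (i < size verts)%N -> (j < size verts)%N -> 0 <= s < 1 -> 0 <= t < 1 ->
    edge_pt verts i s = edge_pt verts j t -> i = j /\ s = t ;
  inner_open : open inner ;
  inner_connected : connected inner ;
  inner_nonempty : inner !=set0 ;
  inner_bounded : bounded_set inner ;
  inner_frontier : frontier inner =
    \bigcup_(i in `I_(size verts)) (edge_pt verts i @` `[0, 1]) }.

Definition edge_len (K : polygon) (i : nat) : R :=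
  edist (edge_pt (verts K) i 0) (edge_pt (verts K) i 1).

Definition polygonal_decomposition (Omega : set plane) (m : nat)
    (T : 'I_m -> polygon) : Prop :=
  [/\ forall k, inner (T k) `<=` Omega,
      forall k l, k != l -> inner (T k) `&` inner (T l) = set0 &
      closure Omega = \bigcup_(k in [set: 'I_m]) closure (inner (T k))].

Definition star_shaped_ball (A : set plane) (z : plane) (r : R) : Prop :=
  eball z r `<=` A /\
  forall x y, eball z r x -> A y -> segment x y `<=` A.

Definition shape_regular (rho0 : R) (N : nat) (K : polygon) : Prop :=
  [/\ exists z r, rho0 * ediam (inner K) <= r /\
        star_shaped_ball (inner K) z r,
      forall i, (i < size (verts K))%N ->
        rho0 * ediam (inner K) <= edge_len K i &
      (size (verts K) <= N)%N].

Definition basis (b : bool) : plane := if b then (0, 1) else (1, 0).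

Definition partial (b : bool) (f : plane -> R) : plane -> R :=
  fun x => 'D_(basis b) f x.

Definition smooth (f : plane -> R) : Prop :=
  forall (s : seq bool) (x : plane), differentiable (foldr partial f s) x.

Definition test_fun (K : set plane) (phi : plane -> R) : Prop :=
  let S := closure [set x | phi x != 0] in
  [/\ smooth phi, compact S & S `<=` K].

Local Notation plane_measurable := (measurableTypeR R * measurableTypeR R)%type.
Local Notation leb2 := (@lebesgue_measure R \x @lebesgue_measure R)%E.

Definition sq_norm2 (K : set plane) (f : plane -> R) : \bar R :=
  (\int[leb2]_(x in K) ((f x) ^+ 2)%:E)%E.

Definition L2 (K : set plane) (f : plane -> R) : Prop :=
  measurable_fun (K : set plane_measurable) (f : plane_measurable -> R) /\
  (sq_norm2 K f < +oo)%E.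

Definition is_weak_partial (K : set plane) (v : plane -> R) (b : bool)
    (g : plane -> R) : Prop :=
  L2 K g /\
  forall phi, test_fun K phi ->
    (\int[leb2]_(x in K) (v x * partial b phi x) =
     - \int[leb2]_(x in K) (g x * phi x))%R.

Definition H1 (K : set plane) (v : plane -> R) : Prop :=
  L2 K v /\ forall b, exists g, is_weak_partial K v b g.

(* A representative of the weak derivative, which is unique a.e. in [K]; only
   meaningful when [H1 K v]. *)
Definition weak_partial (K : set plane) (v : plane -> R) (b : bool) :
  plane -> R := xget (cst 0) [set g | is_weak_partial K v b g].

Definition sq_seminorm_H1 (K : set plane) (v : plane -> R) : \bar R :=
  (\int[leb2]_(x in K) (\sum_(b : bool) (weak_partial K v b x) ^+ 2)%R%:E)%E.

Definition sq_norm_H1 (K : set plane) (v : plane -> R) : \bar R :=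
  (sq_norm2 K v + sq_seminorm_H1 K v)%E.

Definition dirichlet (K : set plane) (u v : plane -> R) : R :=
  (\int[leb2]_(x in K)
     \sum_(b : bool) weak_partial K u b x * weak_partial K v b x)%R.

Definition weakly_harmonic (K : set plane) (v : plane -> R) : Prop :=
  forall phi, test_fun K phi ->
    (\int[leb2]_(x in K)
       \sum_(b : bool) weak_partial K v b x * partial b phi x)%R = 0.

Definition bd_int (K : polygon) (f : plane -> \bar R) : \bar R :=
  (\sum_(i < size (verts K)) (edge_len K i)%:E *
     \int[@lebesgue_measure R]_(t in `[0%R, 1%R]) f (edge_pt (verts K) i t))%E.

Definition L2_bd (K : polygon) (g : plane -> R) : Prop :=
  (forall i, (i < size (verts K))%N ->
     measurable_fun (`[0, 1]%classic : set (measurableTypeR R))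
       (fun t => g (edge_pt (verts K) i t))) /\
  (bd_int K (fun x => ((g x) ^+ 2)%:E) < +oo)%E.

(* The trace operator is the continuous extension to [H1], with values in
   L^2 of the boundary, of the restriction to the boundary of functions that
   are smooth up to the boundary. *)
Definition is_trace (K : polygon) (v g : plane -> R) : Prop :=
  L2_bd K g /\
  exists phi : nat -> plane -> R,
    [/\ forall n, smooth (phi n),
        sq_norm_H1 (inner K) (phi n \- v) @[n --> \oo] --> 0%E &
        bd_int K (fun x => ((phi n x - g x) ^+ 2)%:E) @[n --> \oo] --> 0%E].

Definition trace (K : polygon) (v : plane -> R) : plane -> R :=
  xget (cst 0) [set g | is_trace K v g].

Definition VDelta (K : polygon) (p : nat) (v : plane -> R) : Prop :=
  [/\ H1 (inner K) v, weakly_harmonic (inner K) v &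
    exists g, [/\ is_trace K v g,
      {within frontier (inner K), continuous g} &
      forall i, (i < size (verts K))%N ->
        exists2 q : {poly R}, (size q <= p.+1)%N &
          forall t, 0 <= t <= 1 -> g (edge_pt (verts K) i t) = q.[t]]].

Definition harmonic_poly (K : set plane) (p : nat) (q : plane -> R) : Prop :=
  (exists c : nat -> nat -> R, forall x,
     q x = \sum_(i < p.+1) \sum_(j < (p - i).+1) c i j * x.1 ^+ i * x.2 ^+ j) /\
  forall x, K x -> \sum_(b : bool) partial b (partial b q) x = 0.

(* The relation [q = Pi^nabla v]. *)
Definition is_PiNabla (K : polygon) (p : nat) (v q : plane -> R) : Prop :=
  [/\ harmonic_poly (inner K) p q,
      forall r, harmonic_poly (inner K) p r ->
        dirichlet (inner K) r (v \- q) = 0 &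
      bd_int K (fun x => (trace K (v \- q) x)%:E) = 0%E].

Definition kerPi (K : polygon) (p : nat) (v : plane -> R) : Prop :=
  VDelta K p v /\ is_PiNabla K p v (cst 0).

Definition ip_half (K : polygon) (u v : plane -> R) : \bar R :=
  (bd_int K (fun x => (u x * v x)%R%:E) +
   bd_int K (fun x => bd_int K (fun y =>
     ((u x - u y) * (v x - v y) / (edist x y) ^+ 2)%R%:E)))%E.

(* Extended-real-valued, so that a bound on it includes finiteness. *)
Definition SK (K : polygon) (u v : plane -> R) : \bar R :=
  ip_half K (trace K u) (trace K v).

End Plane.

Arguments polygon : clear implicits.

(* Main.v *)
From HB Require Import structures.
Require Import Defs.
From mathcomp Require Import all_boot all_order all_algebra.
From mathcomp Require Import all_classical all_reals all_analysis.
From mathcomp Require Import measurable_realfun ring lra zify.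
Set Implicit Arguments.
Unset Strict Implicit.
Unset Printing Implicit Defensive.
Import Order.TTheory GRing.Theory Num.Theory.
Import numFieldNormedType.Exports.
Local Open Scope classical_set_scope.
Local Open Scope ring_scope.

(** With [g] the trace of [v], the stabilisation [S^K(v,v)] is the squared L2
    norm of [g] plus its Gagliardo energy.

    The Gagliardo energy is bounded by the Dirichlet energy first for a smooth
    [phi].  Two boundary points [x] and [y] are compared through points at
    relative distance [e ~ |x - y|] on the rays from [x] and [y] to a common
    point of a box inside the ball of star-shapedness.  The increments along
    the rays are estimated by Cauchy-Schwarz, and averaging over the box turns
    them, after a change of variables, into a weighted integral of
    [|grad phi|^2]; the weight is bounded because the boundary measure of a
    disc of radius [s] is at most a multiple of [s].

    For the converse, [phi] is replaced in the interior by its kernel mean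
    [w(x) = D(x)^-1 int phi(y) |x - y|^-4 dy], with [D(x) = int |x - y|^-4 dy]
    and [y] ranging over the boundary.  It has the same trace, and its
    Dirichlet energy is at most a multiple of the Gagliardo energy of [phi].
    Since [v] is harmonic, [grad v] is orthogonal to the gradients of the
    compactly supported truncations of [phi - w] (cut off where [D] is large),
    hence to [grad (phi - w)].  So [int grad v . grad phi] equals
    [int grad v . grad w], and Cauchy-Schwarz applies.

    Both bounds pass to the limit along smooth functions approximating [v] and
    its trace.  The mean of [g] over the boundary vanishes, so the L2 norm is
    dominated by the Gagliardo energy.  None of this sees the degree [p], and
    the constants are scale invariant except in the L2 term, which carries a
    factor [h] bounded by the diameter of the domain. *)

(** The converse bound is Dirichlet's principle: the energy of a harmonic function is controlled by
    that of any function with the same trace, so an extension of [phi] given by a formula is wanted.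
    The exponent 4 makes the formula work. The mass [D] is at least a multiple of [dist^-3], and in
    the gradient of [w] a pair of boundary points [a], [b] receives the weight
    [D(x)^-2 |x - a|^-6 |x - b|^-4]. The mass absorbs a sixth power of the nearer point; a fourth
    power of the farther one is integrable over the plane away from it, with integral of order
    [|a - b|^-2], the Gagliardo kernel. Weak harmonicity speaks of compactly supported test
    functions, hence the truncation. A function of [D] serves because [D] is smooth inside and
    [(phi - w) grad D] is at most a multiple of [D], so the term in which the cut-off is
    differentiated stays bounded. The boundary enters as an abstract finite measure [mu] with a map
    [G] into the plane; its geometry is a bound [C1 * s] from above and [c1 * s] from below on the
    mass of discs of radius [s], the latter for centres on the boundary and [s <= h]. *)

(** * Measurability and changes of variables in the plane *)

Section PlaneMeasure.
Context {R : realType}.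
Local Notation P := (measurableTypeR R * measurableTypeR R)%type.
Local Notation leb := (@lebesgue_measure R).
Local Notation leb2 := (@lebesgue_measure R \x @lebesgue_measure R)%E.

(** Rational boxes link the topology to the product sigma-algebra: an open set is the countable
    union of those it contains. *)
Lemma open_plane_measurable (U : set (R * R)) : open U -> measurable (U : set P).
Proof.
move=> oU.
pose box (i : rat * rat * nat) : set P :=
  (ball (ratr i.1.1 : R) i.2.+1%:R^-1) `*` (ball (ratr i.1.2 : R) i.2.+1%:R^-1).
pose F i : set P := if `[< box i `<=` U >] then box i else set0.
have -> : U = \bigcup_i F i.
  apply/seteqP; split => [x Ux|x [i _]]; last first.
    by rewrite /F; case: ifPn => // /asboolP; exact.
  have /nbhs_ballP[e /= e0 xeU] : nbhs x U by apply: open_nbhs_nbhs.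
  have [n ne] : exists n : nat, n.+1%:R^-1 < e / 2.
    have := @near_infty_natSinv_lt R (PosNum (divr_gt0 e0 (ltr0n R 2))).
    by case=> n _ /(_ n (leqnn n)) ?; exists n.
  have rat_ball (y : R) : exists q : rat, ball y n.+1%:R^-1 (ratr q : R).
    have /(_ (ball y n.+1%:R^-1)) := @dense_rat R.
    case; first by exists y; apply: ballxx.
      exact: ball_open.
    by move=> z [yz [q _ qz]]; exists q; rewrite qz.
  have [p xp] := rat_ball x.1; have [q xq] := rat_ball x.2.
  exists (p, q, n) => //; rewrite /F; case: ifPn => [_|/asboolP].
    by split => /=; apply: ball_sym.
  case=> y [/= y1 y2]; apply: xeU; split.
    apply: le_ball (ball_triangle xp y1).
    by rewrite (splitr e) lerD// ltW.
  apply: le_ball (ball_triangle xq y2).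
  by rewrite (splitr e) lerD// ltW.
apply: countable_bigcupT_measurable => // i; rewrite /F; case: ifPn => // _.
by apply: measurableX; exact: measurable_ball.
Qed.

Lemma open_continuous_plane_measurable_fun (U : set (R * R)) (f : R * R -> R) :
  open U -> {in U, continuous f} -> measurable_fun (U : set P) (f : P -> R).
Proof.
move=> oU cf.
apply: (measurability _ (RGenOpens.measurableE R)).
move=> _ [_ [a [b ->] <-]]; apply: open_plane_measurable.
rewrite openE => x [Ux fx]; apply: filterI; first exact: open_nbhs_nbhs.
by apply: (cf x (mem_set Ux)); apply: open_nbhs_nbhs; split => //; exact: interval_open.
Qed.

Lemma continuous_plane_measurable_fun (f : R * R -> R) :
  continuous f -> measurable_fun (setT : set P) (f : P -> R).
Proof.
by move=> cf; apply: open_continuous_plane_measurable_fun => //; exact: openT.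
Qed.

(** By uniqueness of Lebesgue measure it is enough to compare it on half-open intervals with the
    image measure under [x -> c + s * x], scaled by [s]. *)
Lemma ge0_integral_affine (c s : R) (f : R -> \bar R) : 0 < s ->
  measurable_fun setT f -> (forall x, 0 <= f x)%E ->
  (\int[leb]_x f x = s%:E * \int[leb]_x f (c + s * x)%R)%E.
Proof.
move=> s0 mf f0.
pose phi : measurableTypeR R -> measurableTypeR R := fun x => c + s * x.
have mphi : measurable_fun [set: measurableTypeR R] phi.
  apply: measurable_funD; first exact: measurable_cst.
  exact: mulrl_measurable.
pose k := NngNum (ltW s0).
have E (mphi' : measurable_fun [set: measurableTypeR R] phi) A :
    measurable A -> leb A = mscale k (pushforward leb phi) A.
  apply: lebesgue_measure_unique => _ [[a b] _ <-].
  rewrite -[RHS]/(s%:E * leb (phi @^-1` `]a, b]))%E.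
  rewrite (_ : phi @^-1` _ = `](a - c) / s, (b - c) / s]%classic); last first.
    apply/seteqP; split => x /=; rewrite /phi !in_itv/= ltr_pdivrMr// ler_pdivlMr//; lra.
  rewrite !lebesgue_measure_itv/= !lte_fin ltr_pM2r ?invr_gt0// ltrD2r.
  case: ifP => _; last by rewrite mule0.
  by rewrite -!EFinB -EFinM; congr EFin; field; rewrite gt_eqF.
have -> : (\int[leb]_x f (c + s * x)%R = \int[pushforward leb phi]_x f x)%E.
  by rewrite ge0_integral_pushforward.
rewrite -(ge0_integral_mscale _ _ k)//.
by apply: eq_measure_integral => A mA _; exact: E.
Qed.

Lemma ge0_integral_plane_affine (c : R * R) (s : R) (f : R * R -> \bar R) :
  0 < s -> measurable_fun setT (f : P -> \bar R) -> (forall x, 0 <= f x)%E ->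
  (\int[leb2]_x f x = (s ^+ 2)%:E * \int[leb2]_x f (c + s *: x)%R)%E.
Proof.
move=> s0 mf f0.
have mphi : measurable_fun (setT : set P) ((fun x => c + s *: x) : P -> P).
  apply: measurable_fun_pair.
    by apply: measurable_funD => //; apply: measurable_funM.
  by apply: measurable_funD => //; apply: measurable_funM.
have mfphi : measurable_fun (setT : set P) ((fun x => f (c + s *: x)%R) : P -> \bar R).
  exact: (measurableT_comp mf mphi).
rewrite (@fubini_tonelli1 _ _ _ _ R leb leb f)//.
rewrite (@fubini_tonelli1 _ _ _ _ R leb leb (fun x : P => f (c + s *: x)%R))//.
transitivity (s%:E * \int[leb]_x fubini_F leb f (c.1 + s * x)%R)%E.
  apply: ge0_integral_affine => //; last by move=> x; apply: integral_ge0.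
  exact: (@measurable_fun_fubini_tonelli_F _ _ _ _ R leb f).
rewrite expr2 EFinM -muleA; congr (_ * _)%E.
rewrite -ge0_integralZl//; first last.
- by rewrite lee_fin ltW.
- by move=> x _; apply: integral_ge0.
- exact: (@measurable_fun_fubini_tonelli_F _ _ _ _ R leb (fun x : P => f (c + s *: x)%R)).
apply: eq_integral => x _; rewrite /fubini_F (@ge0_integral_affine c.2 s)//.
by apply: (measurableT_comp mf); exact: measurable_pair1.
Qed.

Lemma plane_boxE (a b c d : R) : a <= b -> c <= d ->
  leb2 (`[a, b] `*` `[c, d]) = ((b - a) * (d - c))%:E.
Proof.
move=> ab cd; rewrite product_measure1E//= !lebesgue_measure_itv/= !lte_fin.
move: ab cd; rewrite le_eqVlt => /predU1P[->|ab]; last rewrite ab.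
  by rewrite ltxx mul0e subrr mul0r.
rewrite le_eqVlt => /predU1P[->|cd]; last rewrite cd.
  by rewrite ltxx mule0 subrr mulr0.
by rewrite -!EFinB -EFinM.
Qed.

End PlaneMeasure.

(** * Cauchy-Schwarz, dyadic shells and dominated convergence *)

Section L2.
Context d (T : measurableType d) (R : realType) (mu : {measure set T -> \bar R}).
Variables (D : set T) (mD : measurable D) (f g : T -> R).
Hypotheses (mf : measurable_fun D f) (mg : measurable_fun D g).
Hypotheses (f2 : mu.-integrable D (fun x => (f x ^+ 2)%:E))
           (g2 : mu.-integrable D (fun x => (g x ^+ 2)%:E)).

Lemma integrable_mul_L2 : mu.-integrable D (fun x => (f x * g x)%:E).
Proof.
apply: (@le_integrable _ _ _ mu D mD _ (fun x => (f x ^+ 2)%:E + (g x ^+ 2)%:E)%E).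
- by apply/measurable_EFinP; apply: measurable_funM.
- move=> x Dx; rewrite -EFinD !abse_EFin lee_fin (ger0_norm (addr_ge0 _ _)) ?sqr_ge0//.
  rewrite normrM -(real_normK (num_real (f x))) -(real_normK (num_real (g x))).
  have := sqr_ge0 (`|f x| - `|g x|); have := normr_ge0 (f x).
  have := normr_ge0 (g x); nra.
- exact: integrableD.
Qed.

(** The quadratic polynomial [l -> int (l f + g)^2] is nonnegative, so its discriminant is not
    positive. A vanishing leading coefficient is treated apart: it forces the linear coefficient to
    vanish. *)
Lemma Rintegral_cauchy_schwarz :
  (\int[mu]_(x in D) (f x * g x)) ^+ 2 <=
  (\int[mu]_(x in D) (f x ^+ 2)) * (\int[mu]_(x in D) (g x ^+ 2)).
Proof.
have fg := integrable_mul_L2.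
set a := (\int[mu]_(x in D) (f x ^+ 2)); set b := (X in X ^+ 2); set c := (X in _ * X).
have H l : 0 <= l ^+ 2 * a + 2 * l * b + c.
  have -> : l ^+ 2 * a + 2 * l * b + c = \int[mu]_(x in D) ((l * f x + g x) ^+ 2).
    rewrite -RintegralZl// -RintegralZl// -RintegralD//; first last.
    - exact: (integrableZl mD (2 * l) fg).
    - exact: (integrableZl mD (l ^+ 2) f2).
    rewrite -RintegralD//; last first.
      rewrite (_ : _ \o _ = (fun x => (l ^+ 2)%:E * (f x ^+ 2)%:E + (2 * l)%:E * (f x * g x)%:E)%E).
        apply: integrableD => //; exact: integrableZl.
      by apply/funext => x /=; rewrite EFinD !EFinM.
    by apply: eq_Rintegral => x _; ring.
  by apply: Rintegral_ge0 => x _; exact: sqr_ge0.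
have a0 : 0 <= a by apply: Rintegral_ge0 => x _; exact: sqr_ge0.
have [a_eq0|ap] := eqVneq a 0.
  rewrite a_eq0 mul0r.
  have [->|b0] := eqVneq b 0; first by rewrite expr0n.
  (* At this [l] the affine function [2 * l * b + c] takes the value [-1]. *)
  exfalso; have := H (- (c + 1) / (2 * b)).
  rewrite a_eq0 mulr0 add0r.
  have -> : 2 * (- (c + 1) / (2 * b)) * b + c = -1 by field.
  by rewrite oppr_ge0 ler10.
have {ap}ap : 0 < a by rewrite lt_def ap.
have := H (- b / a).
have -> : (- b / a) ^+ 2 * a + 2 * (- b / a) * b + c = c - b ^+ 2 / a by field; rewrite gt_eqF.
by rewrite subr_ge0 ler_pdivrMr// mulrC.
Qed.

End L2.

Lemma scale4_index (R : realType) (rho s : R) : 0 < rho -> rho <= s ->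
  exists k : nat, 4 ^+ k * rho <= s < 4 ^+ k.+1 * rho.
Proof.
move=> r0 rs.
have ex : exists n : nat, s < 4 ^+ n * rho.
  exists (Num.truncn (s / rho)).+1.
  rewrite -ltr_pdivrMr//; apply: lt_le_trans (truncnS_gt _) _.
  rewrite -natrX ler_nat; exact: ltnW (ltn_expl _ _).
case: (ex_minnP ex) => -[|k] skr min.
  by exfalso; move: skr; rewrite expr0 mul1r ltNge rs.
exists k; rewrite skr andbT leNgt; apply/negP => /min.
by rewrite ltnn.
Qed.

Section Dyadic.
Context d (T : measurableType d) (R : realType) (mu : {measure set T -> \bar R}).

(** On the shell [4^k rho <= f < 4^(k+1) rho] the growth of the measure and the decay of [g] combine
    to [b M 2^-k]; the factor 2 is the sum of the geometric series. The exponent [a] is the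
    dimension, 1 on the boundary and 2 in the plane. Ratio 4 suits kernels containing a square root,
    which gains exactly a factor 2 per shell. *)
Lemma integral_dyadic_le (f : T -> R) (g : R -> R) (a : nat) (M b rho : R) :
  0 < rho -> 0 <= M -> 0 <= b -> measurable_fun setT f ->
  measurable_fun setT (g \o f) -> (forall s, 0 <= g s) ->
  (forall s, 0 < s -> (mu [set x | (f x < s)%R] <= (M * s ^+ a)%:E)%E) ->
  (forall k s, 4 ^+ k * rho <= s -> s < 4 ^+ k.+1 * rho ->
     g s * (4 ^+ k.+1 * rho) ^+ a <= b * 2^-1 ^+ k) ->
  (\int[mu]_(x in [set x | (rho <= f x)%R]) (g (f x))%:E <= (2 * b * M)%:E)%E.
Proof.
move=> r0 M0 b0 mf mgf g0 Hmu Hg.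
pose A k := [set x | 4 ^+ k * rho <= f x < 4 ^+ k.+1 * rho].
have mA k : measurable (A k).
  rewrite (_ : A k = f @^-1` `[4 ^+ k * rho, 4 ^+ k.+1 * rho[).
    by rewrite -[X in measurable X]setTI; apply: mf.
  by apply/seteqP; split => x /=; rewrite in_itv.
have -> : [set x | rho <= f x] = \bigcup_k A k.
  apply/seteqP; split => [x /= /(scale4_index r0)[k Ak]|x [k _ /= /andP[+ _]]].
    by exists k.
  by apply: le_trans; rewrite ler_peMl ?(ltW r0)// exprn_ege1// ler1n.
have pos4 k : 0 < 4 ^+ k * rho by rewrite mulr_gt0// exprn_gt0.
rewrite ge0_integral_bigcup//; first last.
- apply/trivIsetP => i j _ _; rewrite neq_lt.
  have disj m n : (m < n)%N -> A m `&` A n = set0.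
    move=> mn; apply/seteqP; split => // x [/= /andP[_ xm] /andP[xn _]].
    have : 4 ^+ n * rho < 4 ^+ m.+1 * rho by apply: le_lt_trans xn xm.
    by rewrite ltr_pM2r// ltr_eXn2l ?ltr1n// ltnS leqNgt mn.
  by move=> /orP[/disj//|/disj]; rewrite setIC.
- by move=> x _; rewrite lee_fin.
- by apply/measurable_EFinP; apply: measurable_funTS.
apply: (@le_trans _ _ (\sum_(0 <= k <oo) ((b * M) * 2^-1 ^+ k)%:E)%E).
  apply: lee_nneseries => k _; first by move=> _; apply: integral_ge0 => x _; rewrite lee_fin.
  pose c := b * 2^-1 ^+ k / (4 ^+ k.+1 * rho) ^+ a.
  apply: (@le_trans _ _ (\int[mu]_(x in A k) (cst c%:E) x)%E).
    apply: ge0_le_integral => //.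
    - by move=> x _; rewrite lee_fin.
    - by apply/measurable_EFinP; apply: measurable_funTS.
    - move=> x /andP[x1 x2]; rewrite lee_fin /c ler_pdivlMr ?exprn_gt0//.
      exact: Hg.
  rewrite integral_cst//.
  have c0 : 0 <= c by rewrite /c divr_ge0 ?exprn_ge0// ?mulr_ge0 ?exprn_ge0// ltW.
  apply: (@le_trans _ _ (c%:E * mu [set x | (f x < 4 ^+ k.+1 * rho)%R])%E).
    apply: lee_pmul => //; apply: le_measure; rewrite ?inE//.
      rewrite (_ : [set x | _] = f @^-1` `]-oo, 4 ^+ k.+1 * rho[).
        by rewrite -[X in measurable X]setTI; apply: mf.
      by apply/seteqP; split => x /=; rewrite in_itv.
    by move=> x /= /andP[].
  apply: (@le_trans _ _ (c%:E * (M * (4 ^+ k.+1 * rho) ^+ a)%:E)%E).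
    by apply: lee_pmul => //; exact: Hmu.
  rewrite -EFinM lee_fin /c le_eqVlt; apply/orP; left; apply/eqP.
  have := pos4 k.+1; set t := 4 ^+ k.+1 * rho => t0; field.
  by rewrite expf_neq0// gt_eqF.
have -> : (\sum_(0 <= k <oo) ((b * M) * 2^-1 ^+ k)%:E = (2 * b * M)%:E)%E.
  have := @cvg_geometric_eseries_half R (2 * b * M) 0.
  rewrite expr0 divr1 => /cvg_lim <-//; apply: eq_eseriesr => k _.
  by congr EFin; rewrite addn1 natrX exprS exprVn; field; rewrite expf_neq0.
by [].
Qed.

End Dyadic.

Section DominatedConvergence.
Context d (T : measurableType d) (R : realType) (mu : {measure set T -> \bar R}).
Variables (D : set T) (mD : measurable D).

Lemma Rintegral_dominated_cvg (f_ : nat -> T -> R) (f g : T -> R) :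
  (forall n, measurable_fun D (f_ n)) -> measurable_fun D f ->
  (forall x, D x -> f_ n x @[n --> \oo] --> f x) ->
  mu.-integrable D (EFin \o g) -> (forall n x, D x -> `|f_ n x| <= g x) ->
  mu.-integrable D (EFin \o f) /\
  \int[mu]_(x in D) f_ n x @[n --> \oo] --> \int[mu]_(x in D) f x.
Proof.
move=> mf_ mf cf ig fg.
have H1 n : measurable_fun D (EFin \o f_ n) by apply/measurable_EFinP.
have H2 : measurable_fun D (EFin \o f) by apply/measurable_EFinP.
have H3 : {ae mu, forall x, D x -> (EFin \o f_ n) x @[n --> \oo] --> (EFin \o f) x}.
  by apply: aeW => x Dx; apply/fine_cvgP; split; [exact: nearW|exact: cf].
have H4 : {ae mu, forall x n, D x -> (`|(EFin \o f_ n) x| <= (EFin \o g) x)%E}.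
  by apply: aeW => x n Dx; rewrite /= lee_fin; exact: fg.
have [If _ cv] := dominated_convergence mD H1 H2 H3 ig H4.
split => //; apply: fine_cvg; rewrite fineK//.
exact: integrable_fin_num.
Qed.

End DominatedConvergence.

(** * Differentiability in the plane *)

Section Differentiable.
Context {R : realType}.
Local Notation plane := (R * R)%type.

Lemma differentiable_expansion (V : normedModType R) (f : V -> R)
    (L : {linear V -> R}) (x : V) : continuous L ->
  f \o shift x = cst (f x) + L +o_ 0 id ->
  differentiable f x /\ 'd f x = L :> (V -> R).
Proof.
move=> cL fL; have E := diff_unique cL fL.
by split => //; apply/diff_locallyP; rewrite E.
Qed.

Lemma near_differentiable (f g : plane -> R) (x : plane) :
  (\near x, f x = g x) -> differentiable f x -> differentiable g x.
Proof.
move=> fg /diff_locallyP[cd /eqaddoP df].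
have [] // := @differentiable_expansion _ g ('d f x) x.
apply/eqaddoP => e e0; have := df e e0 => dfe.
have fg0 : \forall h \near (0 : plane), f (h + x) = g (h + x).
  rewrite (near_shift x); apply: filterS fg => y /=.
  by rewrite sub0r addrNK.
have fgxx : f x = g x by exact: nbhs_singleton fg.
near=> h.
have fgh : f (h + x) = g (h + x) by near: h.
have : `|(f \o shift x - (cst (f x) + 'd f x)) h| <= e * `|h| by near: h.
rewrite -![(_ + _ : _ -> _) _]/(_ + _) -![(- _ : _ -> _) _]/(- _).
by rewrite -![(_ + _ : _ -> _) _]/(_ + _) /= fgh fgxx.
Unshelve. all: by end_near. Qed.

Lemma dirderiv (f : plane -> R) (x v : plane) : differentiable f x ->
  'd f x v = v.1 * partial false f x + v.2 * partial true f x.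
Proof.
move=> df; rewrite /partial !deriveE//.
rewrite {1}(_ : v = v.1 *: Defs.basis false + v.2 *: Defs.basis true); last first.
  by rewrite /Defs.basis [LHS]surjective_pairing; congr pair => /=; rewrite /GRing.scale/=; ring.
by rewrite linearD !linearZ.
Qed.

Definition lin2 (a b : R) (v : plane) : R := v.1 * a + v.2 * b.

Lemma lin2_is_linear a b : linear (lin2 a b).
Proof. by move=> k u v; rewrite /lin2/= /GRing.scale/=; ring. Qed.

HB.instance Definition _ a b := GRing.isLinear.Build R plane R _ (lin2 a b) (lin2_is_linear a b).

Lemma lin2_continuous a b : continuous (lin2 a b).
Proof.
move=> v; apply: cvgD; apply: cvgM; try exact: cvg_cst.
exact: cvg_fst. exact: cvg_snd.
Qed.

(** A quadratic remainder is in particular [o(|v|)]. In this form differentiability passes under an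
    integral: remainders that are uniform in the parameter integrate to a remainder of the same
    kind. *)
Lemma differentiable_quadratic (f : plane -> R) (x : plane) (a b C d : R) :
  0 < d -> 
  (forall v, `|v| < d -> `|f (x + v) - f x - (v.1 * a + v.2 * b)| <= C * `|v| ^+ 2) ->
  [/\ differentiable f x, partial false f x = a & partial true f x = b].
Proof.
move=> d0 H.
have [|df dE] := @differentiable_expansion _ f (lin2 a b) x (@lin2_continuous a b).
  apply/eqaddoP => e e0.
  have C1 : 0 < `|C| + 1 by rewrite ltr_wpDl.
  have near1 : \forall h \near (0 : plane), `|h| < d by exact: nbhs0_lt.
  have near2 : \forall h \near (0 : plane), `|h| < e / (`|C| + 1).
    by apply: nbhs0_lt; rewrite divr_gt0.
  near=> h.
  have hd : `|h| < d by near: h.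
  have -> : (f \o shift x - (cst (f x) + lin2 a b)) h = f (x + h) - f x - (h.1 * a + h.2 * b).
    by rewrite /lin2 -![(_ + _ : _ -> _) _]/(_ + _) /= [h + x]addrC opprD addrA.
  apply: le_trans (H _ hd) _.
  rewrite expr2 mulrA ler_wpM2r//.
  have hC : `|h| < e / (`|C| + 1).
    by near: h.
  apply: le_trans (_ : (`|C| + 1) * `|h| <= _).
    by rewrite ler_wpM2r// (le_trans (ler_norm _))// lerDl.
  by move: hC; rewrite ltr_pdivlMr// mulrC => /ltW.
have pE u : 'd f x u = u.1 * a + u.2 * b by rewrite dE.
by split; [|rewrite /partial deriveE// pE /Defs.basis/= mul1r mul0r addr0|
  rewrite /partial deriveE// pE /Defs.basis/= mul1r mul0r add0r].
Unshelve. all: by end_near. Qed.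

Lemma is_derive_path (f : plane -> R) (g : R -> plane) (g1 g2 : R) (t : R) :
  differentiable f (g t) -> is_derive t 1 (fst \o g) g1 -> is_derive t 1 (snd \o g) g2 ->
  is_derive t 1 (f \o g) (g1 * partial false f (g t) + g2 * partial true f (g t)).
Proof.
move=> df [d1 e1] [d2 e2].
have dg1 : differentiable (fst \o g) t by apply/derivable1_diffP.
have dg2 : differentiable (snd \o g) t by apply/derivable1_diffP.
have dg : differentiable g t.
  rewrite (_ : g = fun u => ((fst \o g) u, (snd \o g) u)); last first.
    by apply/funext => u /=; rewrite -surjective_pairing.
  exact: differentiable_pair.
have dg' : 'd g t 1 = (g1, g2).
  rewrite -e1 -e2 -!derive1E.
  have : 'd (fun u => ((fst \o g) u, (snd \o g) u)) t 1 = ('d (fst \o g) t 1, 'd (snd \o g) t 1).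
    by rewrite diff_pair.
  rewrite (_ : (fun u => _) = g); last first.
    by apply/funext => u /=; rewrite -surjective_pairing.
  by move=> ->; rewrite !derive1E !deriveE.
have dfg : differentiable (f \o g) t by exact: differentiable_comp.
split; first by apply/derivable1_diffP.
by rewrite deriveE// diff_comp//= dg' dirderiv.
Qed.

Lemma is_derive_segment (f : plane -> R) (x v : plane) (t : R) :
  differentiable f (x + t *: v) ->
  is_derive t 1 (fun s => f (x + s *: v))
    (v.1 * partial false f (x + t *: v) + v.2 * partial true f (x + t *: v)).
Proof.
move=> df; apply: (@is_derive_path f (fun s => x + s *: v)) => //.
  rewrite (_ : _ \o _ = cst x.1 + v.1 \*: id); last first.
    by apply/funext => s; rewrite /= -[RHS]/(x.1 + v.1 * s) mulrC.
  by apply: is_derive_eq; rewrite add0r /GRing.scale/= mulr1.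
rewrite (_ : _ \o _ = cst x.2 + v.2 \*: id); last first.
    by apply/funext => s; rewrite /= -[RHS]/(x.2 + v.2 * s) mulrC.
by apply: is_derive_eq; rewrite add0r /GRing.scale/= mulr1.
Qed.

End Differentiable.

(** * Smooth functions on open sets *)

Section SmoothOn.
Context {R : realType}.
Local Notation plane := (R * R)%type.
Implicit Types (U : set plane) (f g : plane -> R).

(** Localises [smooth] to a set and counts the order of differentiation, so that stability under
    products, inverses and compositions goes by induction on the order. *)
Fixpoint smooth_upto (n : nat) U f : Prop :=
  if n is m.+1 then
    (forall x, U x -> differentiable f x) /\ forall b, smooth_upto m U (partial b f)
  else True.

Definition smooth_on U f := forall n, smooth_upto n U f.

Lemma smooth_onT f : smooth f <-> smooth_on setT f.
Proof.
split => [sf n|sf s].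
  elim: n f sf => //= n IH f sf; split; first by move=> x _; exact: (sf [::]).
  by move=> b; apply: IH => s x; have := sf (rcons s b) x; rewrite foldr_rcons.
elim/last_ind: s f sf => [|s b IH] f sf x; first by have [df _] := sf 1%N; exact: df.
rewrite foldr_rcons; apply: IH => n; have [_ pf] := sf n.+1; exact: pf.
Qed.

Lemma smooth_on_partial U f b : smooth_on U f -> smooth_on U (partial b f).
Proof. by move=> sf n; have [_ pf] := sf n.+1; exact: pf. Qed.

Lemma smooth_on_differentiable U f x : smooth_on U f -> U x -> differentiable f x.
Proof. by move=> sf; have [df _] := sf 1%N; exact: df. Qed.

Lemma smooth_on_continuous U f : smooth_on U f -> {in U, continuous f}.
Proof.
by move=> sf x /set_mem Ux; apply: differentiable_continuous; exact: smooth_on_differentiable Ux.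
Qed.

Lemma smooth_uptoS n U V f : V `<=` U -> smooth_upto n U f -> smooth_upto n V f.
Proof.
move=> VU; elim: n f => //= n IH f [df pf]; split; first by move=> x /VU; exact: df.
by move=> b; exact: IH.
Qed.

Lemma smooth_uptoW n U f : smooth_upto n.+1 U f -> smooth_upto n U f.
Proof.
elim: n f => //= n IH f [df pf]; split => // b; exact: IH.
Qed.

(** Each order is a pointwise condition on one globally defined function, so it can be checked on
    the pieces of a cover. *)
Lemma smooth_uptoU n U V f : smooth_upto n U f -> smooth_upto n V f -> smooth_upto n (U `|` V) f.
Proof.
elim: n f => //= n IH f [df pf] [df' pf']; split; first by move=> x [/df|/df'].
by move=> b; exact: IH.
Qed.

Lemma eq_smooth_upto n U f g : open U -> (forall x, U x -> f x = g x) ->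
  smooth_upto n U f -> smooth_upto n U g.
Proof.
move=> oU; elim: n f g => //= n IH f g fg [df pf].
have nfg x : U x -> \near x, f x = g x.
  by move=> Ux; apply: filterS (open_nbhs_nbhs (conj oU Ux)) => y; exact: fg.
split; first by move=> x Ux; apply: near_differentiable (nfg x Ux) _; exact: df.
move=> b; apply: IH (pf b) => x Ux; exact/near_eq_derive/nfg.
Qed.

Lemma smooth_upto_cst n U c : smooth_upto n U (cst c).
Proof.
elim: n c => //= n IH c; split; first by move=> x _; exact: differentiable_cst.
by move=> b; rewrite (_ : partial b _ = cst 0)//; apply/funext => x; exact: derive_cst.
Qed.

Lemma smooth_upto_add n U f g : open U -> smooth_upto n U f -> smooth_upto n U g ->
  smooth_upto n U (fun x => f x + g x).
Proof.
move=> oU; elim: n f g => //= n IH f g [df pf] [dg pg]; split.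
  by move=> x Ux; apply: differentiableD; [exact: df|exact: dg].
move=> b; apply: eq_smooth_upto (IH _ _ (pf b) (pg b)) => // x Ux.
by rewrite /partial; symmetry; apply: deriveD; apply: diff_derivable; [exact: df|exact: dg].
Qed.

Lemma smooth_upto_mul n U f g : open U -> smooth_upto n U f -> smooth_upto n U g ->
  smooth_upto n U (fun x => f x * g x).
Proof.
move=> oU; elim: n f g => //= n IH f g sf sg.
have [sf' sg'] := (@smooth_uptoW n _ f sf, @smooth_uptoW n _ g sg).
move: sf sg => [df pf] [dg pg]; split.
  by move=> x Ux; apply: differentiableM; [exact: df|exact: dg].
move=> b; apply: (@eq_smooth_upto _ _ (fun x => f x * partial b g x + g x * partial b f x)) => //.
  move=> x Ux; rewrite /partial; symmetry; apply: deriveM; apply: diff_derivable;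
   [exact: df|exact: dg].
by apply: smooth_upto_add => //; apply: IH.
Qed.

Lemma smooth_upto_inv n U f : open U -> (forall x, U x -> f x != 0) ->
  smooth_upto n U f -> smooth_upto n U (fun x => (f x)^-1).
Proof.
move=> oU f0; elim: n => //= n IH sf.
have sf' := IH (@smooth_uptoW n _ f sf).
move: sf => [df pf]; split.
  by move=> x Ux; apply: differentiableV; [exact: df|exact: f0].
move=> b; apply: (@eq_smooth_upto _ _
    (fun x => (-1 * ((f x)^-1 * (f x)^-1)) * partial b f x)) => //.
  move=> x Ux; rewrite /partial deriveV ?f0//; last by apply: diff_derivable; exact: df.
  by rewrite /GRing.scale/= -exprVn expr2 mulN1r.
apply: smooth_upto_mul => //; apply: smooth_upto_mul => //; first exact: smooth_upto_cst.
exact: smooth_upto_mul.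
Qed.

(** The outer function comes with the sequence of its derivatives. The conclusion ranges over all
    [k] because one differentiation passes from [h k] to [h k.+1]. *)
Lemma smooth_upto_comp n U f (h : nat -> R -> R) : open U ->
  (forall k (t : R), is_derive t (1 : R) (h k) (h k.+1 t)) ->
  smooth_upto n U f -> forall k, smooth_upto n U (fun x => h k (f x)).
Proof.
move=> oU dh; elim: n => //= n IH sf k.
have sf' := IH (@smooth_uptoW n _ f sf).
move: sf => [df pf].
have dhd t m : differentiable (h m) t by apply/derivable1_diffP; exact: ex_derive.
split; first by move=> x Ux; apply: differentiable_comp => //; exact: df.
move=> b; apply: (@eq_smooth_upto _ _ (fun x => h k.+1 (f x) * partial b f x)) => //.
  move=> x Ux; rewrite /partial.
  rewrite (@deriveE _ _ _ (fun y => h k (f y))); last first.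
    by apply: differentiable_comp => //; exact: df.
  rewrite (@diff_comp _ _ _ _ f (h k))//=; last exact: df.
  rewrite -(@deriveE _ _ _ f); last exact: df.
  have := @deriveE _ _ _ (h k) (f x) 1 (dhd _ _); rewrite derive_val => hE.
  set y := 'D_(Defs.basis b) f x.
  have -> : 'd (h k) (f x) y = 'd (h k) (f x) (y *: (1 : R)) by rewrite /GRing.scale/= mulr1.
  by rewrite linearZ/= -hE /GRing.scale/= mulrC.
by apply: smooth_upto_mul.
Qed.

Lemma smooth_on_fst U : smooth_on U (fun x => x.1).
Proof.
case=> //= n; have dfst (x : plane) : differentiable (fun x : plane => x.1 : R) x.
  by apply: (@linear_differentiable _ _ _ (fst : {linear plane -> R})) => y; exact: cvg_fst.
split => // b.
rewrite (_ : partial b _ = cst (Defs.basis b).1); first exact: smooth_upto_cst.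
apply/funext => x; rewrite /partial deriveE//.
have -> // : 'd (fun y : plane => y.1 : R) x = fst :> (plane -> R).
by apply: (@diff_lin _ _ _ (fst : {linear plane -> R})) => y; exact: cvg_fst.
Qed.

Lemma smooth_on_snd U : smooth_on U (fun x => x.2).
Proof.
case=> //= n; have dsnd (x : plane) : differentiable (fun x : plane => x.2 : R) x.
  by apply: (@linear_differentiable _ _ _ (snd : {linear plane -> R})) => y; exact: cvg_snd.
split => // b.
rewrite (_ : partial b _ = cst (Defs.basis b).2); first exact: smooth_upto_cst.
apply/funext => x; rewrite /partial deriveE//.
have -> // : 'd (fun y : plane => y.2 : R) x = snd :> (plane -> R).
by apply: (@diff_lin _ _ _ (snd : {linear plane -> R})) => y; exact: cvg_snd.
Qed.

End SmoothOn.

(** * Mean value, Taylor and compactness bounds *)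

Section MeanValue.
Context {R : realType}.
Local Notation plane := (R * R)%type.

Lemma plane_norm1 (v : plane) : `|v.1| <= `|v|.
Proof. by rewrite [leRHS]/Num.norm/= le_max lexx. Qed.

Lemma plane_norm2 (v : plane) : `|v.2| <= `|v|.
Proof. by rewrite [leRHS]/Num.norm/= le_max lexx orbT. Qed.

Lemma plane_norm_le (v : plane) (M : R) : (`|v| <= M) = (`|v.1| <= M) && (`|v.2| <= M).
Proof. by rewrite [in LHS]/Num.norm/= ge_max. Qed.

Lemma mean_value_le (f : plane -> R) (x v : plane) (B : R) :
  (forall s, 0 <= s <= 1 -> differentiable f (x + s *: v)) ->
  (forall s b, 0 <= s <= 1 -> `|partial b f (x + s *: v)| <= B) ->
  `|f (x + v) - f x| <= 2 * B * `|v|.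
Proof.
move=> df Bf.
have [||c c01] := @MVT R (fun s => f (x + s *: v))
    (fun s => v.1 * partial false f (x + s *: v) + v.2 * partial true f (x + s *: v)) 0 1 ltr01.
- move=> t; rewrite in_itv/= => /andP[t0 t1].
  by apply: is_derive_segment; apply: df; rewrite !ltW.
- apply: derivable_within_continuous => t; rewrite in_itv/= => t01.
  by apply: ex_derive; apply: is_derive_segment; apply: df.
have {}c01 : 0 <= c <= 1 by move: c01; rewrite in_itv/= => /andP[c0 c1]; rewrite !ltW.
rewrite scale1r scale0r addr0 subr0 mulr1 => ->.
apply: le_trans (ler_normD _ _) _; rewrite !normrM.
have B1 := Bf c false c01; have B2 := Bf c true c01.
rewrite (_ : 2 * B * `|v| = `|v| * B + `|v| * B); last by ring.
by apply: lerD; apply: ler_pM => //; [exact: plane_norm1|exact: plane_norm2].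
Qed.

(** The mean value theorem along the segment leaves differences of first partials, which
    [mean_value_le] bounds by [2 B |v|]. In the sup norm each of the two coordinates contributes one
    such term, whence the 4. *)
Lemma taylor2_le (f : plane -> R) (x v : plane) (B : R) :
  (forall s, 0 <= s <= 1 -> differentiable f (x + s *: v)) ->
  (forall s b, 0 <= s <= 1 -> differentiable (partial b f) (x + s *: v)) ->
  (forall s b c, 0 <= s <= 1 -> `|partial c (partial b f) (x + s *: v)| <= B) ->
  `|f (x + v) - f x - (v.1 * partial false f x + v.2 * partial true f x)| <=
  4 * B * `|v| ^+ 2.
Proof.
move=> df d2f Bf.
have [||c c01] := @MVT R (fun s => f (x + s *: v))
    (fun s => v.1 * partial false f (x + s *: v) + v.2 * partial true f (x + s *: v)) 0 1 ltr01.
- move=> t; rewrite in_itv/= => /andP[t0 t1].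
  by apply: is_derive_segment; apply: df; rewrite !ltW.
- apply: derivable_within_continuous => t; rewrite in_itv/= => t01.
  by apply: ex_derive; apply: is_derive_segment; apply: df.
have {}c01 : 0 <= c <= 1 by move: c01; rewrite in_itv/= => /andP[c0 c1]; rewrite !ltW.
have [c0 c1] := andP c01.
rewrite scale1r scale0r addr0 subr0 mulr1 => ->.
have H b : `|partial b f (x + c *: v) - partial b f x| <= 2 * B * `|v|.
  have B0 : 0 <= B by apply: le_trans (Bf 0 true true _); rewrite ?lexx ?ler01.
  have cs s : 0 <= s <= 1 -> 0 <= s * c <= 1.
    by move=> /andP[s0 s1]; rewrite mulr_ge0//= mulr_ile1.
  apply: le_trans (@mean_value_le (partial b f) x (c *: v) B _ _) _.
  - by move=> s s01; rewrite scalerA; apply: d2f; exact: cs.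
  - by move=> s b' s01; rewrite scalerA; apply: Bf; exact: cs.
  by rewrite normrZ (ger0_norm c0) ler_wpM2l ?mulr_ge0// ler_piMl.
rewrite [X in `|X|](_ : _ = v.1 * (partial false f (x + c *: v) - partial false f x) +
   v.2 * (partial true f (x + c *: v) - partial true f x)); last by ring.
apply: le_trans (ler_normD _ _) _; rewrite !normrM.
rewrite (_ : 4 * B * `|v| ^+ 2 = `|v| * (2 * B * `|v|) + `|v| * (2 * B * `|v|)); last by ring.
by apply: lerD; apply: ler_pM => //; [exact: plane_norm1|exact: plane_norm2].
Qed.

Lemma plane_bounded_closed_compact (A : set plane) (M : R) :
  closed A -> (forall x, A x -> `|x| <= M) -> compact A.
Proof.
move=> cA AM; apply: (@subclosed_compact _ _ (`[- M, M] `*` `[- M, M])) => //.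
  by apply: compact_setX; exact: segment_compact.
by move=> x /AM; rewrite plane_norm_le !ler_norml => /andP[? ?]; split; rewrite /= in_itv.
Qed.

Lemma continuous_compact_bound (f : plane -> R) (A : set plane) : compact A ->
  {in A, continuous f} -> exists B, forall x, A x -> `|f x| <= B.
Proof.
move=> cA cf.
have /continuous_compact /(_ cA) /compact_bounded : {within A, continuous f}.
  exact: continuous_in_subspaceT.
case=> B [_ HB]; exists (B + 1) => x Ax.
by apply: (HB (B + 1)); [rewrite ltrDl|exists x].
Qed.

End MeanValue.

(** * The flat function [exp (- 1 / t)] *)

Section ExpInv.
Context {R : realType}.

(** [expR y] is the [n]-th power of [expR (y / n)], which is at least [y / n]. *)
Lemma expr_le_expR (n : nat) : exists2 C : R, 0 <= C & forall y, 0 <= y -> y ^+ n <= C * expR y.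
Proof.
case: n => [|n].
  by exists 1 => // y y0; rewrite expr0 mul1r; apply: le_trans (expR_ge1Dx _); rewrite lerDl.
exists (n.+1%:R ^+ n.+1) => [|y y0]; first by rewrite exprn_ge0.
have -> : expR y = expR (y / n.+1%:R) ^+ n.+1.
  by rewrite -expRM_natl mulrC divfK.
rewrite -exprMn ler_pXn2r ?nnegrE ?mulr_ge0 ?expR_ge0//.
rewrite mulrC -ler_pdivrMr//; apply: le_trans (expR_ge1Dx _).
by rewrite lerDr.
Qed.

Lemma horner_le_expR (p : {poly R}) :
  exists2 C : R, 0 <= C & forall y, 0 <= y -> `|p.[y]| <= C * expR y.
Proof.
have H (n : nat) : exists2 C : R, 0 <= C & forall y, 0 <= y ->
    \sum_(i < n) `|p`_i| * y ^+ i <= C * expR y.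
  elim: n => [|n [C C0 IH]].
    by exists 0 => // y _; rewrite big_ord0 mul0r.
  have [D D0 HD] := expr_le_expR n.
  exists (C + `|p`_n| * D) => [|y y0]; first by rewrite addr_ge0// mulr_ge0.
  rewrite big_ord_recr/= mulrDl lerD ?IH// -mulrA ler_wpM2l//; exact: HD.
have [C C0 HC] := H (size p); exists C => // y y0.
apply: le_trans (HC y y0); rewrite horner_coef; apply: le_trans (ler_norm_sum _ _ _) _.
by apply: ler_sum => i _; rewrite normrM normrX (ger0_norm y0).
Qed.

(** Differentiating [p(1/t) exp(-1/t)] gives [t^-2 (p - p')(1/t) exp(-1/t)], which is the
    recursion. *)
Fixpoint expinv_poly (k : nat) : {poly R} :=
  if k is k'.+1 then 'X^2 * (expinv_poly k' - (expinv_poly k')^`()) else 1.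

(* [expinv k] is the [k]-th derivative of the function equal to
   [exp (- 1 / t)] for [t > 0] and to [0] elsewhere. *)
Definition expinv (k : nat) (t : R) : R :=
  if 0 < t then (expinv_poly k).[t^-1] * expR (- t^-1) else 0.

(** The exponential dominates [y^2 p(y)] at [y = 1/t]. Quadratic flatness is what gives every
    [expinv k] the derivative [0] at the origin. *)
Lemma expinv_quadratic k : exists2 C : R, 0 <= C & forall t, `|expinv k t| <= C * t ^+ 2.
Proof.
have [C C0 HC] := horner_le_expR ('X^2 * expinv_poly k).
exists C => // t; rewrite /expinv; case: ifPn => [t0|_]; last by rewrite normr0 mulr_ge0 ?sqr_ge0.
have := HC t^-1; rewrite invr_ge0 => /(_ (ltW t0)).
rewrite hornerM hornerXn normrM (ger0_norm (exprn_ge0 _ _)) ?invr_ge0 ?(ltW t0)// => H.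
rewrite normrM (ger0_norm (expR_ge0 _)) expRN -ler_pdivlMr ?invr_gt0 ?expR_gt0// invrK.
rewrite exprVn in H; move: H; rewrite ler_pdivrMl ?exprn_gt0// => H.
by apply: le_trans H _; rewrite mulrA [t ^+ 2 * C]mulrC.
Qed.

Lemma is_derive_expinv k (t : R) : is_derive t (1 : R) (expinv k) (expinv k.+1 t).
Proof.
have [t0|t0|<-] := ltgtP 0 t.
- apply: (@near_eq_is_derive R R R (fun t => (expinv_poly k).[t^-1] * expR (- t^-1))).
    by near=> s; rewrite /expinv ifT//; near: s; exact: lt_nbhsr.
  rewrite /expinv t0.
  have d1 : is_derive t (1 : R) (fun s : R => s^-1) (- t ^- 2).
    apply: is_derive_eq; first by apply: is_deriveV; rewrite gt_eqF.
    by rewrite /GRing.scale/= mulr1.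
  have d2 : is_derive t (1 : R) (horner (expinv_poly k) \o (fun s : R => s^-1))
      ((expinv_poly k)^`().[t^-1] * - t ^- 2).
    exact: is_derive1_comp.
  have d3' : is_derive t (1 : R) (fun s : R => - s^-1) (t ^- 2).
    by apply: is_derive_eq (is_deriveN d1) _; rewrite opprK.
  have d3 : is_derive t (1 : R) (expR \o (fun s : R => - s^-1)) (expR (- t^-1) * t ^- 2).
    exact: is_derive1_comp.
  apply: is_derive_eq (is_deriveM d2 d3) _.
  rewrite /= !hornerE /GRing.scale/= exprVn; ring.
- apply: (@near_eq_is_derive R R R (cst 0)).
    by near=> s; rewrite /expinv ifF//; apply/negbTE; rewrite -leNgt ltW//; near: s; exact: lt_nbhsl.
  by rewrite /expinv ifF; [apply: is_derive_eq|apply/negbTE; rewrite -leNgt ltW].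
- have [C C0 HC] := expinv_quadratic k.
  have e0 : expinv k 0 = 0 by rewrite /expinv ltxx.
  have cv : (fun h : R => h^-1 *: (expinv k (h *: 1 + 0) - expinv k 0)) @ 0^' --> (0 : R).
    apply/cvgr0Pnorm_le => e epos.
    have n1 : \forall h \near (0 : R)^', `|h| < e / (C + 1).
      have n0 : \forall h \near (0 : R), `|h| < e / (C + 1).
        by apply: nbhs0_lt; rewrite divr_gt0// ltr_wpDl.
      exact: nbhs_dnbhs n0.
    near=> h.
    have h0 : h != 0 by near: h; exact: nbhs_dnbhs_neq.
    rewrite addr0 e0 subr0 /GRing.scale/= mulr1 normrM normfV ler_pdivrMl ?normr_gt0//.
    apply: le_trans (HC h) _; rewrite -(real_normK (num_real h)) expr2 mulrCA mulrA -mulrA.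
    rewrite ler_wpM2l//.
    have : `|h| < e / (C + 1) by near: h.
    rewrite ltr_pdivlMr ?ltr_wpDl// => /ltW; apply: le_trans.
    by rewrite mulrC ler_wpM2l// lerDl.
  rewrite {2}/expinv ltxx; split; first by apply/cvg_ex; exists 0.
  exact: cvg_lim cv.
Unshelve. all: by end_near. Qed.

Lemma expinv0_ge0 (t : R) : 0 <= expinv 0 t.
Proof. by rewrite /expinv; case: ifP => // _; rewrite hornerE mul1r expR_ge0. Qed.

Lemma expinv0_le1 (t : R) : expinv 0 t <= 1.
Proof.
rewrite /expinv; case: ifP => // t0; rewrite hornerE mul1r -[leRHS]expR0 ler_expR.
by rewrite oppr_le0 invr_ge0 ltW.
Qed.

Lemma expinv0_gt0 (t : R) : 0 < t -> 0 < expinv 0 t.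
Proof. by move=> t0; rewrite /expinv t0 hornerE mul1r expR_gt0. Qed.

Lemma expinv_le0 k (t : R) : t <= 0 -> expinv k t = 0.
Proof. by rewrite leNgt => /negbTE t0; rewrite /expinv t0. Qed.

Lemma expinv0_ge (t : R) : 0 < t -> 1 - t^-1 <= expinv 0 t.
Proof. by move=> t0; rewrite /expinv t0 hornerE mul1r; exact: expR_ge1Dx. Qed.

Lemma expinv1_le : exists2 C : R, 0 <= C & forall t, `|expinv 1 t| <= C.
Proof.
have [C C0 HC] := horner_le_expR (expinv_poly 1); exists C => // t.
rewrite /expinv; case: ifP => t0; last by rewrite normr0.
rewrite normrM (ger0_norm (expR_ge0 _)) expRN -ler_pdivlMr ?invr_gt0 ?expR_gt0// invrK.
by apply: HC; rewrite invr_ge0 ltW.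
Qed.

End ExpInv.

(** * Differentiation under the integral sign *)

Section ParamIntegral.
Context {R : realType}.
Local Notation plane := (R * R)%type.
Local Notation P := (measurableTypeR R * measurableTypeR R)%type.
Context d (T : measurableType d) (mu : {finite_measure set T -> \bar R}).
Variables (G : T -> plane) (mG : measurable_fun setT (G : T -> P)).
Variables (h : T -> R) (mh : measurable_fun setT h).
Variables (B Bh : R) (GB : forall t, `|G t| <= B) (hB : forall t, `|h t| <= Bh).

Let U0 : set plane := ~` [set 0].

Lemma open_setC0 : open U0.
Proof. by rewrite openC; apply: accessible_closed_set1; apply: hausdorff_accessible; exact: norm_hausdorff. Qed.

Lemma annulus_compact (e M : R) : compact [set y : plane | e <= `|y| <= M].
Proof.
apply: (@plane_bounded_closed_compact _ _ M) => [|x /andP[]//].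
rewrite (_ : [set y | _] = [set y : plane | e <= `|y|] `&` [set y : plane | `|y| <= M]); last first.
  by apply/seteqP; split => x /= => [/andP[]//|[-> ->]].
apply: closedI.
  apply: (@preimage_closed _ _ (fun y : plane => `|y|) [set y | e <= y]); first by move=> y *; exact: norm_continuous.
  exact: closed_ge.
apply: (@preimage_closed _ _ (fun y : plane => `|y|) [set y | y <= M]); first by move=> y *; exact: norm_continuous.
exact: closed_le.
Qed.

Section fixed_kernel.
Variables (p : plane -> R) (sp : smooth_on U0 p).
Variables (x : plane) (e : R) (e0 : 0 < e) (xe : forall t, e <= `|x - G t|).

Let x_sub_G_neq0 t : U0 (x - G t).
Proof. by move=> E; have := xe t; rewrite E normr0 leNgt e0. Qed.

Lemma kernel_measurable : measurable_fun setT (fun t => h t * p (x - G t)).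
Proof.
apply: measurable_funM => //.
apply: (@measurable_comp _ _ _ _ _ _ (U0 : set P) (p : P -> R) _ ((fun t => x - G t) : T -> P)).
- by apply: open_plane_measurable; exact: open_setC0.
- by move=> _ [t _ <-].
- apply: open_continuous_plane_measurable_fun; first exact: open_setC0.
  exact: smooth_on_continuous.
- have m1 := measurableT_comp measurable_fst mG.
  have m2 := measurableT_comp measurable_snd mG.
  by apply: measurable_fun_pair; apply: measurable_funB.
Qed.

Lemma kernel_integrable : mu.-integrable setT (EFin \o (fun t => h t * p (x - G t))).
Proof.
have [C HC] : exists C, forall y : plane, e <= `|y| <= `|x| + B -> `|p y| <= C.
  apply: continuous_compact_bound; first exact: annulus_compact.
  move=> y /set_mem /andP[ey _]; apply: (smooth_on_continuous sp); apply/mem_set => y0.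
  by move: ey; rewrite y0 normr0 leNgt e0.
apply: measurable_bounded_integrable => //.
- exact: fin_num_fun_lty.
- exact: kernel_measurable.
exists (Bh * C); split; first exact: num_real.
move=> M BM t _; apply: le_trans (ltW BM); rewrite normrM ler_pM//.
by apply: HC; rewrite xe/=; apply: le_trans (ler_normB _ _) _; rewrite lerD2l.
Qed.

End fixed_kernel.

(** For [|v| < e / 2] the segment from [x - G t] to [x - G t + v] stays in one annulus away from the
    origin, the same for all [t]. The second partials of [p] are bounded there, so the Taylor
    remainder is quadratic uniformly in [t], and the measure is finite. *)
Lemma param_integral_derive (p : plane -> R) (x : plane) (e : R) :
  smooth_on U0 p -> 0 < e -> (forall t, e <= `|x - G t|) ->
  [/\ differentiable (fun x => \int[mu]_t (h t * p (x - G t))) x,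
    partial false (fun x => \int[mu]_t (h t * p (x - G t))) x =
      \int[mu]_t (h t * partial false p (x - G t)) &
    partial true (fun x => \int[mu]_t (h t * p (x - G t))) x =
      \int[mu]_t (h t * partial true p (x - G t))].
Proof.
move=> sp e0 xe.
have e20 : 0 < e / 2 by rewrite divr_gt0.
have [C HC] : exists C, forall b c, forall y : plane, e / 2 <= `|y| <= `|x| + B + e / 2 ->
    `|partial c (partial b p) y| <= C.
  have HC b c : exists C, forall y : plane, e / 2 <= `|y| <= `|x| + B + e / 2 ->
      `|partial c (partial b p) y| <= C.
    apply: continuous_compact_bound; first exact: annulus_compact.
    move=> y /set_mem /andP[ey _].
    apply: (smooth_on_continuous (smooth_on_partial c (smooth_on_partial b sp))).
    by apply/mem_set => y0; move: ey; rewrite y0 normr0 leNgt e20.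
  have [C1 H1] := HC false false; have [C2 H2] := HC false true.
  have [C3 H3] := HC true false; have [C4 H4] := HC true true.
  exists (`|C1| + `|C2| + `|C3| + `|C4|) => b c y Hy.
  have [n1 n2 n3 n4] := And4 (normr_ge0 C1) (normr_ge0 C2) (normr_ge0 C3) (normr_ge0 C4).
  have [l1 l2 l3 l4] := And4 (ler_norm C1) (ler_norm C2) (ler_norm C3) (ler_norm C4).
  by case: b c => -[]; [have := H4 y Hy|have := H3 y Hy|have := H2 y Hy|have := H1 y Hy]; lra.
have I := kernel_integrable.
pose K := Bh * (4 * C) * fine (mu setT).
apply: (@differentiable_quadratic _ _ _ _ _ K (e / 2)) => // v ve.
have xve t s : 0 <= s <= 1 -> e / 2 <= `|x + s *: v - G t| <= `|x| + B + e / 2.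
  move=> /andP[s0 s1].
  have sv : `|s *: v| <= e / 2.
    rewrite normrZ (ger0_norm s0); apply: le_trans (ltW ve).
    by rewrite ler_piMl.
  rewrite (_ : x + s *: v - G t = (x - G t) + s *: v); last by rewrite addrAC.
  apply/andP; split.
    have := xe t; have := lerB_dist (x - G t) (- (s *: v)); rewrite opprK normrN.
    lra.
  apply: le_trans (ler_normD _ _) _; rewrite lerD//.
  by apply: le_trans (ler_normB _ _) _; rewrite lerD2l.
have U0y y : e / 2 <= `|y| <= `|x| + B + e / 2 -> U0 y.
  by move=> /andP[ey _] y0; move: ey; rewrite y0 normr0 leNgt e20.
have I1 : mu.-integrable setT (EFin \o (fun t => h t * p (x + v - G t))).
  apply: (I p sp _ (e / 2)) => // t.
  by have := xve t 1; rewrite scale1r => /(_ _)/andP[]//; rewrite lexx ler01.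
have I2 := I p sp x e e0 xe.
have I3 b := I (partial b p) (smooth_on_partial b sp) x e e0 xe.
have J1 : mu.-integrable setT (EFin \o (fun t => v.1 * (h t * partial false p (x - G t)))).
  exact: (integrableZl measurableT v.1 (I3 false)).
have J2 : mu.-integrable setT (EFin \o (fun t => v.2 * (h t * partial true p (x - G t)))).
  exact: (integrableZl measurableT v.2 (I3 true)).
pose rem t := h t * (p (x - G t + v) - p (x - G t) -
  (v.1 * partial false p (x - G t) + v.2 * partial true p (x - G t))).
have remE : \int[mu]_t (h t * p (x + v - G t)) - \int[mu]_t (h t * p (x - G t)) -
   (v.1 * \int[mu]_t (h t * partial false p (x - G t)) +
    v.2 * \int[mu]_t (h t * partial true p (x - G t))) = \int[mu]_t rem t.
  rewrite -RintegralZl// -RintegralZl//.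
  rewrite -RintegralB// -(RintegralD _ J1 J2)// -RintegralB//.
  - by apply: eq_Rintegral => t _; rewrite /rem (addrAC x v); ring.
  - exact: (integrableB measurableT I1 I2).
  - exact: (integrableD measurableT J1 J2).
have remI : mu.-integrable setT (EFin \o rem).
  apply: eq_integrable (integrableB measurableT (integrableB measurableT I1 I2)
    (integrableD measurableT J1 J2)) => // t _ /=.
  by rewrite -!EFinD; congr EFin; rewrite /rem (addrAC x v); ring.
rewrite remE.
apply: le_trans (le_normr_Rintegral _ remI) _ => //.
apply: le_trans (_ : \int[mu]_t (Bh * (4 * C * `|v| ^+ 2)) <= _); last first.
  rewrite Rintegral_cst// /K; set m := fine _; set n := `|v|.
  by rewrite le_eqVlt; apply/orP; left; apply/eqP; ring.
apply: le_Rintegral => //.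
- exact: (integrable_norm remI).
- by apply: finite_measure_integrable_cst.
move=> t _; rewrite /rem normrM ler_pM//.
have E s : x - G t + s *: v = x + s *: v - G t by rewrite addrAC.
apply: taylor2_le.
- by move=> s s01; rewrite E; apply: (smooth_on_differentiable sp); apply: U0y; exact: xve.
- move=> s b s01; rewrite E; apply: (smooth_on_differentiable (smooth_on_partial b sp)).
  by apply: U0y; exact: xve.
- by move=> s b c s01; rewrite E; apply: HC; exact: xve.
Qed.

(** A partial derivative of such an integral is an integral of the same form with kernel
    [partial b p]; hence induction on the order with [p] generalised. *)
Lemma smooth_on_param_integral (p : plane -> R) (U : set plane) :
  open U -> (forall x, U x -> exists2 e, 0 < e & forall t, e <= `|x - G t|) ->
  smooth_on U0 p -> smooth_on U (fun x => \int[mu]_t (h t * p (x - G t))).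
Proof.
move=> oU Ue + n; elim: n p => //= n IH p sp; split.
  by move=> x /Ue[e e0 xe]; have [] := param_integral_derive sp e0 xe.
move=> b; apply: (eq_smooth_upto oU _ (IH _ (smooth_on_partial b sp))).
by move=> x /Ue[e e0 xe]; case: b; have [] := param_integral_derive sp e0 xe.
Qed.

End ParamIntegral.

(** * Test functions and weak derivatives *)

Section TestFun.
Context {R : realType}.
Local Notation plane := (R * R)%type.
Local Notation P := (measurableTypeR R * measurableTypeR R)%type.
Local Notation leb2 := (@lebesgue_measure R \x @lebesgue_measure R)%E.
Implicit Types (K S : set plane) (f g psi : plane -> R).

Lemma test_fun_supported K S psi : compact S -> S `<=` K ->
  (forall x, psi x != 0 -> S x) -> smooth psi -> test_fun K psi.
Proof.
move=> cS SK psiS spsi.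
have clS : closed S by apply: compact_closed => //; exact: norm_hausdorff.
have subS : closure [set x | psi x != 0] `<=` S.
  rewrite [X in _ `<=` X](iffLR (closure_id S) clS); apply: closureS; exact: psiS.
split => //; last exact: subset_trans subS SK.
by apply: (subclosed_compact _ cS) => //; exact: closed_closure.
Qed.

Lemma closed_box_compact (a b c d : R) : compact (`[a, b] `*` `[c, d] : set plane).
Proof. by apply: compact_setX; exact: segment_compact. Qed.

(** Each factor is flat where its quadratic argument is not positive, that is outside the interval.
    As [n] grows the product tends to the indicator of the open box. *)
Definition box_bump (a b c d : R) (n : nat) (x : plane) : R :=
  expinv 0 (n%:R * ((x.1 - a) * (b - x.1))) * expinv 0 (n%:R * ((x.2 - c) * (d - x.2))).

Lemma smooth_box_bump a b c d n : smooth (box_bump a b c d n).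
Proof.
apply/smooth_onT => k.
have cst_ c' : smooth_upto k setT (fun _ : plane => c' : R) by exact: smooth_upto_cst.
have s1 := @smooth_on_fst R setT k; have s2 := @smooth_on_snd R setT k.
have H (f : plane -> R) : smooth_upto k setT f -> smooth_upto k setT (fun x => expinv 0 (f x)).
  by move=> sf; apply: (smooth_upto_comp openT (@is_derive_expinv R)).
have sub (u v : R) (f : plane -> R) : smooth_upto k setT f ->
    smooth_upto k setT (fun x => n%:R * ((f x - u) * (v - f x))).
  move=> sf; apply: (smooth_upto_mul openT) => //; apply: (smooth_upto_mul openT).
    by apply: (smooth_upto_add openT).
  apply: (smooth_upto_add openT) => //.
  apply: (eq_smooth_upto openT (f := fun x => -1 * f x)); first by move=> x _; rewrite mulN1r.
  exact: (smooth_upto_mul openT).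
by apply: (smooth_upto_mul openT); apply: H; apply: sub.
Qed.

Lemma box_bump_factor (a b t : R) (n : nat) : a < b -> expinv 0 (n%:R * ((t - a) * (b - t))) != 0 ->
  a < t < b.
Proof.
move=> ab; apply: contraR => H; apply/eqP/expinv_le0.
apply: mulr_ge0_le0 => //; move: H; rewrite negb_and -!leNgt => /orP[] H.
  by apply: mulr_le0_ge0; lra.
by apply: mulr_ge0_le0; lra.
Qed.

Lemma test_fun_box_bump K a b c d n : a < b -> c < d -> `[a, b] `*` `[c, d] `<=` K ->
  test_fun K (box_bump a b c d n).
Proof.
move=> ab cd BK; apply: (test_fun_supported _ BK).
- exact: closed_box_compact.
- move=> x; rewrite mulf_eq0 negb_or => /andP[/(box_bump_factor ab)/andP[? ?]].
  by move=> /(box_bump_factor cd)/andP[? ?]; split; rewrite /= in_itv/= !ltW.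
- exact: smooth_box_bump.
Qed.

Lemma expinv0_scaled_cvg (s : R) : 0 < s -> expinv 0 (n%:R * s) @[n --> \oo] --> (1 : R).
Proof.
move=> s0; apply/cvgrPdist_le => e e0.
near=> n.
have n0 : 0 < (n%:R : R) by rewrite ltr0n; near: n; exact: nbhs_infty_gt.
have ns : 0 < n%:R * s by rewrite mulr_gt0.
have := expinv0_le1 (n%:R * s); have := expinv0_ge ns => h1 h2.
rewrite ger0_norm ?subr_ge0// lerBlDr -lerBlDl; apply: le_trans h1.
rewrite lerD2l lerN2 invf_ple ?posrE//.
rewrite -ler_pdivrMr//; near: n; exact: nbhs_infty_ger.
Unshelve. all: by end_near. Qed.

Lemma box_bump_cvg a b c d (x : plane) : a < b -> c < d ->
  box_bump a b c d n x @[n --> \oo] --> (\1_(`]a, b[ `*` `]c, d[) x : R).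
Proof.
move=> ab cd; rewrite indicE; case: (boolP (x \in _)) => xB.
  move/set_mem : xB => [/=]; rewrite !in_itv/= => /andP[a1 b1] /andP[c1 d1].
  rewrite -[X in _ --> X](mulr1 1%R).
  by apply: cvgM; apply: expinv0_scaled_cvg; apply: mulr_gt0; rewrite subr_gt0.
rewrite (_ : (fun n => _) = fun _ => 0); first exact: cvg_cst.
apply/funext => n; apply/eqP; move: xB; apply: contraNT.
rewrite mulf_eq0 negb_or => /andP[/(box_bump_factor ab) ? /(box_bump_factor cd) ?].
by apply/mem_set; split; rewrite /= in_itv.
Qed.

Lemma box_bump_ge0 a b c d n (x : plane) : 0 <= box_bump a b c d n x.
Proof. by rewrite mulr_ge0 ?expinv0_ge0. Qed.

Lemma box_bump_le1 a b c d n (x : plane) : box_bump a b c d n x <= 1.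
Proof. by rewrite mulr_ile1 ?expinv0_ge0 ?expinv0_le1. Qed.

Lemma smooth_continuous f : smooth f -> continuous f.
Proof. by move=> sf x; apply: differentiable_continuous; exact: (sf [::]). Qed.

Lemma smooth_partial b f : smooth f -> smooth (partial b f).
Proof. by move=> /smooth_onT sf; apply/smooth_onT; exact: smooth_on_partial. Qed.

Lemma smooth_measurable D f : smooth f -> measurable_fun (D : set P) (f : P -> R).
Proof.
by move=> /smooth_continuous/continuous_plane_measurable_fun; exact: measurable_funTS.
Qed.

Lemma measurable_open_box (a b c d : R) : measurable (`]a, b[ `*` `]c, d[ : set P).
Proof. exact: measurableX. Qed.

(** The indicator of the open box is the pointwise limit of test functions with values in [[0, 1]],
    and [|g|] dominates. *)
Lemma integral_open_box0 K (g : plane -> R) a b c d : open K ->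
  leb2.-integrable (K : set P) (EFin \o g) ->
  (forall psi, test_fun K psi -> \int[leb2]_(x in K) (g x * psi x) = 0) ->
  `[a, b] `*` `[c, d] `<=` K ->
  (\int[leb2]_(x in `]a, b[ `*` `]c, d[) (g x)%:E = 0)%E.
Proof.
move=> oK ig g0 BK.
have [ab|ab] := ltP a b; last first.
  by rewrite set_itv_ge ?set0X ?integral_set0// bnd_simp -leNgt.
have [cd|cd] := ltP c d; last first.
  by rewrite [X in _ `*` X]set_itv_ge ?setX0 ?integral_set0// bnd_simp -leNgt.
have mK : measurable (K : set P) by exact: open_plane_measurable.
have mg : measurable_fun (K : set P) (g : P -> R) by apply/measurable_EFinP; exact: measurable_int ig.
pose B : set P := `]a, b[ `*` `]c, d[.
have mB : measurable B by exact: measurable_open_box.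
have BKo : B `<=` K.
  by move=> x [/= ? ?]; apply: BK; split; apply: subset_itv_oo_cc.
have mbump n D : measurable_fun (D : set P) (box_bump a b c d n : P -> R).
  by apply: smooth_measurable; exact: smooth_box_bump.
have [|||||I] := @Rintegral_dominated_cvg _ _ _ leb2 K mK
  (fun n x => g x * box_bump a b c d n x) (fun x => g x * \1_B x) (fun x => `|g x|) _ _ _ _ _.
- by move=> n; apply: measurable_funM.
- by apply: measurable_funM => //; exact: measurable_indic.
- by move=> x Kx; apply: cvgMl_tmp; exact: box_bump_cvg.
- exact: integrable_abse ig.
- move=> n x _; rewrite normrM ler_piMr// ger0_norm ?box_bump_ge0//.
  exact: box_bump_le1.
rewrite (_ : (fun n => _) = cst 0); last first.
  by apply/funext => n; apply: g0; exact: test_fun_box_bump.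
move=> /(cvg_unique (@norm_hausdorff _ _) (cvg_cst 0)) E0.
rewrite -[X in (\int[_]_(x in X) _)%E](setIidr BKo) integral_mkcondr.
transitivity (\int[leb2]_(x in K) (g x * \1_B x)%:E)%E.
  apply: eq_integral => x _; rewrite patchE indicE; case: (x \in B).
    by rewrite mulr1.
  by rewrite mulr0.
rewrite -[LHS]fineK; last exact: integrable_fin_num I.
by congr EFin.
Qed.

Lemma L2_integrable K g : open K -> bounded_set K -> L2 K g ->
  leb2.-integrable (K : set P) (fun x => (g x ^+ 2)%:E).
Proof.
move=> oK bK [mg gK]; apply/integrableP; split.
  by apply/measurable_EFinP; apply: measurable_funX.
by under eq_integral do rewrite gee0_abs ?lee_fin ?sqr_ge0//.
Qed.

Lemma bounded_plane K : bounded_set K -> exists2 M : R, 0 < M & forall x, K x -> `|x| <= M.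
Proof.
case=> M [_ HM]; exists (`|M| + 1); first by rewrite ltr_wpDl.
by apply: HM; rewrite (le_lt_trans (ler_norm M))// ltrDl.
Qed.

Lemma bounded_plane_finite K : open K -> bounded_set K -> (leb2 (K : set P) < +oo)%E.
Proof.
move=> oK /bounded_plane[M M0 KM].
have : (leb2 (`[(- M)%R, M] `*` `[(- M)%R, M]) < +oo)%E by rewrite plane_boxE ?ltry// lerNl; lra.
apply: le_lt_trans; apply: le_measure; rewrite ?inE.
- exact: open_plane_measurable.
- exact: measurableX.
- by move=> x /KM; rewrite plane_norm_le !ler_norml => /andP[? ?]; split; rewrite /= in_itv.
Qed.

Lemma L2_integrable1 K g : open K -> bounded_set K -> L2 K g ->
  leb2.-integrable (K : set P) (EFin \o g).
Proof.
move=> oK bK gL2; have mK := open_plane_measurable oK.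
have g2 := L2_integrable oK bK gL2.
have i1 : leb2.-integrable (K : set P) (fun x => ((cst 1 x : R) ^+ 2)%:E).
  rewrite (_ : (fun _ => _) = cst 1%:E); last by apply/funext => x; rewrite expr1n.
  apply: (measurable_bounded_integrable (f := cst 1)) => //; first exact: bounded_plane_finite.
  by exists 1; split => // M M1 x _; rewrite /= normr1; exact: ltW M1.
apply: eq_integrable (integrable_mul_L2 mK _ _ g2 i1) => //.
- by move=> x _ /=; rewrite mulr1.
- by case: gL2.
Qed.

Definition itvoo : set (set R) := [set `]p.1, p.2[%classic | p in [set: R * R]].

Lemma itvooI : setI_closed itvoo.
Proof.
move=> _ _ [p _ <-] [q _ <-]; exists (Num.max p.1 q.1, Num.min p.2 q.2) => //=.
apply/seteqP; split => x /=; rewrite !in_itv/= gt_max lt_min.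
  by move=> /andP[/andP[-> ->] /andP[-> ->]].
by move=> [/andP[-> ->] /andP[-> ->]].
Qed.

Definition open_boxes : set (set plane) := [set A `*` B | A in itvoo & B in itvoo].

Lemma open_boxesI : setI_closed open_boxes.
Proof.
move=> _ _ [A oA [B oB <-]] [C oC [D oD <-]]; rewrite -setXI.
by exists (A `&` C); [exact: itvooI|exists (B `&` D) => //; exact: itvooI].
Qed.

Lemma itvoo_cover : \bigcup_k `](- k%:R), k%:R[%classic = [set: R].
Proof.
apply/seteqP; split => // x _; exists (Num.truncn `|x|).+1 => //=; rewrite in_itv/= -ltr_norml.
exact: truncnS_gt.
Qed.

(** A measurable rectangle is the intersection of two cylinders, and a cylinder over an open
    interval is a countable union of open boxes. With stability under intersection this makes open
    boxes a pi-system fit for Dynkin's theorem. *)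
Lemma open_boxes_measurable : @measurable _ P = <<s open_boxes >>.
Proof.
have itvooE : (measurable : set (set (measurableTypeR R))) = <<s itvoo >>.
  rewrite (RGenOpens.measurableE R); congr (<<s _ >>).
  apply/seteqP; split => [_ [a [b ->]]|_ [p _ <-]]; first by exists (a, b).
  by exists p.1, p.2.
rewrite eqEsubset; split; last first.
  apply: smallest_sub; first exact: sigma_algebra_measurable.
  by move=> _ [_ [p _ <-] [_ [q _ <-] <-]]; exact: measurableX.
rewrite measurable_prod_measurableType.
have bigC (C : set plane) : open_boxes C -> <<s open_boxes >> C by exact: sub_sigma_algebra.
pose sA : sigma_algebra setT <<s open_boxes >> := smallest_sigma_algebra _ _.
have cU (F : (set plane)^nat) : (forall n, <<s open_boxes >> (F n)) -> <<s open_boxes >> (\bigcup_n F n).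
  by case: sA => _ _; exact.
have cI (A B : set plane) : <<s open_boxes >> A -> <<s open_boxes >> B -> <<s open_boxes >> (A `&` B).
  move=> oA oB; have := @measurableI _ (g_sigma_algebraType open_boxes) A B; exact.
have cC (A : set plane) : <<s open_boxes >> A -> <<s open_boxes >> (setT `\` A).
  by case: sA => _ + _; exact.
have c0 : <<s open_boxes >> set0 by case: sA.
have Hf (A : set R) : measurable (A : set (measurableTypeR R)) -> <<s open_boxes >> (A `*` setT).
  rewrite itvooE; apply: (smallest_sub (X := [set A | <<s open_boxes >> (A `*` setT)])).
    split.
    - by rewrite /= set0X.
    - move=> B /= HB; rewrite (_ : _ `*` _ = setT `\` (B `*` setT)); first exact: cC.
      by apply/seteqP; split => x /=; tauto.
    - move=> F /= HF; rewrite (_ : _ `*` _ = \bigcup_n (F n `*` setT)); first exact: cU.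
      by apply/seteqP; split => [x [[n _ Fn] _]|x [n _ [Fn _]]]; [exists n|split => //; exists n].
  move=> _ [p _ <-] /=; rewrite -itvoo_cover.
  rewrite (_ : _ `*` _ = \bigcup_k (`]p.1, p.2[ `*` `](- k%:R), k%:R[)).
    apply: cU => k; apply: bigC; exists `]p.1, p.2[%classic; first by exists p.
    by exists `](- k%:R), k%:R[%classic => //; exists (- k%:R, k%:R).
  by apply/seteqP; split => [x [? [n _ Fn]]|x [n _ [? Fn]]]; [exists n|split => //; exists n].
have Hs (A : set R) : measurable (A : set (measurableTypeR R)) -> <<s open_boxes >> (setT `*` A).
  rewrite itvooE; apply: (smallest_sub (X := [set A | <<s open_boxes >> (setT `*` A)])).
    split.
    - by rewrite /= setX0.
    - move=> B /= HB; rewrite (_ : _ `*` _ = setT `\` (setT `*` B)); first exact: cC.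
      by apply/seteqP; split => x /=; tauto.
    - move=> F /= HF; rewrite (_ : _ `*` _ = \bigcup_n (setT `*` F n)); first exact: cU.
      by apply/seteqP; split => [x [_ [n _ Fn]]|x [n _ [_ Fn]]]; [exists n|split => //; exists n].
  move=> _ [p _ <-] /=; rewrite -itvoo_cover.
  rewrite (_ : _ `*` _ = \bigcup_k (`](- k%:R), k%:R[ `*` `]p.1, p.2[)).
    apply: cU => k; apply: bigC; exists `](- k%:R), k%:R[%classic; first by exists (- k%:R, k%:R).
    by exists `]p.1, p.2[%classic => //; exists p.
  by apply/seteqP; split => [x [[n _ Fn] ?]|x [n _ [Fn ?]]]; [exists n|split => //; exists n].
apply: smallest_sub; first exact: smallest_sigma_algebra.
move=> _ [A mA [B mB <-]].
rewrite (_ : A `*` B = (A `*` setT) `&` (setT `*` B)); last first.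
  by apply/seteqP; split => x /=; tauto.
by apply: cI; [exact: Hf|exact: Hs].
Qed.

(** Sets whose intersection with the box carries zero integral of [g] form a lambda-system
    containing the open boxes. By Dynkin's theorem [g] then integrates to zero over every measurable
    subset of the box. *)
Lemma ae_eq0_open_box (g : plane -> R) a b c d :
  let B : set plane := (`]a, b[ `*` `]c, d[) in
  leb2.-integrable (B : set P) (EFin \o g) ->
  (forall a1 b1 c1 d1, a <= a1 -> b1 <= b -> c <= c1 -> d1 <= d ->
     (\int[leb2]_(x in `]a1, b1[ `*` `]c1, d1[) (g x)%:E = 0)%E) ->
  ae_eq leb2 (B : set P) (EFin \o g) (cst 0%E).
Proof.
move=> B ig H0.
have mB : measurable (B : set P) by exact: measurable_open_box.
apply: integral_ae_eq => // E EB mE; rewrite integral0.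
suff : forall A, <<s open_boxes >> A -> (\int[leb2]_(x in A `&` B) (g x)%:E = 0)%E.
  by move=> /(_ E); rewrite -open_boxes_measurable setIidl//; exact.
have P0 : (\int[leb2]_(x in B) (g x)%:E = 0)%E by apply: H0.
apply: (dynkin_induction (T := P)).
- exact: open_boxes_measurable.
- exact: open_boxesI.
- by rewrite setTI.
- move=> _ [_ [p _ <-] [_ [q _ <-] <-]].
  rewrite -setXI.
  rewrite (_ : _ `*` _ = `]Num.max p.1 a, Num.min p.2 b[ `*` `]Num.max q.1 c, Num.min q.2 d[).
    by apply: H0; rewrite ?le_max ?ge_min ?lexx ?orbT.
  by congr (_ `*` _); apply/seteqP; split => x /=; rewrite !in_itv/= gt_max lt_min;
   [move=> [/andP[-> ->] /andP[-> ->]]|move=> /andP[/andP[-> ->] /andP[-> ->]]|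
    move=> [/andP[-> ->] /andP[-> ->]]|move=> /andP[/andP[-> ->] /andP[-> ->]]].
- move=> S mS S0.
  have mgB : measurable_fun (B : set P) (EFin \o g) by exact: measurable_int ig.
  have := P0; rewrite -[X in (\int[_]_(x in X) _)%E](setUIDK B S).
  rewrite integral_setU//; [|exact: measurableI|exact: measurableD| |].
  + by rewrite [X in (\int[_]_(x in X) _ + _)%E]setIC S0 add0e setDE [X in (\int[_]_(x in X) _)%E]setIC.
  + by rewrite setUIDK.
  + by apply/disj_setPS => x [[_ Sx] [_ /(_ Sx)]].
- move=> F mF tF F0.
  rewrite setI_bigcupl integral_bigcup.
  + by rewrite eseries0.
  + apply/trivIsetP => i j _ _ ij; move/trivIsetP : tF => /(_ i j Logic.I Logic.I ij) FF.
    by rewrite setIACA FF set0I.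
  + by move=> k; exact: measurableI.
  + apply: integrableS ig => //; last by move=> x [k _ []].
    by apply: bigcupT_measurable => k; exact: measurableI.
Qed.

End TestFun.

(** * Weak derivatives and the fundamental lemma *)

Section WeakDerivative.
Context {R : realType}.
Local Notation plane := (R * R)%type.
Local Notation P := (measurableTypeR R * measurableTypeR R)%type.
Local Notation leb2 := (@lebesgue_measure R \x @lebesgue_measure R)%E.
Implicit Types (K S : set plane) (f g psi : plane -> R).

Lemma test_fun_smooth K psi : test_fun K psi -> smooth psi.
Proof. by case. Qed.

Lemma partial_eq0 psi (x : plane) b : ~ closure [set x | psi x != 0] x -> partial b psi x = 0.
Proof.
move=> nx; rewrite /partial (@near_eq_derive _ _ _ psi (cst 0)).
  exact: derive_cst.
have oS : open (~` closure [set x | psi x != 0]) by rewrite openC; exact: closed_closure.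
apply: filterS (open_nbhs_nbhs (conj oS nx)) => y ny.
by apply/eqP/negPn/negP => y0; apply: ny; exact: subset_closure.
Qed.

Lemma test_fun_partial K psi b : test_fun K psi -> test_fun K (partial b psi).
Proof.
move=> [spsi cS SK]; apply: (test_fun_supported cS SK); last exact: smooth_partial.
by move=> x; apply: contra_neqP => /partial_eq0 ->.
Qed.

Lemma test_fun_mul K f psi : smooth f -> test_fun K psi -> test_fun K (fun x => f x * psi x).
Proof.
move=> sf [spsi cS SK]; apply: (test_fun_supported cS SK).
  move=> x; rewrite mulf_eq0 negb_or => /andP[_ px]; exact: subset_closure.
apply/smooth_onT => n; apply: (smooth_upto_mul openT).
  exact: (iffLR (smooth_onT f) sf n).
exact: (iffLR (smooth_onT psi) spsi n).
Qed.

Lemma test_fun_bounded K psi : test_fun K psi -> exists C, forall x, `|psi x| <= C.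
Proof.
move=> [spsi cS SK].
have [C HC] := continuous_compact_bound cS (fun x _ => @smooth_continuous R psi spsi x).
exists (`|C|) => x.
have [px|px] := eqVneq (psi x) 0; first by rewrite px normr0.
by apply: le_trans (ler_norm _); apply: HC; exact: subset_closure.
Qed.

Lemma integrable_mul_bounded (D : set P) (g h : plane -> R) (C : R) : measurable D ->
  leb2.-integrable D (EFin \o g) -> measurable_fun D (h : P -> R) ->
  (forall x, `|h x| <= C) -> leb2.-integrable D (fun x => (g x * h x)%:E).
Proof.
move=> mD ig mh hC.
have mg : measurable_fun D (g : P -> R) by apply/measurable_EFinP; exact: measurable_int ig.
have iCg : leb2.-integrable D (fun x => (`|C|)%:E * (EFin \o g) x)%E by exact: integrableZl.
apply: (le_integrable mD _ _ iCg).
  by apply/measurable_EFinP; apply: measurable_funM.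
move=> x _ /=; rewrite lee_fin !normrM normr_id mulrC ler_wpM2r//.
by apply: le_trans (hC x) _; exact: ler_norm.
Qed.

Lemma integral_deriv_compact (h h' : R -> R) (M : R) :
  (forall t : R, is_derive t (1 : R) h (h' t)) -> continuous h' ->
  (forall t, M <= `|t| -> h t = 0 /\ h' t = 0) -> 0 < M ->
  (\int[@lebesgue_measure R]_t (h' t)%:E = 0)%E.
Proof.
move=> dh ch' h0 M0.
have cont : continuous h.
  by move=> t; apply: differentiable_continuous; apply/derivable1_diffP; exact: ex_derive.
transitivity (\int[@lebesgue_measure R]_(t in `[(- M)%R, M]) (h' t)%:E)%E.
  rewrite [RHS]integral_mkcond; apply: eq_integral => t _; rewrite patchE.
  case: ifPn => // /negP tM; congr EFin; apply: (h0 t _).2.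
  rewrite leNgt; apply/negP => tM'; apply: tM; apply/mem_set.
  by rewrite /= in_itv/= -ler_norml ltW.
rewrite (@continuous_FTC2 _ h' h (- M) M).
- by rewrite (h0 M _).1 ?(h0 (- M) _).1 ?subee// ?normrN ger0_norm// ltW.
- by rewrite gtrN.
- exact: continuous_subspaceT.
- split => [t _| |]; first exact: ex_derive.
  + by apply: cvg_at_right_filter; exact: cont.
  + by apply: cvg_at_left_filter; exact: cont.
- by move=> t _; rewrite derive1E; exact: derive_val.
Qed.

Lemma is_derive_section1 f (x y : R) : smooth f ->
  is_derive x (1 : R) (fun x => f (x, y)) (partial false f (x, y)).
Proof.
move=> sf; have := @is_derive_path R f (fun x => (x, y)) 1 0 x (sf [::] _)
  (is_derive_id _ _) (is_derive_cst _ _ _).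
by rewrite mul1r mul0r addr0.
Qed.

Lemma is_derive_section2 f (x y : R) : smooth f ->
  is_derive y (1 : R) (fun y => f (x, y)) (partial true f (x, y)).
Proof.
move=> sf; have := @is_derive_path R f (fun y => (x, y)) 0 1 y (sf [::] _)
  (is_derive_cst _ _ _) (is_derive_id _ _).
by rewrite mul1r mul0r add0r.
Qed.

(** Fubini is used in the order that integrates the direction of differentiation innermost; on each
    line the fundamental theorem gives zero, since [psi] vanishes far out. *)
Lemma integral_partial_test K psi b : test_fun K psi ->
  \int[leb2]_(x in K) (partial b psi x) = 0.
Proof.
move=> tpsi; have [spsi cS SK] := tpsi.
have [M' M'0 HM'] := @bounded_plane R _ (compact_bounded cS).
pose M := M' + 1.
have M0 : 0 < M by rewrite /M; lra.
have out (x : plane) : M <= `|x| -> psi x = 0 /\ partial b psi x = 0.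
  move=> Mx; have nS : ~ closure [set x | psi x != 0] x.
    by move=> /HM' xM; move: Mx; rewrite /M; lra.
  split; last exact: partial_eq0.
  by apply/eqP/negPn/negP => px; apply: nS; exact: subset_closure.
have sb := @smooth_partial R b psi spsi.
have [C HC] := test_fun_bounded (test_fun_partial b tpsi).
have mf : measurable_fun (setT : set P) (EFin \o partial b psi).
  by apply/measurable_EFinP; exact: smooth_measurable.
have If : leb2.-integrable (setT : set P) (EFin \o partial b psi).
  pose B : set P := `[(- M), M] `*` `[(- M), M].
  have mB : measurable B by exact: measurableX.
  have : leb2.-integrable B (EFin \o partial b psi).
    apply: measurable_bounded_integrable => //.
    - have : (leb2 B < +oo)%E by rewrite plane_boxE ?ltry// lerNl; lra.
      exact.
    - exact: smooth_measurable.
    - by exists C; split; [exact: num_real|move=> N CN x _; apply: le_trans (ltW CN)].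
  move/(integrable_mkcond _ mB); apply: eq_integrable => // x _; rewrite patchE /=.
  case: ifPn => // /negP xB; congr EFin; symmetry; apply: (out x _).2.
  rewrite leNgt; apply/negP => xM; apply: xB; apply/mem_set.
  have : `|x| <= M by exact: ltW.
  by rewrite plane_norm_le !ler_norml => /andP[? ?]; split; rewrite /= in_itv.
rewrite Rintegral_mkcond; rewrite (_ : _ \_ K = partial b psi); last first.
  apply/funext => x; rewrite patchE; case: ifPn => // /negP xK; symmetry; apply: partial_eq0.
  by move=> xS; apply: xK; apply/mem_set; exact: SK.
rewrite /Rintegral.
have norm1 (u v : R) : M <= `|u| -> M <= `|(u, v) : plane|.
  by move=> Mu; apply: le_trans Mu _; exact: (plane_norm1 (u, v)).
have norm2 (u v : R) : M <= `|v| -> M <= `|(u, v) : plane|.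
  by move=> Mu; apply: le_trans Mu _; exact: (plane_norm2 (u, v)).
case: b If mf sb HC out => If mf sb HC out.
  transitivity (fine (\int[@lebesgue_measure R]_x
      fubini_F (@lebesgue_measure R) (EFin \o partial true psi) x)%E).
    by congr fine; symmetry; exact: integral12_prod_meas1.
  rewrite /fubini_F integral0_eq// => x _ /=.
  apply: (@integral_deriv_compact (fun y => psi (x, y)) _ M) => //.
  - by move=> y; exact: is_derive_section2.
  - move=> y; apply: (@continuous_comp _ _ _ (fun y => (x, y))); last exact: smooth_continuous.
    by apply: differentiable_continuous; apply: differentiable_pair; [exact: differentiable_cst|exact: ex_diff].
  - by move=> t Mt; apply: out; exact: norm2.
transitivity (fine (\int[@lebesgue_measure R]_y
    fubini_G (@lebesgue_measure R) (EFin \o partial false psi) y)%E).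
  by congr fine; symmetry; exact: integral21_prod_meas1.
rewrite /fubini_G integral0_eq// => y _ /=.
apply: (@integral_deriv_compact (fun x => psi (x, y)) _ M) => //.
- by move=> x; exact: is_derive_section1.
- move=> x; apply: (@continuous_comp _ _ _ (fun x => (x, y))); last exact: smooth_continuous.
  by apply: differentiable_continuous; apply: differentiable_pair; [exact: ex_diff|exact: differentiable_cst].
- by move=> t Mt; apply: out; exact: norm1.
Qed.

Section fixed_domain.
Variables (K : set plane) (oK : open K) (bK : bounded_set K).

Let mK : measurable (K : set P). Proof. exact: open_plane_measurable. Qed.

Lemma smooth_bounded f : smooth f -> exists C, forall x, K x -> `|f x| <= C.
Proof.
move=> sf; have [M M0 KM] := bounded_plane bK.
have cB : compact (`[(- M), M] `*` `[(- M), M] : set plane) by exact: closed_box_compact.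
have [C HC] := continuous_compact_bound cB (fun x _ => @smooth_continuous R f sf x).
exists C => x /KM; rewrite plane_norm_le => /andP[].
rewrite ler_norml => ?; rewrite ler_norml => ?.
by apply: HC; split; rewrite /= in_itv.
Qed.

Lemma bounded_L2 f C : measurable_fun (K : set P) (f : P -> R) ->
  (forall x, K x -> `|f x| <= C) -> L2 K f.
Proof.
move=> mf fC; split => //.
have : leb2.-integrable (K : set P) (EFin \o (fun x => f x ^+ 2)).
  apply: measurable_bounded_integrable => //; first exact: bounded_plane_finite.
    exact: measurable_funX.
  exists (C ^+ 2); split; first exact: num_real.
  move=> M CM x Kx /=; apply: le_trans (ltW CM).
  rewrite normrX lerXn2r ?nnegrE//; last exact: fC.
  exact: le_trans (fC x Kx).
move=> /integrableP[_]; rewrite /sq_norm2.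
by under eq_integral do rewrite /= ger0_norm ?sqr_ge0//.
Qed.

Lemma smooth_L2 f : smooth f -> L2 K f.
Proof.
by move=> sf; have [C HC] := smooth_bounded sf; apply: bounded_L2 HC; exact: smooth_measurable.
Qed.

Lemma L2_sub f g : L2 K f -> L2 K g -> L2 K (fun x => f x - g x).
Proof.
move=> fL gL; have [mf _] := fL; have [mg _] := gL.
have mfg : measurable_fun (K : set P) ((fun x => f x - g x) : P -> R) by exact: measurable_funB.
split => //.
have I : leb2.-integrable (K : set P) (fun x => 2%:E * (f x ^+ 2)%:E + 2%:E * (g x ^+ 2)%:E)%E.
  by apply: integrableD => //; apply: integrableZl => //; exact: L2_integrable.
have : leb2.-integrable (K : set P) (fun x => ((f x - g x) ^+ 2)%:E).
  apply: (le_integrable mK _ _ I).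
    by apply/measurable_EFinP; exact: measurable_funX.
  move=> x _; rewrite -!EFinM -EFinD !abse_EFin lee_fin !ger0_norm ?sqr_ge0//.
    have := sqr_ge0 (f x + g x); rewrite !expr2; nra.
  by rewrite addr_ge0// mulr_ge0 ?sqr_ge0.
move=> /integrableP[_]; rewrite /sq_norm2.
by under eq_integral do rewrite /= ger0_norm ?sqr_ge0//.
Qed.

Lemma integrable_mul_test g psi : L2 K g -> test_fun K psi ->
  leb2.-integrable (K : set P) (EFin \o (fun x => g x * psi x)).
Proof.
move=> gL tpsi; have [C HC] := test_fun_bounded tpsi.
apply: (integrable_mul_bounded mK (L2_integrable1 oK bK gL) _ HC).
by apply: smooth_measurable; exact: test_fun_smooth tpsi.
Qed.

(** The test function hypothesis kills the integral of [g] over every box inside [K], so [g = 0]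
    almost everywhere on such boxes; countably many rational ones cover [K]. *)
Lemma fundamental_lemma g : L2 K g ->
  (forall psi, test_fun K psi -> \int[leb2]_(x in K) (g x * psi x) = 0) ->
  ae_eq leb2 (K : set P) (EFin \o g) (cst 0%E).
Proof.
move=> gL g0; have ig := L2_integrable1 oK bK gL.
pose obox (i : rat * rat * nat) : set P :=
  `](ratr i.1.1 - i.2.+1%:R^-1), (ratr i.1.1 + i.2.+1%:R^-1)[ `*`
  `](ratr i.1.2 - i.2.+1%:R^-1), (ratr i.1.2 + i.2.+1%:R^-1)[.
pose cbox (i : rat * rat * nat) : set plane :=
  `[(ratr i.1.1 - i.2.+1%:R^-1), (ratr i.1.1 + i.2.+1%:R^-1)] `*`
  `[(ratr i.1.2 - i.2.+1%:R^-1), (ratr i.1.2 + i.2.+1%:R^-1)].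
pose N := [set x | ~ (K x -> (EFin \o g) x = 0%E)].
pose F (n : nat) : set P := if unpickle n is Some i then
  (if `[< cbox i `<=` K >] then N `&` obox i else set0) else set0.
have NF : N `<=` \bigcup_n F n.
  move=> x Nx; have Kx : K x by apply: contrapT => nKx; apply: Nx => /nKx.
  have /nbhs_ballP[e /= e0 xeK] : nbhs x K by exact: open_nbhs_nbhs.
  have [n ne] : exists n : nat, n.+1%:R^-1 < e / 2.
    have := @near_infty_natSinv_lt R (PosNum (divr_gt0 e0 (ltr0n R 2))).
    by case=> n _ /(_ n (leqnn n)) ?; exists n.
  have rat_ball (y : R) : exists q : rat, ball y n.+1%:R^-1 (ratr q : R).
    have /(_ (ball y n.+1%:R^-1)) := @dense_rat R.
    case; [by exists y; apply: ballxx|exact: ball_open|].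
    by move=> z [yz [q _ qz]]; exists q; rewrite qz.
  have [p xp] := rat_ball x.1; have [q xq] := rat_ball x.2.
  exists (pickle (p, q, n)); first exact: Logic.I.
  rewrite /F pickleK; case: ifPn => [_|/asboolP].
    by split => //; split; rewrite /obox/= in_itv/= -ltr_distlC distrC.
  have tri (u w y r : R) : `|u - r| < n.+1%:R^-1 -> `|r - y| <= n.+1%:R^-1 -> `|u - y| < e.
    move=> ur ry; apply: le_lt_trans (ler_distD r _ _) _.
    by rewrite (splitr e) ltr_leD//; [exact: lt_trans ur ne|exact: le_trans ry (ltW ne)].
  case=> y [/=]; rewrite !in_itv/= -!ler_distlC => y1 y2; apply: xeK; split.
    exact: tri xp y1.
  exact: tri xq y2.
suff : leb2.-negligible (N : set P) by exact.
apply: (@negligibleS _ _ _ leb2 (\bigcup_n F n) N) => //; apply: negligible_bigcup => n; rewrite /F.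
case: unpickle => [i|]; last exact: negligible_set0.
case: ifPn => [/asboolP cK|_]; last exact: negligible_set0.
have oK' : obox i `<=` K.
  by move=> x [/= ? ?]; apply: cK; split; apply: subset_itv_oo_cc.
have : leb2.-negligible (~` [set x | obox i x -> (EFin \o g) x = cst 0%E x]).
  apply: ae_eq0_open_box.
    by apply: integrableS ig => //; exact: measurable_open_box.
  move=> a1 b1 c1 d1 h1 h2 h3 h4; apply: (integral_open_box0 oK ig g0) => x [/=].
  rewrite !in_itv/= => /andP[x1 x2] /andP[x3 x4]; apply: cK.
  by split; rewrite /= in_itv/=; apply/andP; split;
    [exact: le_trans h1 x1|exact: le_trans x2 h2|exact: le_trans h3 x3|exact: le_trans x4 h4].
apply: negligibleS => x [Nx ox] H; apply: Nx => _; exact: H.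
Qed.

Lemma weak_partial_unique (v g1 g2 : plane -> R) b :
  is_weak_partial K v b g1 -> is_weak_partial K v b g2 ->
  ae_eq leb2 (K : set P) (EFin \o g1) (EFin \o g2).
Proof.
move=> [L1 H1] [L2_ H2].
have := @fundamental_lemma (fun x => g1 x - g2 x) (L2_sub L1 L2_) _.
case.
  move=> psi tpsi; rewrite (@eq_Rintegral _ _ _ _ _ (fun x : P => g1 x * psi x - g2 x * psi x)).
    rewrite RintegralB//; [|exact: integrable_mul_test|exact: integrable_mul_test].
    by apply/eqP; rewrite subr_eq0 -eqr_opp -H1// H2.
  by move=> x _; rewrite mulrBl.
move=> A [mA A0 HA]; exists A; split => // x Hx; apply: HA => /= H0; apply: Hx => Kx.
by have [/eqP] := H0 Kx; rewrite subr_eq0 => /eqP E; congr EFin.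
Qed.

(** The product [f * psi] is again a test function, so the integral of its partial derivative
    vanishes; the product rule does the rest. *)
Lemma is_weak_partial_smooth f b : smooth f -> is_weak_partial K f b (partial b f).
Proof.
move=> sf; split; first exact/smooth_L2/smooth_partial.
move=> psi tpsi; have := integral_partial_test b (test_fun_mul sf tpsi).
have spsi := test_fun_smooth tpsi.
rewrite (@eq_Rintegral _ _ _ _ _ (fun x : P => f x * partial b psi x + partial b f x * psi x)); last first.
  move=> x _; rewrite /partial deriveM; [|exact: diff_derivable (sf [::] x)|exact: diff_derivable (spsi [::] x)].
  by rewrite /GRing.scale/= [X in _ + X]mulrC.
rewrite RintegralD//.
- by move/eqP; rewrite addr_eq0 => /eqP.
- by apply: integrable_mul_test; [exact: smooth_L2|exact: test_fun_partial].
- by apply: integrable_mul_test => //; exact/smooth_L2/smooth_partial.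
Qed.

Lemma is_weak_partial_sub f g f' g' b : L2 K f -> L2 K g -> is_weak_partial K f b f' ->
  is_weak_partial K g b g' -> is_weak_partial K (f \- g) b (fun x => f' x - g' x).
Proof.
move=> fL gL [f'L Hf] [g'L Hg]; split; first exact: L2_sub.
move=> psi tpsi.
rewrite (@eq_Rintegral _ _ _ _ _ (fun x : P => f x * partial b psi x - g x * partial b psi x)); last first.
  by move=> x _ /=; rewrite mulrBl.
rewrite [in RHS](@eq_Rintegral _ _ _ _ _ (fun x : P => f' x * psi x - g' x * psi x)); last first.
  by move=> x _ /=; rewrite mulrBl.
have tb := test_fun_partial b tpsi.
rewrite !RintegralB//; try exact: integrable_mul_test.
by rewrite Hf// Hg// opprB opprK addrC.
Qed.

Lemma weak_partialP v b : H1 K v -> is_weak_partial K v b (weak_partial K v b).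
Proof. by move=> [_ /(_ b)[g Hg]]; rewrite /weak_partial; case: xgetP => // /(_ g). Qed.

(** [weak_partial] of a difference is a choice made independently of those for [f] and [v];
    uniqueness almost everywhere identifies it with the difference of derivatives, which is enough
    under the integral. *)
Lemma sq_seminorm_H1_sub f v : smooth f -> H1 K v ->
  (sq_seminorm_H1 K (f \- v)%R =
   \int[leb2]_(x in K) (\sum_(b : bool) (partial b f x - weak_partial K v b x) ^+ 2)%R%:E)%E.
Proof.
move=> sf Hv; have fL := smooth_L2 sf; have [vL _] := Hv.
have Hfv b := is_weak_partial_sub fL vL (is_weak_partial_smooth b sf) (weak_partialP b Hv).
have Hfv1 : H1 K (f \- v).
  by split; [exact: L2_sub|move=> b; exists (fun x => partial b f x - weak_partial K v b x)].
have ms b : measurable_fun (K : set P) ((fun x => partial b f x - weak_partial K v b x) : P -> R).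
  by have [[]] := Hfv b.
have mw b : measurable_fun (K : set P) (weak_partial K (f \- v) b : P -> R).
  by have [[]] := weak_partialP b Hfv1.
rewrite /sq_seminorm_H1; apply: ae_eq_integral => //.
- by apply/measurable_EFinP; apply: measurable_sum => b; exact: measurable_funX.
- by apply/measurable_EFinP; apply: measurable_sum => b; exact: measurable_funX.
have ae b := weak_partial_unique (weak_partialP b Hfv1) (Hfv b).
have := ae true; have := ae false.
apply: filterS2 => x H0 H1 Kx; congr EFin.
have [E1] := H1 Kx; have [E0] := H0 Kx.
by apply: eq_bigr => -[] _; rewrite ?E1 ?E0.
Qed.

End fixed_domain.

End WeakDerivative.

Section IntegralMono.
Context d (T : measurableType d) (R : realType) (mu : {measure set T -> \bar R}).

(** The integral of a nonnegative function is a supremum over simple functions lying below it, so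
    the comparison holds for arbitrary functions, measurable or not. *)
Lemma ge0_integral_mono (D : set T) (f g : T -> \bar R) :
  (forall x, D x -> 0 <= f x)%E -> (forall x, D x -> f x <= g x)%E ->
  (\int[mu]_(x in D) f x <= \int[mu]_(x in D) g x)%E.
Proof.
move=> f0 fg; rewrite integral_mkcond [leRHS]integral_mkcond.
have fg' x : ((f \_ D) x <= (g \_ D) x)%E.
  by rewrite !patchE; case: ifPn => // /set_mem Dx; exact: fg.
have f0' x : (0 <= (f \_ D) x)%E by rewrite patchE; case: ifPn => // /set_mem Dx; exact: f0.
rewrite !ge0_integralTE//; last by move=> x; exact: le_trans (f0' x) (fg' x).
apply: le_ereal_sup => _ [h hf <-]; exists h => // x; exact: le_trans (hf x) (fg' x).
Qed.

End IntegralMono.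

(** * Euclidean geometry of star-shaped sets *)

Section Euclid.
Context {R : realType}.
Local Notation plane := (R * R)%type.
Local Notation P := (measurableTypeR R * measurableTypeR R)%type.
Local Notation edist := Defs.edist.
Implicit Types x y v w : plane.

Lemma ler_of_sqr (a b : R) : 0 <= b -> (a ^+ 2 : R) <= (b ^+ 2 : R) -> a <= b.
Proof. by move=> b0 ab; rewrite leNgt; apply/negP => ba; nra. Qed.

Definition enorm v : R := Num.sqrt (v.1 ^+ 2 + v.2 ^+ 2).

Lemma edistE x y : edist x y = enorm (x - y). Proof. by []. Qed.

Lemma enorm_ge0 v : 0 <= enorm v. Proof. exact: sqrtr_ge0. Qed.

Lemma sqr_enorm v : enorm v ^+ 2 = v.1 ^+ 2 + v.2 ^+ 2.
Proof. by rewrite sqr_sqrtr// addr_ge0 ?sqr_ge0. Qed.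

Lemma enormN v : enorm (- v) = enorm v.
Proof. by rewrite /enorm /= !sqrrN. Qed.

Lemma enormZ (a : R) v : 0 <= a -> enorm (a *: v) = a * enorm v.
Proof.
move=> a0; rewrite /enorm/= /GRing.scale/= !exprMn -mulrDr sqrtrM ?sqr_ge0//.
by rewrite sqrtr_sqr ger0_norm.
Qed.

Lemma enormD v w : enorm (v + w) <= enorm v + enorm w.
Proof.
have D0 : 0 <= enorm v + enorm w by rewrite addr_ge0 ?enorm_ge0.
apply: ler_of_sqr; first exact: D0.
rewrite (sqr_enorm (v + w)) /=; have := sqr_enorm v; have := sqr_enorm w.
have : v.1 * w.1 + v.2 * w.2 <= enorm v * enorm w.
  have [le0|gt0] := leP (v.1 * w.1 + v.2 * w.2) 0.
    by apply: le_trans le0 _; rewrite mulr_ge0 ?enorm_ge0.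
  apply: ler_of_sqr; first by rewrite mulr_ge0 ?enorm_ge0.
  rewrite exprMn !sqr_enorm; have := sqr_ge0 (v.1 * w.2 - v.2 * w.1); nra.
nra.
Qed.

Lemma edist_triangle y x w : edist x w <= edist x y + edist y w.
Proof. by rewrite !edistE; apply: le_trans (enormD _ _); rewrite addrA subrK. Qed.

Lemma edistC x y : edist x y = edist y x.
Proof. by rewrite !edistE -enormN opprB. Qed.

Lemma edist_ge0 x y : 0 <= edist x y. Proof. by rewrite edistE; exact: enorm_ge0. Qed.

Lemma enorm_ge_norm v : `|v| <= enorm v.
Proof.
rewrite plane_norm_le; apply/andP; split; rewrite -sqrtr_sqr ler_wsqrtr//.
  by rewrite lerDl sqr_ge0.
by rewrite lerDr sqr_ge0.
Qed.

Lemma enorm_le_norm v : enorm v <= 2 * `|v|.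
Proof.
have := plane_norm1 v; have := plane_norm2 v => v2 v1.
apply: ler_of_sqr; first by rewrite mulr_ge0.
rewrite sqr_enorm.
rewrite -(real_normK (num_real v.1)) -(real_normK (num_real v.2)).
have := normr_ge0 v.1; have := normr_ge0 v.2; nra.
Qed.

Lemma edist_eq0 x y : edist x y = 0 -> x = y.
Proof.
move=> E; apply/eqP; rewrite -subr_eq0 -normr_le0 -E edistE; exact: enorm_ge_norm.
Qed.

Lemma enorm_continuous : continuous enorm.
Proof.
move=> v; apply: (@continuous_comp _ _ _ (fun v : plane => v.1 ^+ 2 + v.2 ^+ 2) Num.sqrt).
  rewrite (_ : (fun _ => _) = fun v : plane => v.1 * v.1 + v.2 * v.2); last first.
    by apply/funext => u; rewrite !expr2.
  by apply: cvgD; apply: cvgM; try exact: cvg_fst; exact: cvg_snd.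
exact: sqrt_continuous.
Qed.

Lemma measurable_enorm : measurable_fun setT (enorm : P -> R).
Proof. by apply: continuous_plane_measurable_fun; exact: enorm_continuous. Qed.

Lemma measurable_edist d (T : measurableType d) (f g : T -> plane) :
  measurable_fun setT (f : T -> P) -> measurable_fun setT (g : T -> P) ->
  measurable_fun setT (fun t => edist (f t) (g t)).
Proof.
move=> mf mg.
have f1 := measurableT_comp measurable_fst mf; have f2 := measurableT_comp measurable_snd mf.
have g1 := measurableT_comp measurable_fst mg; have g2 := measurableT_comp measurable_snd mg.
have m : measurable_fun setT ((fun t => f t - g t) : T -> P).
  by apply: measurable_fun_pair; apply: measurable_funB.
exact: (measurableT_comp measurable_enorm m).
Qed.

Lemma dot_le (a b c d : R) : (a * c + b * d) ^+ 2 <= (a ^+ 2 + b ^+ 2) * (c ^+ 2 + d ^+ 2).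
Proof. have := sqr_ge0 (a * d - b * c); nra. Qed.

End Euclid.

(** * Increments along a path *)

Section PathInequality.
Context {R : realType}.
Local Notation leb := (@lebesgue_measure R).

(** The increment is the integral of [f'] over [[0, e]]; Cauchy-Schwarz against the constant 1 costs
    the length [e]. *)
Lemma sqr_increment_le (f f' : R -> R) (e : R) : 0 <= e ->
  (forall t : R, is_derive t (1 : R) f (f' t)) -> continuous f' ->
  (((f e - f 0) ^+ 2)%:E <= e%:E * \int[leb]_(u in `[0%R, e]) ((f' u) ^+ 2)%:E)%E.
Proof.
rewrite le_eqVlt => /predU1P[<- _ _|e0 df cf'].
  by rewrite subrr expr0n/= mul0e.
have cf : continuous f.
  by move=> t; apply: differentiable_continuous; apply/derivable1_diffP; exact: ex_derive.
have FTC := @continuous_FTC2 R f' f 0 e e0 _ _ _.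
have {}FTC : (\int[leb]_(u in `[0%R, e]) (f' u)%:E = (f e)%:E - (f 0)%:E)%E.
  apply: FTC.
  - exact: continuous_subspaceT.
  - split => [t _| |]; first exact: ex_derive.
    + by apply: cvg_at_right_filter; exact: cf.
    + by apply: cvg_at_left_filter; exact: cf.
  - by move=> t _; rewrite derive1E; exact: derive_val.
have m01 : measurable (`[0, e]%classic : set (measurableTypeR R)) by exact: measurable_itv.
have mf' : measurable_fun `[0, e]%classic (f' : measurableTypeR R -> R).
  by apply: measurable_funTS; exact: continuous_measurable_fun.
have i2 : leb.-integrable `[0, e]%classic (fun u => (f' u ^+ 2)%:E).
  apply: continuous_compact_integrable; first exact: segment_compact.
  apply: continuous_subspaceT; rewrite (_ : (fun _ => _) = fun u => f' u * f' u).
    by move=> t; apply: cvgM; exact: cf'.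
  by apply/funext => u; rewrite expr2.
have i1 : leb.-integrable `[0, e]%classic (fun u : measurableTypeR R => ((cst 1 u : R) ^+ 2)%:E).
  rewrite (_ : (fun _ => _) = EFin \o cst 1); last first.
    by apply/funext => u /=; rewrite expr1n.
  apply: continuous_compact_integrable; first exact: segment_compact.
  by apply: continuous_subspaceT => t; exact: cvg_cst.
have := @Rintegral_cauchy_schwarz _ _ _ leb _ m01 f' (cst 1) mf' (measurable_cst _) i2 i1.
have -> : \int[leb]_(x in `[0%R, e]) (f' x * cst 1 x) = f e - f 0.
  transitivity (\int[leb]_(u in `[0%R, e]) f' u); last by rewrite /Rintegral FTC.
  by apply: eq_Rintegral => u _ /=; rewrite mulr1.
have -> : \int[leb]_(x in `[0%R, e]) ((cst 1 x : R) ^+ 2) = e.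
  transitivity (\int[leb]_(u in `[0%R, e]) (1 : R)).
    by apply: eq_Rintegral => u _ /=; rewrite expr1n.
  by rewrite Rintegral_cst//= lebesgue_measure_itv/= lte_fin e0 -EFinB/= subr0 mul1r.
move=> H.
rewrite -[X in (_ <= _ * X)%E]fineK; last exact: integrable_fin_num i2.
by rewrite -EFinM lee_fin mulrC.
Qed.

End PathInequality.

(** * Tonelli's theorem and measurability of partial integrals *)

Section Tonelli.
Context d1 d2 (T1 : measurableType d1) (T2 : measurableType d2) (R : realType).
Context (m1 : {sigma_finite_measure set T1 -> \bar R}).
Context (m2 : {sigma_finite_measure set T2 -> \bar R}).

Lemma tonelli_setX (A : set T1) (B : set T2) (f : T1 * T2 -> \bar R) :
  measurable A -> measurable B -> measurable_fun setT f -> (forall x, 0 <= f x)%E ->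
  (\int[m1]_(x in A) \int[m2]_(y in B) f (x, y) =
   \int[m2]_(y in B) \int[m1]_(x in A) f (x, y))%E.
Proof.
move=> mA mB mf f0.
have mAB : measurable (A `*` B) by exact: measurableX.
have mg : measurable_fun setT (f \_ (A `*` B)).
  by apply/(measurable_restrictT _ mAB); exact: measurable_funTS.
have g0 x : (0 <= (f \_ (A `*` B)) x)%E by rewrite patchE; case: ifP.
have := fubini_tonelli (m1 := m1) (m2 := m2) (f \_ (A `*` B)) mg g0.
have E1 x : (\int[m2]_y (f \_ (A `*` B)) (x, y) =
    ((fun x => \int[m2]_(y in B) f (x, y)) \_ A) x)%E.
  rewrite patchE; case: ifPn => [/set_mem Ax|/negP nAx].
    rewrite [RHS]integral_mkcond; apply: eq_integral => y _; rewrite !patchE.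
    congr (if _ then _ else _); apply/idP/idP => /set_mem H; apply/mem_set.
      by case: H.
    by split.
  rewrite integral0_eq// => y _; rewrite patchE ifF//; apply/negbTE/negP => /set_mem[/= Ax _].
  by apply: nAx; exact/mem_set.
have E2 y : (\int[m1]_x (f \_ (A `*` B)) (x, y) =
    ((fun y => \int[m1]_(x in A) f (x, y)) \_ B) y)%E.
  rewrite patchE; case: ifPn => [/set_mem By|/negP nBy].
    rewrite [RHS]integral_mkcond; apply: eq_integral => x _; rewrite !patchE.
    congr (if _ then _ else _); apply/idP/idP => /set_mem H; apply/mem_set.
      by case: H.
    by split.
  rewrite integral0_eq// => x _; rewrite patchE ifF//; apply/negbTE/negP => /set_mem[/= _ By].
  by apply: nBy; exact/mem_set.
under eq_integral do rewrite E1.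
under [X in _ = X -> _]eq_integral do rewrite E2.
by rewrite -!integral_mkcond.
Qed.

Lemma measurable_fun_integral_setX (B : set T2) (f : T1 * T2 -> \bar R) :
  measurable B -> measurable_fun setT f -> (forall x, 0 <= f x)%E ->
  measurable_fun setT (fun x => \int[m2]_(y in B) f (x, y))%E.
Proof.
move=> mB mf f0.
have mTB : measurable ([set: T1] `*` B) by exact: measurableX.
have mg : measurable_fun setT (f \_ (setT `*` B)).
  by apply/(measurable_restrictT _ mTB); exact: measurable_funTS.
have g0 x : (0 <= (f \_ (setT `*` B)) x)%E by rewrite patchE; case: ifP.
have := @measurable_fun_fubini_tonelli_F _ _ _ _ R m2 (f \_ (setT `*` B)) mg g0.
rewrite (_ : fubini_F _ _ = fun x => \int[m2]_(y in B) f (x, y))%E//.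
apply/funext => x; rewrite /fubini_F [RHS]integral_mkcond; apply: eq_integral => y _.
rewrite !patchE; congr (if _ then _ else _); apply/idP/idP => /set_mem H; apply/mem_set.
  by case: H.
by split.
Qed.

End Tonelli.

Section PlaneMeasurable.
Context {R : realType} d (X : measurableType d).
Local Notation plane := (R * R)%type.
Local Notation P := (measurableTypeR R * measurableTypeR R)%type.
Implicit Types (f g : X -> plane) (a : X -> R).

Lemma measurable_plane_add f g : measurable_fun setT (f : X -> P) ->
  measurable_fun setT (g : X -> P) -> measurable_fun setT ((fun x => f x + g x) : X -> P).
Proof.
move=> mf mg.
have f1 := measurableT_comp measurable_fst mf; have f2 := measurableT_comp measurable_snd mf.
have g1 := measurableT_comp measurable_fst mg; have g2 := measurableT_comp measurable_snd mg.
by apply: measurable_fun_pair; apply: measurable_funD.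
Qed.

Lemma measurable_plane_sub f g : measurable_fun setT (f : X -> P) ->
  measurable_fun setT (g : X -> P) -> measurable_fun setT ((fun x => f x - g x) : X -> P).
Proof.
move=> mf mg.
have f1 := measurableT_comp measurable_fst mf; have f2 := measurableT_comp measurable_snd mf.
have g1 := measurableT_comp measurable_fst mg; have g2 := measurableT_comp measurable_snd mg.
by apply: measurable_fun_pair; apply: measurable_funB.
Qed.

Lemma measurable_plane_scale a f : measurable_fun setT a ->
  measurable_fun setT (f : X -> P) -> measurable_fun setT ((fun x => a x *: f x) : X -> P).
Proof.
move=> ma mf.
have f1 := measurableT_comp measurable_fst mf; have f2 := measurableT_comp measurable_snd mf.
by apply: measurable_fun_pair; apply: measurable_funM.
Qed.

End PlaneMeasurable.

(** * Cones in a star-shaped domain *)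

Section Geometry.
Context {R : realType}.
Local Notation plane := (R * R)%type.
Local Notation P := (measurableTypeR R * measurableTypeR R)%type.
Local Notation leb2 := (@lebesgue_measure R \x @lebesgue_measure R)%E.
Local Notation edist := Defs.edist.

Lemma closure_near (A : set plane) (x : plane) (e : R) : closure A x -> 0 < e ->
  exists2 y, A y & edist y x < e.
Proof.
move=> clx e0; have e4 : 0 < e / 4 by rewrite divr_gt0.
have [y [Ay xy]] := clx _ (nbhsx_ballx x (PosNum e4)%:num e4).
exists y => //; rewrite edistE; apply: le_lt_trans (enorm_le_norm _) _.
have : `|y - x| <= e / 4.
  case: xy => h1 h2; rewrite plane_norm_le; apply/andP; split.
    by rewrite -normrN [X in `|X|](_ : _ = x.1 - y.1); [exact: ltW h1|rewrite /= opprB].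
  by rewrite -normrN [X in `|X|](_ : _ = x.2 - y.2); [exact: ltW h2|rewrite /= opprB].
by lra.
Qed.

(** A closed ball of the sup norm, in place of a disc, because the product measure gives its area at
    once. *)
Definition sup_box (z : plane) (q : R) : set plane := `[z.1 - q, z.1 + q] `*` `[z.2 - q, z.2 + q].

Lemma sup_boxP z q y : sup_box z q y <-> `|y - z| <= q.
Proof.
rewrite plane_norm_le /= !ler_distl /sup_box/=; split => [[]|/andP[]].
  by rewrite !in_itv/= => -> ->.
by rewrite !in_itv.
Qed.

Lemma measurable_sup_box z q : measurable (sup_box z q : set P).
Proof. by apply: measurableX; exact: measurable_itv. Qed.

Lemma sup_box_measure z q : 0 <= q -> leb2 (sup_box z q) = ((2 * q) ^+ 2)%:E.
Proof. by move=> q0; rewrite plane_boxE; [congr EFin; ring|lra|lra]. Qed.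

Variables (K : set plane) (z : plane) (r h : R).
Hypotheses (oK : open K) (r0 : 0 < r) (star : star_shaped_ball K z r).
Hypothesis diamK : forall x y, K x -> K y -> edist x y <= h.

(** The apex [xi] is replaced by a point [b] of [K] close to it, and [y] by [yb], chosen so that
    [s yb + (1 - s) b] is still the given point. The tolerance on [b] is exactly what keeps [yb] in
    the ball, and star-shapedness applies to the segment from [yb] to [b]. *)
Lemma cone_sub (y xi : plane) (s : R) : edist y z < r -> closure K xi -> 0 < s <= 1 ->
  K (xi + s *: (y - xi)).
Proof.
move=> yz clxi /andP[s0 s1]; have [ballK starK] := star.
have [s_eq1|s_neq1] := eqVneq s 1.
  by rewrite s_eq1 scale1r addrC subrK; apply: ballK; rewrite /eball/= edistC.
have s_lt1 : 0 < 1 - s by rewrite subr_gt0 lt_neqAle s_neq1.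
have e0 : 0 < (r - edist y z) * s / (1 - s) by rewrite divr_gt0// mulr_gt0// subr_gt0.
have [b Kb bxi] := closure_near clxi e0.
pose yb := y + ((1 - s) / s) *: (xi - b).
have ybz : eball z r yb.
  rewrite /eball/= edistC; apply: le_lt_trans (edist_triangle y _ _) _.
  rewrite (edistE yb y) (_ : yb - y = ((1 - s) / s) *: (xi - b)); last first.
    by rewrite /yb addrC addKr.
  rewrite enormZ; last by rewrite divr_ge0 ?ltW.
  rewrite -edistE (edistC xi b) -ltrBrDr -ltr_pdivlMl ?divr_gt0//.
  apply: lt_le_trans bxi _; rewrite le_eqVlt; apply/orP; left; apply/eqP; field.
  by rewrite !gt_eqF.
have := starK _ _ ybz Kb; apply; exists (1 - s); first by rewrite /= in_itv/= ltW//; lra.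
rewrite /segpt /yb; apply: injective_projections; rewrite /= /GRing.scale/=; field; exact: lt0r_neq0.
Qed.

Lemma edist_closure_le (y xi : plane) : K y -> closure K xi -> edist y xi <= h.
Proof.
move=> Ky clxi; apply/ler_addgt0Pr => e e0.
have [b Kb bxi] := closure_near clxi e0.
apply: le_trans (edist_triangle b _ _) _; rewrite lerD//; first exact: diamK.
exact: ltW.
Qed.

(** The homothety of centre [xi] and ratio [s] maps the disc of radius [r / 2] around [y] to a disc
    of radius [s r / 2], contained in [K] by [cone_sub]; a point outside [K] cannot be in it. *)
Lemma cone_dist (y xi xi' : plane) (s : R) : edist y z <= r / 2 -> closure K xi -> 0 < s <= 1 ->
  ~ K xi' -> s * (r / 2) <= edist (xi + s *: (y - xi)) xi'.
Proof.
move=> yz clxi s01; have /andP[s0 s1] := s01; rewrite leNgt => nK; apply/negP => H; apply: nK.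
pose y' := y + s^-1 *: (xi' - (xi + s *: (y - xi))).
have -> : xi' = xi + s *: (y' - xi).
  rewrite /y'; apply: injective_projections; rewrite /= /GRing.scale/=; field; exact: lt0r_neq0.
apply: cone_sub => //.
apply: le_lt_trans (edist_triangle y _ _) _.
rewrite (edistE y' y) (_ : y' - y = s^-1 *: (xi' - (xi + s *: (y - xi)))); last first.
  by rewrite /y' addrC addKr.
rewrite enormZ ?invr_ge0 ?(ltW s0)// -edistE (edistC xi').
have : s^-1 * edist (xi + s *: (y - xi)) xi' < r / 2 by rewrite ltr_pdivrMl.
lra.
Qed.

Lemma sup_box_edist y q : sup_box z q y -> edist y z <= 2 * q.
Proof.
move=> /sup_boxP yz; rewrite edistE; apply: le_trans (enorm_le_norm _) _; lra.
Qed.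

End Geometry.

Section PlaneLebesgue.
Context {R : realType}.
Local Notation P := (measurableTypeR R * measurableTypeR R)%type.
Local Notation leb2 := (@lebesgue_measure R \x @lebesgue_measure R)%E.

(* The product measure has no canonical sigma-finite structure: the library
   attaches one to products of subprobabilities only. *)
Definition plane_lebesgue : set P -> \bar R := leb2.

HB.instance Definition _ := Measure.copy plane_lebesgue leb2.

Let plane_lebesgue_sigma_finite : sigma_finite setT plane_lebesgue.
Proof.
exists (fun n => sup_box 0 n%:R).
  apply/esym/seteqP; split => // x _.
  have [n xn] : exists n : nat, `|x| <= n%:R.
    by exists (Num.truncn `|x|).+1; rewrite ltW// truncnS_gt.
  by exists n => //; apply/sup_boxP; rewrite subr0.
move=> n; split; first exact: measurable_sup_box.
by rewrite /plane_lebesgue sup_box_measure// ltry.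
Qed.

HB.instance Definition _ := Measure_isSigmaFinite.Build _ _ _ plane_lebesgue
  plane_lebesgue_sigma_finite.

End PlaneLebesgue.

Section RealMeasurable.
Context {R : realType} d (X : measurableType d).

Lemma measurable_inv (f : X -> R) : measurable_fun setT f -> measurable_fun setT (fun x => (f x)^-1).
Proof.
apply: (measurableT_comp (f := fun x : R => x^-1)).
rewrite (_ : setT = [set~ 0] `|` [set 0]); last by rewrite setvU.
have o0 : open [set~ (0 : R)] by rewrite openC; exact: closed_eq.
apply/measurable_funU => //; first exact: open_measurable.
split; last exact: measurable_fun_set1.
by apply: open_continuous_measurable_fun => // x /set_mem/eqP x0; exact: inv_continuous.
Qed.

Lemma measurable_sqrt (f : X -> R) : measurable_fun setT f -> measurable_fun setT (fun x => Num.sqrt (f x)).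
Proof.
apply: (measurableT_comp (f := fun x : R => Num.sqrt x)).
by apply: continuous_measurable_fun; exact: sqrt_continuous.
Qed.

End RealMeasurable.

Section Symmetrize.
Context d (T : measurableType d) (R : realType) (mu : {sigma_finite_measure set T -> \bar R}).

(** Tonelli exchanges the two variables, so an estimate for a pair may be split into a part charged
    to [t] and its mirror image charged to [s]. *)
Lemma integral_symmetrize (b : T -> T -> \bar R) :
  measurable_fun setT (fun p : T * T => b p.1 p.2) -> (forall t s, 0 <= b t s)%E ->
  (\int[mu]_t \int[mu]_s (2%:E * b t s + 2%:E * b s t) = 4%:E * \int[mu]_t \int[mu]_s b t s)%E.
Proof.
move=> mb b0.
have mb' : measurable_fun setT (fun p : T * T => b p.2 p.1).
  exact: (measurableT_comp mb (@measurable_swap _ _ _ _)).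
have msec t : measurable_fun setT (b t) by exact: (measurableT_comp mb (measurable_pair1 t)).
have msec' t : measurable_fun setT (b^~ t) by exact: (measurableT_comp mb (measurable_pair2 t)).
have bE : (\int[mu]_t \int[mu]_s b s t = \int[mu]_t \int[mu]_s b t s)%E.
  exact: (tonelli_setX mu mu measurableT measurableT mb' (fun q => b0 _ _)).
have mI : measurable_fun setT (fun t => \int[mu]_s b t s)%E.
  exact: (measurable_fun_integral_setX mu measurableT mb (fun q => b0 _ _)).
have mI' : measurable_fun setT (fun t => \int[mu]_s b s t)%E.
  exact: (measurable_fun_integral_setX mu measurableT mb' (fun q => b0 _ _)).
have I0 t : (0 <= \int[mu]_s b t s)%E by exact: integral_ge0.
have I0' t : (0 <= \int[mu]_s b s t)%E by exact: integral_ge0.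
transitivity (\int[mu]_t (2%:E * \int[mu]_s b t s + 2%:E * \int[mu]_s b s t))%E.
  apply: eq_integral => t _.
  rewrite ge0_integralD//; [|by move=> s _; rewrite mule_ge0|exact: measurable_funeM
    |by move=> s _; rewrite mule_ge0|exact: measurable_funeM].
  by rewrite !ge0_integralZl.
rewrite ge0_integralD//; [|by move=> s _; rewrite mule_ge0|exact: measurable_funeM
  |by move=> s _; rewrite mule_ge0|exact: measurable_funeM].
rewrite !ge0_integralZl// bE -ge0_muleDl// -EFinD; congr (_%:E * _)%E; ring.
Qed.

End Symmetrize.

(** * The trace inequality *)

Section TraceInequality.
Context {R : realType}.
Local Notation plane := (R * R)%type.
Local Notation P := (measurableTypeR R * measurableTypeR R)%type.
Local Notation leb := (@lebesgue_measure R).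
Local Notation leb2 := (@lebesgue_measure R \x @lebesgue_measure R)%E.
Local Notation edist := Defs.edist.
Context d (T : measurableType d) (mu : {finite_measure set T -> \bar R}).
Variables (G : T -> plane) (mG : measurable_fun setT (G : T -> P)).
Variables (K : set plane) (z : plane) (r h C1 : R).
Hypotheses (oK : open K) (r0 : 0 < r) (rh : r <= 2 * h) (star : star_shaped_ball K z r).
Hypothesis diamK : forall x y, K x -> K y -> edist x y <= h.
Hypotheses (clG : forall t, closure K (G t)) (nKG : forall t, ~ K (G t)).
Hypothesis C1_ge0 : 0 <= C1.
Hypothesis reg : forall x s, 0 < s -> (mu [set t | (edist x (G t) < s)%R] <= (C1 * s)%:E)%E.
Variables (phi : plane -> R) (sphi : smooth phi).

Let h0 : 0 < h. Proof. by have := lt_le_trans r0 rh; lra. Qed.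

Definition grad_sq (f : plane -> R) (x : plane) : R := \sum_(b : bool) (partial b f x) ^+ 2.

Lemma grad_sqE f x : grad_sq f x = partial true f x ^+ 2 + partial false f x ^+ 2.
Proof. by rewrite /grad_sq big_bool. Qed.

Lemma grad_sq_ge0 f x : 0 <= grad_sq f x.
Proof. by rewrite grad_sqE addr_ge0 ?sqr_ge0. Qed.

Lemma measurable_grad_sq f : smooth f -> measurable_fun setT (grad_sq f : P -> R).
Proof.
move=> sf; apply: measurable_sum => b; apply: measurable_funX.
by apply: smooth_measurable; exact: smooth_partial.
Qed.

Let Gd := grad_sq phi.

(* The rays are parametrised by [t = u ^+ 2]: Cauchy-Schwarz in [t] itself
   would lose a logarithm once integrated against [edist^-2]. *)
Lemma ray_increment (xi y : plane) (e : R) : 0 <= e -> enorm (y - xi) <= h ->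
  (((phi (xi + e ^+ 2 *: (y - xi)) - phi xi) ^+ 2)%:E <=
   (4 * h ^+ 2 * e)%:E *
     \int[leb]_(u in `[0%R, e]) (u ^+ 2 * Gd (xi + u ^+ 2 *: (y - xi)))%:E)%E.
Proof.
move=> e0 vh; set v := y - xi.
pose g (u : R) : plane := xi + u ^+ 2 *: v.
have dg1 (u : R) : is_derive u (1 : R) (fst \o g) (2 * u * v.1).
  rewrite (_ : _ \o _ = cst xi.1 + v.1 \*: (@id R ^+ 2)); last first.
    by apply/funext => s; rewrite /= -[RHS]/(xi.1 + v.1 * s ^+ 2) mulrC.
  by apply: is_derive_eq; rewrite /GRing.scale/= add0r expr1 mulr1; ring.
have dg2 (u : R) : is_derive u (1 : R) (snd \o g) (2 * u * v.2).
  rewrite (_ : _ \o _ = cst xi.2 + v.2 \*: (@id R ^+ 2)); last first.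
    by apply/funext => s; rewrite /= -[RHS]/(xi.2 + v.2 * s ^+ 2) mulrC.
  by apply: is_derive_eq; rewrite /GRing.scale/= add0r expr1 mulr1; ring.
have dfg (f : plane -> R) : smooth f -> continuous (f \o g).
  move=> sf u; apply: differentiable_continuous; apply/derivable1_diffP.
  by have [] := is_derive_path (sf [::] (g u)) (dg1 u) (dg2 u).
pose f' u := 2 * u * v.1 * partial false phi (g u) + 2 * u * v.2 * partial true phi (g u).
have cf' : continuous f'.
  have c2 c : continuous (fun u : R => 2 * u * c).
    by move=> u; apply: cvgM; [apply: cvgM; [exact: cvg_cst|exact: cvg_id]|exact: cvg_cst].
  by move=> u; apply: cvgD; apply: cvgM; [exact: c2|exact: (dfg _ (smooth_partial false sphi))
    |exact: c2|exact: (dfg _ (smooth_partial true sphi))].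
have := @sqr_increment_le R (phi \o g) f' e e0 (fun u => is_derive_path (sphi [::] (g u)) (dg1 u) (dg2 u)) cf'.
rewrite /= /g expr0n/= scale0r addr0 => H; apply: le_trans H _.
have -> : (4 * h ^+ 2 * e)%:E = (e%:E * (4 * h ^+ 2)%:E)%E by rewrite -EFinM mulrC.
rewrite -muleA; apply: lee_pmul => //; first by apply: integral_ge0 => u _; rewrite lee_fin sqr_ge0.
have mI : measurable_fun `[0, e]%classic (fun u : measurableTypeR R => (u ^+ 2 * Gd (g u))%:E).
  apply/measurable_EFinP; apply: measurable_funTS; apply: continuous_measurable_fun => u.
  apply: cvgM; first exact: exprn_continuous.
  rewrite -/(g u).
  rewrite (_ : (fun x => _) = fun u => (partial true phi \o g) u * (partial true phi \o g) u +
     (partial false phi \o g) u * (partial false phi \o g) u); last first.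
    by apply/funext => s; rewrite /Gd grad_sqE !expr2.
  rewrite (_ : Gd (g u) = partial true phi (g u) * partial true phi (g u) +
    partial false phi (g u) * partial false phi (g u)); last by rewrite /Gd grad_sqE !expr2.
  by apply: cvgD; apply: cvgM; apply: (dfg _ (smooth_partial _ sphi)).
rewrite -ge0_integralZl//.
- apply: ge0_integral_mono => u _; first by rewrite lee_fin sqr_ge0.
  rewrite -EFinM lee_fin /f' /Gd grad_sqE -/(g u).
  set a := partial false phi (g u); set b := partial true phi (g u).
  have -> : 2 * u * v.1 * a + 2 * u * v.2 * b = (2 * u) * (v.1 * a + v.2 * b) by ring.
  have := dot_le v.1 v.2 a b; have := sqr_enorm v.
  have : enorm v ^+ 2 <= h ^+ 2 by rewrite lerXn2r ?nnegrE ?enorm_ge0 ?(ltW h0).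
  move=> vh2 vE dot.
  have : (v.1 * a + v.2 * b) ^+ 2 <= h ^+ 2 * (b ^+ 2 + a ^+ 2).
    apply: le_trans dot _; rewrite -vE [b ^+ 2 + _]addrC ler_wpM2r// addr_ge0 ?sqr_ge0//.
  move=> H1; rewrite exprMn (_ : (2 * u) ^+ 2 = 4 * u ^+ 2); last by ring.
  rewrite (_ : 4 * h ^+ 2 * _ = 4 * u ^+ 2 * (h ^+ 2 * (b ^+ 2 + a ^+ 2))); last by ring.
  by rewrite ler_wpM2l// mulr_ge0// sqr_ge0.
- by move=> u _; rewrite lee_fin mulr_ge0 ?sqr_ge0 ?grad_sq_ge0.
- by rewrite lee_fin mulr_ge0 ?sqr_ge0.
Qed.

Definition ray_pt (t : T) (u : R) (y : plane) : plane := G t + u ^+ 2 *: (y - G t).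

Lemma measurable_ray_pt d' (X : measurableType d') (a : X -> T) (u : X -> R) (y : X -> plane) :
  measurable_fun setT a -> measurable_fun setT u -> measurable_fun setT (y : X -> P) ->
  measurable_fun setT ((fun x => ray_pt (a x) (u x) (y x)) : X -> P).
Proof.
move=> ma mu' my; have mGa : measurable_fun setT ((G \o a) : X -> P) by exact: measurableT_comp.
apply: measurable_plane_add => //; apply: measurable_plane_scale; first exact: measurable_funX.
exact: measurable_plane_sub.
Qed.

(** A box of half-width [r / 4] lies within distance [r / 2] of [z], and it contains every translate
    by at most [r / 8] of the box of half-width [r / 8]. *)
Let Q' : set P := sup_box z (r / 4).
Let mQ' : measurable Q'. Proof. exact: measurable_sup_box. Qed.

Definition ray_energy (t : T) (u : R) : \bar R := (\int[leb2]_(y in Q') (Gd (ray_pt t u y))%:E)%E.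

Lemma ray_energy_ge0 t u : (0 <= ray_energy t u)%E.
Proof. by apply: integral_ge0 => y _; rewrite lee_fin grad_sq_ge0. Qed.

Let mI01 : measurable (`[0, 1]%classic : set (measurableTypeR R)).
Proof. exact: measurable_itv. Qed.

Lemma measurable_ray_energy :
  measurable_fun setT (fun p : T * measurableTypeR R => ray_energy p.1 p.2).
Proof.
have := (@measurable_fun_integral_setX _ _ _ _ _ plane_lebesgue Q'
  (fun q : (T * measurableTypeR R) * P => (Gd (ray_pt q.1.1 q.1.2 q.2))%:E)) mQ'; apply.
  apply/measurable_EFinP; apply: (measurableT_comp (measurable_grad_sq sphi)).
  apply: measurable_ray_pt.
  - exact: measurableT_comp measurable_fst measurable_fst.
  - exact: measurableT_comp measurable_snd measurable_fst.
  - exact: measurable_snd.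
by move=> q; rewrite lee_fin grad_sq_ge0.
Qed.

Let Q'h t y : Q' y -> enorm (y - G t) <= h.
Proof.
move=> Qy; rewrite -edistE; apply: (edist_closure_le diamK) => //.
have [ballK _] := star; apply: ballK; rewrite /eball/= edistC.
by have := r0; have := sup_box_edist Qy; lra.
Qed.

Definition ray_defect (t : T) (e : R) : \bar R :=
  (\int[leb2]_(y in Q') ((phi (ray_pt t e y) - phi (G t)) ^+ 2)%:E)%E.

Lemma ray_defect_le t e : 0 <= e ->
  (ray_defect t e <=
   (4 * h ^+ 2 * e)%:E * \int[leb]_(u in `[0%R, e]) ((u ^+ 2)%:E * ray_energy t u))%E.
Proof.
move=> e0.
have mIe : measurable (`[0, e]%classic : set (measurableTypeR R)) by exact: measurable_itv.
pose F (q : P * measurableTypeR R) : \bar R := (q.2 ^+ 2 * Gd (ray_pt t q.2 q.1))%:E.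
have mF : measurable_fun setT F.
  apply/measurable_EFinP; apply: measurable_funM; first by apply: measurable_funX; exact: measurable_snd.
  apply: (measurableT_comp (measurable_grad_sq sphi)); apply: measurable_ray_pt.
  - exact: measurable_cst.
  - exact: measurable_snd.
  - exact: measurable_fst.
have F0 q : (0 <= F q)%E by rewrite lee_fin mulr_ge0 ?sqr_ge0 ?grad_sq_ge0.
have c0 : (0 <= (4 * h ^+ 2 * e)%:E)%E by rewrite lee_fin mulr_ge0// mulr_ge0// sqr_ge0.
apply: (@le_trans _ _ (\int[leb2]_(y in Q') ((4 * h ^+ 2 * e)%:E *
    \int[leb]_(u in `[0%R, e]) F (y, u)))%E).
  apply: ge0_integral_mono => y Qy; first by rewrite lee_fin sqr_ge0.
  by apply: ray_increment => //; exact: Q'h.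
rewrite ge0_integralZl//; first last.
- by move=> y _; apply: integral_ge0.
- by apply: measurable_funTS; exact: (measurable_fun_integral_setX leb mIe mF F0).
apply: lee_pmul => //.
- by apply: integral_ge0 => y _; apply: integral_ge0.
rewrite (tonelli_setX plane_lebesgue leb mQ' mIe mF F0).
rewrite le_eqVlt; apply/orP; left; apply/eqP; apply: eq_integral => u _.
rewrite -ge0_integralZl//.
- by apply/measurable_EFinP; apply: measurable_funTS; apply: (measurableT_comp (measurable_grad_sq sphi));
   apply: measurable_ray_pt.
- by move=> y _; rewrite lee_fin grad_sq_ge0.
- by rewrite lee_fin sqr_ge0.
Qed.


Let dst t s := edist (G t) (G s).

(** [esc d ^+ 2] is the relative height at which the rays from two boundary points at distance [d]
    are compared. At height [8 * d / r] the cones over the box differ by a shift of the target of at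
    most [r / 8]; the height 1, where all rays reach their targets, is the ceiling. *)
Definition esc (d : R) : R := Num.sqrt (Num.min 1 (8 * d / r)).

Lemma esc_ge0 d0 : 0 <= esc d0. Proof. exact: sqrtr_ge0. Qed.

Lemma sqr_esc d0 : 0 <= d0 -> esc d0 ^+ 2 = Num.min 1 (8 * d0 / r).
Proof. by move=> d00; rewrite sqr_sqrtr// le_min ler01/= mulr_ge0// ?mulr_ge0// invr_ge0 ltW. Qed.

Lemma esc_le1 d0 : esc d0 <= 1.
Proof. by rewrite -sqrtr1 ler_wsqrtr// ge_min lexx. Qed.

Lemma esc_gt0 d0 : 0 < d0 -> 0 < esc d0.
Proof. by move=> d00; rewrite sqrtr_gt0 lt_min ltr01/= divr_gt0// mulr_gt0. Qed.

Lemma measurable_ray_defect_integrand t e :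
  measurable_fun setT ((fun y => ((phi (ray_pt t e y) - phi (G t)) ^+ 2)%:E) : P -> \bar R).
Proof.
apply/measurable_EFinP; apply: measurable_funX; apply: measurable_funB => //.
have mphi : measurable_fun setT (phi : P -> R) by exact: smooth_measurable.
apply: (measurableT_comp mphi).
exact: (measurable_ray_pt (u := cst e)).
Qed.

(** The ray from [G t] to [y] and the ray from [G s] to [tau + y] pass through the same point at
    parameter [e]. Comparing both boundary values with the value there and integrating over the
    small box [Q], of area [r^2 / 16], leaves two defects over [Q'], the second after translation by
    [tau]. *)
Lemma pair_defect_le t s : 0 < dst t s ->
  (((r ^+ 2 / 16) * (phi (G t) - phi (G s)) ^+ 2)%:E <=
   2%:E * ray_defect t (esc (dst t s)) + 2%:E * ray_defect s (esc (dst t s)))%E.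
Proof.
move=> d0; set e := esc _; have e0 : 0 < e by exact: esc_gt0.
have e20 : e ^+ 2 != 0 by rewrite expf_neq0// gt_eqF.
pose tau : plane := ((1 - e ^+ 2) / e ^+ 2) *: (G t - G s).
have tau_le : `|tau| <= r / 8.
  have e2 := sqr_esc (ltW d0); rewrite -/e in e2.
  have coef0 : 0 <= (1 - e ^+ 2) / e ^+ 2.
    by rewrite divr_ge0 ?sqr_ge0// e2 subr_ge0 ge_min lexx.
  apply: le_trans (enorm_ge_norm _) _; rewrite enormZ// -edistE -/(dst t s).
  rewrite mulrAC ler_pdivrMr ?exprn_gt0//.
  have [le1|gt1] := leP 1 (8 * dst t s / r).
    by rewrite e2 min_l// subrr mul0r mulr1 divr_ge0// ltW.
  rewrite e2 min_r ?(ltW gt1)//.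
  rewrite (_ : r / 8 * (8 * dst t s / r) = dst t s); last by field; rewrite gt_eqF.
  by rewrite ler_piMl ?(ltW d0)// gerBl divr_ge0// ?(ltW r0)// mulr_ge0// ltW.
have shiftE y : ray_pt s e (tau + 1 *: y) = ray_pt t e y.
  rewrite /ray_pt /tau scale1r.
  by apply: injective_projections; rewrite /= /GRing.scale/=; field; rewrite gt_eqF.
pose Q : set P := sup_box z (r / 8).
have mQ : measurable Q by exact: measurable_sup_box.
have QQ' y : Q y -> Q' y.
  by rewrite /Q /Q' => /sup_boxP yz; apply/sup_boxP; apply: le_trans yz _; have := r0; lra.
have QQ't y : Q y -> Q' (tau + 1 *: y).
  rewrite /Q /Q' => /sup_boxP yz; apply/sup_boxP; rewrite scale1r -addrA.
  apply: le_trans (ler_normD _ _) _; have := lerD tau_le yz; have := r0; lra.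
pose F t := fun y => ((phi (ray_pt t e y) - phi (G t)) ^+ 2)%:E.
have F0 t' y : (0 <= F t' y)%E by rewrite lee_fin sqr_ge0.
have mF t' : measurable_fun setT (F t' : P -> \bar R) by exact: measurable_ray_defect_integrand.
have mFt : measurable_fun setT ((fun y => F s (tau + 1 *: y)) : P -> \bar R).
  apply: (measurableT_comp (mF s)); apply: measurable_plane_add => //.
  exact: (measurable_plane_scale (a := cst 1)).
have -> : ((r ^+ 2 / 16) * (phi (G t) - phi (G s)) ^+ 2)%:E =
    (\int[leb2]_(y in Q) (cst ((phi (G t) - phi (G s)) ^+ 2)%:E y))%E.
  rewrite integral_cst// -[X in _ = (_ * X)%E]/(leb2 (sup_box z (r / 8))).
  rewrite sup_box_measure; last by rewrite divr_ge0// ltW.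
  by rewrite -EFinM; congr EFin; field.
apply: (@le_trans _ _ (\int[leb2]_(y in Q) (2%:E * F t y + 2%:E * F s (tau + 1 *: y)%R))%E).
  apply: ge0_integral_mono => y Qy; first by rewrite lee_fin sqr_ge0.
  rewrite /F shiftE /= -!EFinM -EFinD lee_fin.
  have := sqr_ge0 ((phi (ray_pt t e y) - phi (G t)) + (phi (ray_pt t e y) - phi (G s))); nra.
rewrite ge0_integralD//; first last.
- by apply: measurable_funTS; apply: measurable_funeM.
- by move=> y _; rewrite mule_ge0.
- by apply: measurable_funTS; apply: measurable_funeM.
- by move=> y _; rewrite mule_ge0.
rewrite !ge0_integralZl//; try exact: measurable_funTS.
apply: leeD; apply: lee_pmul => //; try by apply: integral_ge0.
  rewrite /ray_defect integral_mkcond [leRHS]integral_mkcond.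
  apply: ge0_integral_mono => y _; first by rewrite patchE; case: ifP.
  rewrite !patchE; case: ifPn => [/set_mem Qy|_]; last by case: ifP => // _; exact: F0.
  by rewrite ifT//; apply/mem_set; exact: QQ'.
rewrite /ray_defect integral_mkcond [leRHS]integral_mkcond.
have mFQ : measurable_fun setT (F s \_ Q').
  by apply/(measurable_restrictT _ mQ'); exact: measurable_funTS.
have FQ0 x : (0 <= (F s \_ Q') x)%E by rewrite patchE; case: ifP.
rewrite [leRHS](ge0_integral_plane_affine tau ltr01 mFQ FQ0) expr1n mul1e.
apply: ge0_integral_mono => y _; first by rewrite patchE; case: ifP.
rewrite !patchE; case: ifPn => [/set_mem Qy|_]; last by case: ifP.
by rewrite ifT//; apply/mem_set; exact: QQ't.
Qed.


(** The coefficient of the level [u] of a ray for a pair at distance [d0]: [d0^-2] from the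
    Gagliardo quotient, [esc d0] from Cauchy-Schwarz on the ray, and the cut-off from the range of
    [u]. *)
Definition kern (d0 u : R) : R := if u <= esc d0 then d0^-1 ^+ 2 * esc d0 else 0.

Lemma kern_ge0 d0 u : 0 <= kern d0 u.
Proof. by rewrite /kern; case: ifP => // _; rewrite mulr_ge0 ?sqr_ge0 ?esc_ge0. Qed.

Definition split_energy (t s : T) : \bar R :=
  (\int[leb]_(u in `[0%R, 1%R]) ((4 * h ^+ 2 * kern (dst t s) u * u ^+ 2)%:E * ray_energy t u))%E.

Let mRE t : measurable_fun setT (fun u : measurableTypeR R => ray_energy t u).
Proof. exact: (measurableT_comp measurable_ray_energy (measurable_pair1 t)). Qed.

Lemma integral_subset_mono d' (X : measurableType d') (nu : {measure set X -> \bar R})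
    (A B : set X) (f g : X -> \bar R) :
  (forall x, A x -> 0 <= f x)%E -> A `<=` B -> (forall x, A x -> f x <= g x)%E ->
  (forall x, B x -> 0 <= g x)%E -> (\int[nu]_(x in A) f x <= \int[nu]_(x in B) g x)%E.
Proof.
move=> f0 AB fg g0; rewrite integral_mkcond [leRHS]integral_mkcond.
apply: ge0_integral_mono => x _; rewrite !patchE.
  by case: ifPn => // /set_mem; exact: f0.
case: ifPn => [/set_mem Ax|_]; first by rewrite ifT; [exact: fg|apply/mem_set; exact: AB].
by case: ifPn => // /set_mem; exact: g0.
Qed.

Lemma scaled_defect_le t s : 0 < dst t s ->
  (((dst t s)^-1 ^+ 2)%:E * ray_defect t (esc (dst t s)) <= split_energy t s)%E.
Proof.
move=> d0; set e := esc _; have e0 : 0 <= e by exact: esc_ge0.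
have mIe : measurable (`[0, e]%classic : set (measurableTypeR R)) by exact: measurable_itv.
have mF : measurable_fun (`[0, e]%classic : set (measurableTypeR R))
    (fun u => ((u ^+ 2)%:E * ray_energy t u)%E).
  apply: measurable_funTS; apply: emeasurable_funM; last exact: mRE.
  by apply/measurable_EFinP; exact: measurable_funX.
have F0 u : (0 <= (u ^+ 2)%:E * ray_energy t u)%E.
  by rewrite mule_ge0 ?lee_fin ?sqr_ge0 ?ray_energy_ge0.
have c0 : 0 <= 4 * h ^+ 2 * e by rewrite mulr_ge0// mulr_ge0// sqr_ge0.
apply: (@le_trans _ _ (((dst t s)^-1 ^+ 2)%:E * ((4 * h ^+ 2 * e)%:E *
  \int[leb]_(u in `[0%R, e]) ((u ^+ 2)%:E * ray_energy t u)))%E).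
  by apply: lee_wpmul2l; [rewrite lee_fin sqr_ge0|exact: ray_defect_le].
rewrite muleA -EFinM -ge0_integralZl//; last by rewrite lee_fin mulr_ge0 ?sqr_ge0.
apply: integral_subset_mono => u /=.
- by move=> _; rewrite mule_ge0// lee_fin mulr_ge0 ?sqr_ge0.
- by rewrite !in_itv/= => /andP[-> ue]; rewrite (le_trans ue)// esc_le1.
- rewrite in_itv/= => /andP[_ ue]; rewrite /kern ue muleA -EFinM -/e.
  by rewrite (_ : _ * (4 * h ^+ 2 * e) * u ^+ 2 =
     4 * h ^+ 2 * ((dst t s)^-1 ^+ 2 * e) * u ^+ 2)//; ring.
- move=> _; rewrite mule_ge0 ?ray_energy_ge0// lee_fin mulr_ge0 ?sqr_ge0//.
  by rewrite mulr_ge0 ?kern_ge0// mulr_ge0// sqr_ge0.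
Qed.

Lemma pair_quotient_le t s :
  (((r ^+ 2 / 16) * ((phi (G t) - phi (G s)) ^+ 2 / edist (G t) (G s) ^+ 2))%:E <=
   2%:E * split_energy t s + 2%:E * split_energy s t)%E.
Proof.
have B0 t' s' : (0 <= split_energy t' s')%E.
  apply: integral_ge0 => u _; rewrite mule_ge0 ?ray_energy_ge0// lee_fin mulr_ge0 ?sqr_ge0//.
  by rewrite mulr_ge0 ?kern_ge0// mulr_ge0// sqr_ge0.
have := edist_ge0 (G t) (G s); rewrite le_eqVlt => /predU1P[<-|d0].
  (* For coincident boundary points the quotient is [0], since [0^-1 = 0]. *)
  by rewrite expr0n/= invr0 !mulr0 adde_ge0// mule_ge0.
have dC : dst s t = dst t s by rewrite /dst edistC.
have -> : ((r ^+ 2 / 16) * ((phi (G t) - phi (G s)) ^+ 2 / edist (G t) (G s) ^+ 2))%:E =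
  (((dst t s)^-1 ^+ 2)%:E * ((r ^+ 2 / 16) * (phi (G t) - phi (G s)) ^+ 2)%:E)%E.
  by rewrite -EFinM /dst exprVn; congr EFin; ring.
apply: (@le_trans _ _ (((dst t s)^-1 ^+ 2)%:E *
    (2%:E * ray_defect t (esc (dst t s)) + 2%:E * ray_defect s (esc (dst t s))))%E).
  by apply: lee_wpmul2l; [rewrite lee_fin sqr_ge0|exact: pair_defect_le].
have RD0 t' e : (0 <= ray_defect t' e)%E by apply: integral_ge0 => y _; rewrite lee_fin sqr_ge0.
rewrite ge0_muleDr ?mule_ge0//; apply: leeD; rewrite muleCA; apply: lee_wpmul2l => //.
  exact: scaled_defect_le.
by rewrite -dC; apply: scaled_defect_le; rewrite dC.
Qed.

Let mdst : measurable_fun setT (fun p : T * T => dst p.1 p.2).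
Proof. by apply: measurable_edist; [exact: (measurableT_comp mG measurable_fst)|exact: (measurableT_comp mG measurable_snd)]. Qed.

Lemma measurable_esc d' (X : measurableType d') (a : X -> R) : measurable_fun setT a ->
  measurable_fun setT (fun x => esc (a x)).
Proof.
move=> ma; apply: measurable_sqrt; apply: measurable_minr => //.
by apply: measurable_funM => //; exact: measurable_funM.
Qed.

Lemma measurable_kern d' (X : measurableType d') (a : X -> R) (u : X -> R) :
  measurable_fun setT a -> measurable_fun setT u ->
  measurable_fun setT (fun x => kern (a x) (u x)).
Proof.
move=> ma mu'; have me := measurable_esc ma.
rewrite /kern; apply: measurable_fun_ifT.
- exact: measurable_fun_ler.
- by apply: measurable_funM => //; apply: measurable_funX; exact: measurable_inv.
- exact: measurable_cst.
Qed.

(** The condition [u <= esc d] confines [s] to distances [d >= u^2 r / 8], where the kernel is at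
    most of order [d^(-3/2) r^(-1/2)]. Against a measure of linear growth the shells sum to the
    inverse square root of the lower limit, that is to [1 / (r u)] up to a constant. *)
Lemma kern_integral_le t u : 0 < u -> (\int[mu]_s (kern (dst t s) u)%:E <= (128 * C1 / (r * u))%:E)%E.
Proof.
move=> u0.
pose rho := u ^+ 2 * r / 8; have rho0 : 0 < rho by rewrite divr_gt0// mulr_gt0// exprn_gt0.
have mf : measurable_fun setT (fun s => dst t s).
  exact: (measurableT_comp mdst (measurable_pair1 t)).
pose g d0 := d0^-1 ^+ 2 * esc d0.
have g0 d0 : 0 <= g d0 by rewrite mulr_ge0 ?sqr_ge0 ?esc_ge0.
apply: (@le_trans _ _ (\int[mu]_(s in [set s | (rho <= dst t s)%R]) (g (dst t s))%:E)%E).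
  rewrite [leRHS]integral_mkcond; apply: ge0_integral_mono => s _; first by rewrite lee_fin kern_ge0.
  rewrite patchE /kern; case: ifPn => [ue|_]; last by case: ifP => // _; rewrite lee_fin.
  rewrite ifT//; apply/mem_set => /=.
  have : u ^+ 2 <= esc (dst t s) ^+ 2 by rewrite lerXn2r ?nnegrE ?esc_ge0// ltW.
  rewrite sqr_esc ?edist_ge0// le_min => /andP[_]; rewrite ler_pdivlMr//.
  by rewrite /rho; lra.
have b0 : 0 <= 64 / (r * u) by rewrite divr_ge0// mulr_ge0// ltW.
have -> : 128 * C1 / (r * u) = 2 * (64 / (r * u)) * C1 by field; rewrite !gt_eqF.
apply: (@integral_dyadic_le _ _ _ mu (fun s => dst t s) g 1) => //.
- apply: measurable_funM; last exact: measurable_esc.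
  by apply: measurable_funX; exact: measurable_inv.
- by move=> s s0; rewrite expr1; exact: reg.
- move=> k s; set a := 4 ^+ k * rho; have a0 : 0 < a by rewrite mulr_gt0// exprn_gt0.
  move=> as_ sa; have s0 : 0 < s by exact: lt_le_trans as_.
  have sE : esc s <= 2 ^+ k.+1 * u.
    apply: ler_of_sqr; first by rewrite mulr_ge0 ?exprn_ge0// ltW.
    rewrite sqr_esc ?(ltW s0)//; apply: (@le_trans _ _ (8 * s / r)); first by rewrite ge_min lexx orbT.
    rewrite ler_pdivrMr// exprMn -exprM mulnC exprM.
    have -> : (2 : R) ^+ 2 = 4 by rewrite -natrX.
    by have := ltW sa; rewrite /rho; lra.
  have gE : g s <= a^-1 ^+ 2 * (2 ^+ k.+1 * u).
    rewrite ler_pM ?sqr_ge0 ?esc_ge0// lerXn2r ?nnegrE ?invr_ge0 ?(ltW a0) ?(ltW s0)//.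
    by rewrite lef_pV2.
  rewrite expr1; apply: (@le_trans _ _ (a^-1 ^+ 2 * (2 ^+ k.+1 * u) * (4 ^+ k.+1 * rho))).
    by rewrite ler_wpM2r// mulr_ge0 ?exprn_ge0// ltW.
  have e4 : (4 : R) ^+ k = (2 ^+ k) ^+ 2 by rewrite expr2 -exprMn; congr (_ ^+ _); ring.
  rewrite /a /rho (exprS 4 k) (exprS 2 k) e4 (exprVn 2 k); have p0 : (2 : R) ^+ k != 0 by rewrite expf_neq0.
  rewrite le_eqVlt; apply/orP; left; apply/eqP; field.
  by rewrite !gt_eqF// exprn_gt0.
Qed.


Let msplit_integrand : measurable_fun setT (fun q : (T * T) * measurableTypeR R =>
  ((4 * h ^+ 2 * kern (dst q.1.1 q.1.2) q.2 * q.2 ^+ 2)%:E * ray_energy q.1.1 q.2)%E).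
Proof.
have m2 : measurable_fun setT (fun q : (T * T) * measurableTypeR R => q.2) by exact: measurable_snd.
have m1 : measurable_fun setT (fun q : (T * T) * measurableTypeR R => q.1.1).
  exact: measurableT_comp measurable_fst measurable_fst.
apply: emeasurable_funM.
  apply/measurable_EFinP; apply: measurable_funM; last exact: measurable_funX.
  apply: measurable_funM => //; apply: measurable_kern => //.
  exact: (measurableT_comp mdst measurable_fst).
have mp : measurable_fun setT (fun q : (T * T) * measurableTypeR R => (q.1.1, q.2)).
  exact: measurable_fun_pair.
exact: (measurableT_comp measurable_ray_energy mp).
Qed.

Let split_integrand_ge0 (q : (T * T) * measurableTypeR R) :
  (0 <= (4 * h ^+ 2 * kern (dst q.1.1 q.1.2) q.2 * q.2 ^+ 2)%:E * ray_energy q.1.1 q.2)%E.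
Proof.
rewrite mule_ge0 ?ray_energy_ge0// lee_fin mulr_ge0 ?sqr_ge0//.
by rewrite mulr_ge0 ?kern_ge0// mulr_ge0// sqr_ge0.
Qed.

Lemma split_energy_ge0 t s : (0 <= split_energy t s)%E.
Proof. by apply: integral_ge0 => u _; exact: (split_integrand_ge0 ((t, s), u)). Qed.

Lemma measurable_split_energy : measurable_fun setT (fun p : T * T => split_energy p.1 p.2).
Proof.
have := measurable_fun_integral_setX leb mI01 msplit_integrand split_integrand_ge0.
by apply: eq_measurable_fun.
Qed.

(** The loss [1 / u] of [kern_integral_le] takes one of the two powers of [u] coming from the
    parametrisation of the rays and leaves the weight [u]; [512 = 4 * 128]. *)
Lemma integral_split_energy_le t : (\int[mu]_s split_energy t s <=
  (512 * h ^+ 2 * C1 / r)%:E * \int[leb]_(u in `[0%R, 1%R]) (u%:E * ray_energy t u))%E.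
Proof.
pose F (q : T * measurableTypeR R) : \bar R :=
  ((4 * h ^+ 2 * kern (dst t q.1) q.2 * q.2 ^+ 2)%:E * ray_energy t q.2)%E.
have mF : measurable_fun setT F.
  have mp : measurable_fun setT (fun q : T * measurableTypeR R => ((t, q.1), q.2)).
    apply: measurable_fun_pair; last exact: measurable_snd.
    by apply: measurable_fun_pair; [exact: measurable_cst|exact: measurable_fst].
  exact: (measurableT_comp msplit_integrand mp).
have F0 q : (0 <= F q)%E by exact: (split_integrand_ge0 ((t, q.1), q.2)).
have c0 : 0 <= 512 * h ^+ 2 * C1 / r.
  apply: divr_ge0 (ltW r0); apply: mulr_ge0 C1_ge0; apply: mulr_ge0 (sqr_ge0 _); exact: ler0n.
have mu1 : measurable_fun (`[0, 1]%classic : set (measurableTypeR R))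
    (fun u => (u%:E * ray_energy t u)%E).
  by apply: measurable_funTS; apply: emeasurable_funM; [exact/measurable_EFinP|exact: mRE].
have u_ge0 u : `[0, 1]%classic u -> (0 <= u%:E * ray_energy t u)%E.
  by rewrite /= in_itv/= => /andP[u0 _]; rewrite mule_ge0 ?ray_energy_ge0.
rewrite (tonelli_setX mu leb measurableT mI01 mF F0).
rewrite -ge0_integralZl//.
apply: ge0_integral_mono => u /=; rewrite in_itv/= => /andP[u0 _]; first exact: integral_ge0.
have [->|un0] := eqVneq u 0.
  rewrite mul0e mule0 integral0_eq// => s _.
  by rewrite /F/= expr0n/= mulr0 mul0e.
have {}u0 : 0 < u by rewrite lt_neqAle eq_sym un0.
have mk : measurable_fun setT (fun s => (kern (dst t s) u)%:E).
  apply/measurable_EFinP; apply: measurable_kern => //.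
  exact: (measurableT_comp mdst (measurable_pair1 t)).
have k0 s : (0 <= (kern (dst t s) u)%:E)%E by rewrite lee_fin kern_ge0.
have ck0 : 0 <= 4 * h ^+ 2 * u ^+ 2 by rewrite mulr_ge0 ?sqr_ge0// mulr_ge0// sqr_ge0.
have -> : (\int[mu]_s F (s, u) = ((4 * h ^+ 2 * u ^+ 2)%:E * ray_energy t u) *
    \int[mu]_s (kern (dst t s) u)%:E)%E.
  rewrite -ge0_integralZl//; last by rewrite mule_ge0 ?ray_energy_ge0.
  apply: eq_integral => s _; rewrite /F/= muleAC -EFinM.
  by congr (_%:E * _)%E; ring.
apply: (@le_trans _ _ (((4 * h ^+ 2 * u ^+ 2)%:E * ray_energy t u) * (128 * C1 / (r * u))%:E)%E).
  by apply: lee_wpmul2l; [rewrite mule_ge0 ?ray_energy_ge0|exact: kern_integral_le].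
rewrite muleAC -EFinM muleA -EFinM le_eqVlt; apply/orP; left; apply/eqP.
by congr (_%:E * _)%E; field; rewrite !gt_eqF.
Qed.


(** The density of [u * ray_energy t u] against [grad_sq phi]: the substitution [x = ray_pt t u y]
    has Jacobian [u^4], which turns the factor [u] into [u^-3]. *)
Definition cone_weight (t : T) (u : R) (x : plane) : R :=
  u^-1 ^+ 3 * \1_Q' (G t + u^-1 ^+ 2 *: (x - G t)).

Lemma cone_weight_ge0 t u x : 0 <= u -> 0 <= cone_weight t u x.
Proof. by move=> u0; rewrite mulr_ge0// exprn_ge0// invr_ge0. Qed.

Lemma measurable_cone_weight d' (X : measurableType d') (a : X -> T) (u : X -> R) (x : X -> plane) :
  measurable_fun setT a -> measurable_fun setT u -> measurable_fun setT (x : X -> P) ->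
  measurable_fun setT (fun w => cone_weight (a w) (u w) (x w)).
Proof.
move=> ma mu' mx; have mui := measurable_inv mu'.
apply: measurable_funM; first exact: measurable_funX.
have m1 : measurable_fun setT (\1_Q' : P -> R) by exact: measurable_indic.
have mGa : measurable_fun setT ((G \o a) : X -> P) by exact: measurableT_comp.
apply: (measurableT_comp m1); apply: measurable_plane_add => //.
apply: measurable_plane_scale; first exact: measurable_funX.
exact: measurable_plane_sub.
Qed.

Let cone_weightP t u x : 0 < u <= 1 -> cone_weight t u x != 0 ->
  exists2 y, Q' y & x = ray_pt t u y.
Proof.
move=> /andP[u0 _]; rewrite /cone_weight mulf_eq0 negb_or => /andP[_].
rewrite indicE; case: (boolP (_ \in _)) => [/set_mem Qy _|_]; last by rewrite eqxx.
exists (G t + u^-1 ^+ 2 *: (x - G t)) => //; rewrite /ray_pt.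
by apply: injective_projections; rewrite /= /GRing.scale/=; field; rewrite gt_eqF.
Qed.

Let Q'z y : Q' y -> edist y z <= r / 2.
Proof. by move=> Qy; have := sup_box_edist Qy; have := r0; lra. Qed.

Let u2P (u : R) : 0 < u <= 1 -> 0 < u ^+ 2 <= 1.
Proof. by move=> /andP[u0 u1]; rewrite exprn_gt0// exprn_ile1// ltW. Qed.

Lemma ray_energy_plane t u : 0 <= u <= 1 ->
  (u%:E * ray_energy t u = \int[leb2]_(x in K) (cone_weight t u x * Gd x)%:E)%E.
Proof.
move=> /andP[]; rewrite le_eqVlt => /predU1P[<- _|u0 u1].
  by rewrite mul0e integral0_eq// => x _; rewrite /cone_weight invr0 expr0n/= !mul0r.
have u01 : 0 < u <= 1 by rewrite u0.
pose f (x : P) := (cone_weight t u x * Gd x)%:E.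
have f0 x : (0 <= f x)%E by rewrite lee_fin mulr_ge0 ?grad_sq_ge0 ?cone_weight_ge0 ?(ltW u0).
have mf : measurable_fun setT f.
  apply/measurable_EFinP; apply: measurable_funM; last exact: measurable_grad_sq.
  exact: (measurable_cone_weight (a := cst t) (u := cst u)).
transitivity (\int[leb2]_x f x)%E; last first.
  rewrite [RHS]integral_mkcond; apply: eq_integral => x _; rewrite patchE.
  case: ifPn => // /negP nKx; rewrite /f.
  have [->|/(cone_weightP u01)[y Qy xE]] := eqVneq (cone_weight t u x) 0; first by rewrite mul0r.
  exfalso; apply: nKx; apply/mem_set; rewrite xE /ray_pt; apply: (cone_sub star) => //; last exact: u2P.
  by have := Q'z Qy; have := r0; lra.
rewrite (ge0_integral_plane_affine (G t - u ^+ 2 *: G t) (exprn_gt0 2 u0) mf f0).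
have fE y : f (G t - u ^+ 2 *: G t + u ^+ 2 *: y) =
    ((u^-1 ^+ 3)%:E * ((fun y => (Gd (ray_pt t u y))%:E) \_ Q') y)%E.
  have -> : G t - u ^+ 2 *: G t + u ^+ 2 *: y = ray_pt t u y.
    by rewrite /ray_pt scalerBr addrA addrAC.
  rewrite /f /cone_weight patchE.
  have -> : G t + u^-1 ^+ 2 *: (ray_pt t u y - G t) = y.
    by rewrite /ray_pt; apply: injective_projections; rewrite /= /GRing.scale/=; field; rewrite gt_eqF.
  rewrite indicE; case: ifPn => _; first by rewrite mulr1 EFinM.
  by rewrite mulr0 mul0r mule0.
under eq_integral do rewrite fE.
have mG' : measurable_fun Q' (fun y => (Gd (ray_pt t u y))%:E).
  apply/measurable_EFinP; apply: measurable_funTS; apply: (measurableT_comp (measurable_grad_sq sphi)).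
  exact: (measurable_ray_pt (a := cst t) (u := cst u)).
rewrite ge0_integralZl//.
- rewrite -integral_mkcond -/(ray_energy t u) muleA -EFinM.
  by congr (_%:E * _)%E; field; rewrite gt_eqF.
- exact/(measurable_restrictT _ mQ').
- by move=> y _; rewrite patchE; case: ifP => // _; rewrite lee_fin grad_sq_ge0.
- by rewrite lee_fin exprn_ge0// invr_ge0 ltW.
Qed.

Let Cw := 48 * C1 * h ^+ 6 / r ^+ 5.

(** If [x] is reached from [t] at parameter [u], then [x] is at distance at most [u^2 h] from [G t]
    and at least [u^2 r / 2] from every boundary point. So all parameters reaching [x] are
    comparable to a reference value [u1], and the starting points lie in a disc of radius of order
    [u1^2]. The product [u1^-3 * u1 * u1^2] does not depend on [x]. *)
Lemma cone_weight_integral_le x :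
  (\int[mu]_t \int[leb]_(u in `[0%R, 1%R]) (cone_weight t u x)%:E <= Cw%:E)%E.
Proof.
have Cw0 : 0 <= Cw.
  apply: divr_ge0 (exprn_ge0 _ (ltW r0)); apply: mulr_ge0 (exprn_ge0 _ (ltW h0)).
  by apply: mulr_ge0 C1_ge0; exact: ler0n.
have cw_u0 t : cone_weight t 0 x = 0 by rewrite /cone_weight invr0 expr0n/= mul0r.
have u01P t u : `[0, 1]%classic u -> cone_weight t u x != 0 -> 0 < u <= 1.
  rewrite /= in_itv/= => /andP[u0 ->] cw; rewrite andbT lt_neqAle u0 andbT.
  by apply: contraNneq cw => <-; rewrite cw_u0.
have [[t1 [u1 [Iu1 cw1]]]|none] := pselect (exists t u, `[0, 1]%classic u /\ cone_weight t u x != 0); last first.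
  rewrite integral0_eq// => t _; rewrite integral0_eq// => u Iu.
  by congr EFin; apply/eqP; apply/negP => /negP cw; apply: none; exists t, u.
have u101 := u01P _ _ Iu1 cw1; have /andP[u10 _] := u101.
have far t u : 0 < u <= 1 -> cone_weight t u x != 0 ->
    edist x (G t) <= u ^+ 2 * h /\ forall t', u ^+ 2 * (r / 2) <= edist x (G t').
  move=> u01 /(cone_weightP u01)[y Qy ->]; split; last first.
    by move=> t'; apply: (cone_dist star) => //; [exact: Q'z|exact: u2P].
  rewrite edistE /ray_pt addrC addKr enormZ ?sqr_ge0// ler_wpM2l ?sqr_ge0//.
  exact: Q'h.
(* The squares of two parameters have ratio at most [q]; as [q >= 1], the parameters themselves have
   ratio at most [q], without a root in the constant. *)
pose q := 2 * h / r.
have q1 : 1 <= q by rewrite /q ler_pdivlMr// mul1r.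
have q0 : 0 < q by exact: lt_le_trans q1.
have cmp t u t' u' : 0 < u <= 1 -> 0 < u' <= 1 -> cone_weight t u x != 0 ->
    cone_weight t' u' x != 0 -> u <= q * u'.
  move=> u01 u01' cw cw'; have /andP[u0 _] := u01; have /andP[u0' _] := u01'.
  have [_ /(_ t') H] := far _ _ u01 cw; have [H' _] := far _ _ u01' cw'.
  apply: ler_of_sqr; first by rewrite mulr_ge0 ?(ltW q0) ?(ltW u0').
  have : u ^+ 2 * (r / 2) <= u' ^+ 2 * h by exact: le_trans H H'.
  move=> H2; have : u ^+ 2 <= q * u' ^+ 2.
    have -> : q * u' ^+ 2 = u' ^+ 2 * h * (2 / r) by rewrite /q; ring.
    by rewrite mulrA ler_pdivlMr//; move: H2; lra.
  move=> H3; apply: le_trans H3 _; rewrite exprMn ler_wpM2r ?sqr_ge0//.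
  by rewrite expr2 ler_peMl// ltW.
(* The estimates give the radius [2 * h ^+ 2 * u1 ^+ 2 / r]; the 3 makes the inequality strict, as
   [reg] is about open discs. *)
pose A := [set t | edist x (G t) < 3 * h ^+ 2 * u1 ^+ 2 / r].
have mA : measurable A.
  have md : measurable_fun setT (fun t => edist x (G t)) by exact: measurable_edist.
  rewrite (_ : A = setT `&` (fun t => edist x (G t)) @^-1` `]-oo, 3 * h ^+ 2 * u1 ^+ 2 / r[%classic).
    by apply: md => //; exact: measurable_itv.
  by apply/seteqP; split => [t Ht|t []] /=; rewrite in_itv.
have bound t u : `[0, 1]%classic u ->
    cone_weight t u x <= (q / u1) ^+ 3 * \1_A t * \1_(`[0, q * u1]%classic) u.
  move=> Iu; have [->|cw] := eqVneq (cone_weight t u x) 0.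
    by rewrite mulr_ge0// mulr_ge0// exprn_ge0// divr_ge0// ltW.
  have u01 := u01P _ _ Iu cw; have /andP[u0 _] := u01.
  have c1 := cmp _ _ _ _ u01 u101 cw cw1; have c2 := cmp _ _ _ _ u101 u01 cw1 cw.
  rewrite [\1_A t]indicE mem_set; last first.
    rewrite /A/=; have [H _] := far _ _ u01 cw; apply: le_lt_trans H _.
    have [_ /(_ t) H1] := far _ _ u01 cw; have [_ /(_ t1) H2] := far _ _ u01 cw.
    have [H3 _] := far _ _ u101 cw1.
    have H4 := le_trans H2 H3; rewrite ltr_pdivlMr//.
    have : u ^+ 2 * r <= 2 * (u1 ^+ 2 * h) by lra.
    have := exprn_gt0 2 u10; have := exprn_gt0 2 h0; have := h0.
    move=> hp h2p u2p H5.
    apply: (@le_lt_trans _ _ (2 * (u1 ^+ 2 * h) * h)).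
      by rewrite mulrAC ler_wpM2r// ltW.
    by rewrite (_ : 2 * (u1 ^+ 2 * h) * h = 2 * (h ^+ 2 * u1 ^+ 2)); [rewrite -mulrA ltr_pM2r ?mulr_gt0//; lra|ring].
  rewrite indicE mem_set; last by rewrite /= in_itv/= ltW.
  rewrite !mulr1 /cone_weight; apply: (@le_trans _ _ (u^-1 ^+ 3)).
    by rewrite ler_piMr ?exprn_ge0 ?invr_ge0 ?(ltW u0)// indicE; case: (_ \in _).
  have qu1 : 0 <= q / u1 by exact: divr_ge0 (ltW q0) (ltW u10).
  rewrite lerXn2r ?nnegrE ?invr_ge0 ?(ltW u0)//.
  by rewrite ler_pdivlMr// mulrC ler_pdivrMr.
have qu0 : 0 <= (q / u1) ^+ 3 by rewrite exprn_ge0// divr_ge0// ltW.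
apply: (@le_trans _ _ (\int[mu]_t (((q / u1) ^+ 3 * (q * u1))%:E * (\1_A t)%:E))%E).
  apply: ge0_integral_mono => t _.
    apply: integral_ge0 => u; rewrite /= in_itv/= => /andP[u0 _]; by rewrite lee_fin cone_weight_ge0.
  apply: (@le_trans _ _ (\int[leb]_(u in `[0%R, 1%R]) (((q / u1) ^+ 3 * \1_A t)%:E * (\1_(`[0%R, (q * u1)%R]%classic) u)%:E))%E).
    apply: ge0_integral_mono => u Iu; last by rewrite -EFinM lee_fin; exact: bound.
    by move: Iu; rewrite /= in_itv/= => /andP[u0 _]; rewrite lee_fin cone_weight_ge0.
  have mI2 : measurable (`[0, q * u1]%classic : set (measurableTypeR R)) by exact: measurable_itv.
  rewrite ge0_integralZl//; first last.
  - by rewrite lee_fin mulr_ge0.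
  - apply/measurable_EFinP; apply: measurable_funTS; exact: measurable_indic.
  rewrite integral_indic//.
  apply: (@le_trans _ _ (((q / u1) ^+ 3 * \1_A t)%:E * (q * u1)%:E)%E).
    apply: lee_wpmul2l; first by rewrite lee_fin mulr_ge0.
    apply: (@le_trans _ _ (leb `[0, q * u1]%classic)).
      by apply: le_measure; rewrite ?inE//; exact: measurableI.
    rewrite lebesgue_measure_itv/= lte_fin mulr_gt0// -EFinD subr0; exact: lexx.
  by rewrite -!EFinM lee_fin; rewrite le_eqVlt; apply/orP; left; apply/eqP; ring.
rewrite ge0_integralZl//; first last.
- by rewrite lee_fin mulr_ge0// mulr_ge0 ?ltW.
- by apply/measurable_EFinP; exact: measurable_indic.
rewrite integral_indic// setIT.
apply: (@le_trans _ _ (((q / u1) ^+ 3 * (q * u1))%:E * (C1 * (3 * h ^+ 2 * u1 ^+ 2 / r))%:E)%E).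
  apply: lee_wpmul2l; first by rewrite lee_fin mulr_ge0// mulr_ge0 ?ltW.
  by apply: reg; rewrite divr_gt0// mulr_gt0 ?exprn_gt0// mulr_gt0 ?exprn_gt0.
rewrite -EFinM lee_fin /Cw /q; rewrite le_eqVlt; apply/orP; left; apply/eqP; field.
by rewrite !gt_eqF.
Qed.

Lemma ray_energy_integral_le :
  (\int[mu]_t \int[leb]_(u in `[0%R, 1%R]) (u%:E * ray_energy t u) <=
   Cw%:E * \int[leb2]_(x in K) (Gd x)%:E)%E.
Proof.
have mK : measurable (K : set P) by exact: open_plane_measurable.
(* [tonelli_setX] wants an integrand nonnegative everywhere, including at negative [u]; on [[0, 1]]
   the absolute value changes nothing. *)
pose F (q : (T * measurableTypeR R) * P) : \bar R := (`|cone_weight q.1.1 q.1.2 q.2| * Gd q.2)%:E.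
have mF : measurable_fun setT F.
  apply/measurable_EFinP.
  have mq2 : measurable_fun setT (fun q : (T * measurableTypeR R) * P => q.1.2).
    exact: measurableT_comp measurable_snd measurable_fst.
  have mq1 : measurable_fun setT (fun q : (T * measurableTypeR R) * P => q.1.1).
    exact: measurableT_comp measurable_fst measurable_fst.
  have mq3 : measurable_fun setT ((fun q : (T * measurableTypeR R) * P => q.2) : _ -> P).
    exact: measurable_snd.
  apply: measurable_funM; first by apply: measurableT_comp => //; exact: measurable_cone_weight.
  exact: (measurableT_comp (measurable_grad_sq sphi) mq3).
have F0 q : (0 <= F q)%E by rewrite lee_fin mulr_ge0 ?grad_sq_ge0.
have FE t u x : 0 <= u -> F ((t, u), x) = (cone_weight t u x * Gd x)%:E.
  by move=> u0; rewrite /F/= ger0_norm// cone_weight_ge0.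
have mFux t : measurable_fun setT (fun q : measurableTypeR R * P => F ((t, q.1), q.2)).
  have mp : measurable_fun setT (fun q : measurableTypeR R * P => ((t, q.1), q.2)).
    apply: measurable_fun_pair; last exact: measurable_snd.
    by apply: measurable_fun_pair; [exact: measurable_cst|exact: measurable_fst].
  exact: (measurableT_comp mF mp).
have mFtux : measurable_fun setT (fun q : (T * P) * measurableTypeR R => F ((q.1.1, q.2), q.1.2)).
  have mp : measurable_fun setT (fun q : (T * P) * measurableTypeR R => ((q.1.1, q.2), q.1.2)).
    apply: measurable_fun_pair; last exact: measurableT_comp measurable_snd measurable_fst.
    by apply: measurable_fun_pair; [exact: measurableT_comp measurable_fst measurable_fst|exact: measurable_snd].
  exact: (measurableT_comp mF mp).
have mH := measurable_fun_integral_setX leb mI01 mFtux (fun q => F0 _).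
have H0 (p : T * P) : (0 <= \int[leb]_(u in `[0%R, 1%R]) F ((p.1, u), p.2))%E by exact: integral_ge0.
have -> : (\int[mu]_t \int[leb]_(u in `[0%R, 1%R]) (u%:E * ray_energy t u) =
    \int[mu]_t \int[leb2]_(x in K) \int[leb]_(u in `[0%R, 1%R]) F ((t, u), x))%E.
  apply: eq_integral => t _.
  rewrite -(tonelli_setX leb plane_lebesgue mI01 mK (mFux t) (fun q => F0 _)).
  apply: eq_integral => u /set_mem /=; rewrite in_itv/= => u01; rewrite ray_energy_plane//.
  by apply: eq_integral => x _; rewrite FE//; case/andP: u01.
have -> := tonelli_setX mu plane_lebesgue measurableT mK mH H0.
have mGK : measurable_fun (K : set P) (fun x => (Gd x)%:E).
  by apply/measurable_EFinP; apply: measurable_funTS; exact: measurable_grad_sq.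
have Cw0 : 0 <= Cw.
  apply: divr_ge0 (exprn_ge0 _ (ltW r0)); apply: mulr_ge0 (exprn_ge0 _ (ltW h0)).
  by apply: mulr_ge0 C1_ge0; exact: ler0n.
rewrite -ge0_integralZl//; last by move=> x _; rewrite lee_fin grad_sq_ge0.
apply: ge0_integral_mono => x _; first by apply: integral_ge0 => t _; exact: H0.
have -> : (\int[mu]_t \int[leb]_(u in `[0%R, 1%R]) F ((t, u), x) =
    (Gd x)%:E * \int[mu]_t \int[leb]_(u in `[0%R, 1%R]) (cone_weight t u x)%:E)%E.
  pose W (q : T * measurableTypeR R) := (`|cone_weight q.1 q.2 x|)%:E.
  have mW : measurable_fun setT W.
    apply/measurable_EFinP; apply: measurableT_comp => //.
    by apply: (measurable_cone_weight (x := cst x)).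
  have W0 q : (0 <= W q)%E by rewrite lee_fin.
  have WE t : (\int[leb]_(u in `[0%R, 1%R]) W (t, u) = \int[leb]_(u in `[0%R, 1%R]) (cone_weight t u x)%:E)%E.
    apply: eq_integral => u /set_mem /=; rewrite in_itv/= => /andP[u0 _].
    by rewrite /W/= ger0_norm// cone_weight_ge0.
  under [in RHS]eq_integral do rewrite -WE.
  rewrite -ge0_integralZl//; first last.
  - by rewrite lee_fin grad_sq_ge0.
  - by move=> t _; exact: integral_ge0.
  - exact: (measurable_fun_integral_setX leb mI01 mW W0).
  apply: eq_integral => t _; rewrite -ge0_integralZl//; first last.
  - by rewrite lee_fin grad_sq_ge0.
  - by apply: measurable_funTS; exact: (measurableT_comp mW (measurable_pair1 t)).
  apply: eq_integral => u /set_mem /=; rewrite in_itv/= => /andP[u0 _].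
  by rewrite FE// /W/= ger0_norm ?cone_weight_ge0// -EFinM mulrC.
rewrite muleC; apply: lee_wpmul2r; first by rewrite lee_fin grad_sq_ge0.
exact: cone_weight_integral_le.
Qed.

(** Summing [pair_quotient_le] over all pairs, symmetrising and inserting the weight bound gives the
    constant. Its [2 ^+ 6 / r ^+ 2] is the factor 4 of the symmetrisation over the box area
    [r ^+ 2 / 16]. *)
Lemma gagliardo_le_grad :
  (\int[mu]_t \int[mu]_s ((phi (G t) - phi (G s)) ^+ 2 / edist (G t) (G s) ^+ 2)%:E <=
   (2 ^+ 6 * (512 * h ^+ 2 * C1 / r) * (48 * C1 * h ^+ 6 / r ^+ 5) / r ^+ 2)%:E * \int[leb2]_(x in K) (grad_sq phi x)%:E)%E.
Proof.
set I := (\int[leb2]_(x in K) _)%E.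
have c0 : 0 <= 512 * h ^+ 2 * C1 / r.
  apply: divr_ge0 (ltW r0); apply: mulr_ge0 C1_ge0; apply: mulr_ge0 (sqr_ge0 _); exact: ler0n.
have mB := measurable_split_energy.
have B0 := split_energy_ge0.
pose B := (\int[mu]_t \int[mu]_s split_energy t s)%E.
have Bint : (\int[mu]_t \int[mu]_s (2%:E * split_energy t s + 2%:E * split_energy s t) = 4%:E * B)%E.
  exact: (integral_symmetrize mu mB B0).
have Ble : (B <= (512 * h ^+ 2 * C1 / r * Cw)%:E * I)%E.
  apply: (@le_trans _ _ (\int[mu]_t ((512 * h ^+ 2 * C1 / r)%:E * \int[leb]_(u in `[0%R, 1%R]) (u%:E * ray_energy t u)))%E).
    by apply: ge0_integral_mono => t _; [exact: integral_ge0|exact: integral_split_energy_le].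
  have u_ge0 t u : `[0, 1]%classic u -> (0 <= u%:E * ray_energy t u)%E.
    by rewrite /= in_itv/= => /andP[u0 _]; rewrite mule_ge0 ?ray_energy_ge0.
  rewrite ge0_integralZl//; first last.
  - by move=> t _; apply: integral_ge0; exact: u_ge0.
  - pose F (q : T * measurableTypeR R) := (`|q.2|%:E * ray_energy q.1 q.2)%E.
    have mF : measurable_fun setT F.
      apply: emeasurable_funM; last exact: measurable_ray_energy.
      by apply/measurable_EFinP; apply: measurableT_comp => //; exact: measurable_snd.
    have F0 q : (0 <= F q)%E by rewrite mule_ge0 ?ray_energy_ge0.
    have := measurable_fun_integral_setX leb mI01 mF F0; apply: eq_measurable_fun => t _.
    apply: eq_integral => u /set_mem /=; rewrite in_itv/= => /andP[u0 _].
    by rewrite /F/= ger0_norm.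
  rewrite (EFinM _ Cw) -[leRHS]muleA; apply: lee_wpmul2l; first by rewrite lee_fin.
  exact: ray_energy_integral_le.
have r16 : 0 < r ^+ 2 / 16 by rewrite divr_gt0// exprn_gt0.
set S := (\int[mu]_t \int[mu]_s _)%E.
have mq : measurable_fun setT (fun p : T * T =>
    ((phi (G p.1) - phi (G p.2)) ^+ 2 / edist (G p.1) (G p.2) ^+ 2)%:E).
  have mphi : measurable_fun setT (phi : P -> R) by exact: smooth_measurable.
  have mphiG := measurableT_comp mphi mG.
  apply/measurable_EFinP; apply: measurable_funM.
    apply: measurable_funX; apply: measurable_funB.
      exact: (measurableT_comp mphiG measurable_fst).
    exact: (measurableT_comp mphiG measurable_snd).
  by apply: measurable_inv; exact: measurable_funX.
have q_ge0 (p : T * T) : (0 <= ((phi (G p.1) - phi (G p.2)) ^+ 2 / edist (G p.1) (G p.2) ^+ 2)%:E)%E.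
  by rewrite lee_fin divr_ge0 ?sqr_ge0.
have S_le : ((r ^+ 2 / 16)%:E * S <= 4%:E * B)%E.
  rewrite -Bint /S -ge0_integralZl//; first last.
  - by rewrite lee_fin ltW.
  - by move=> t _; apply: integral_ge0 => s _; exact: (q_ge0 (t, s)).
  - exact: (measurable_fun_integral_setX mu measurableT mq q_ge0).
  apply: ge0_integral_mono => t _.
    rewrite mule_ge0 ?lee_fin ?(ltW r16)//; apply: integral_ge0 => s _; exact: (q_ge0 (t, s)).
  rewrite -ge0_integralZl//; first last.
  - by rewrite lee_fin ltW.
  - by move=> s _; exact: (q_ge0 (t, s)).
  - exact: (measurableT_comp mq (measurable_pair1 t)).
  apply: ge0_integral_mono => s _; last by rewrite -EFinM; exact: pair_quotient_le.
  by rewrite mule_ge0 ?lee_fin ?(ltW r16)//; exact: (q_ge0 (t, s)).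
have -> : S = ((r ^+ 2 / 16)^-1%:E * ((r ^+ 2 / 16)%:E * S))%E.
  by rewrite muleA -EFinM mulVf ?gt_eqF// mul1e.
apply: (@le_trans _ _ ((r ^+ 2 / 16)^-1%:E * (4%:E * ((512 * h ^+ 2 * C1 / r * Cw)%:E * I)))%E).
  apply: lee_wpmul2l; first by rewrite lee_fin invr_ge0 ltW.
  by apply: le_trans S_le _; apply: lee_wpmul2l.
rewrite !muleA -!EFinM le_eqVlt; apply/orP; left; apply/eqP; congr (_%:E * _)%E.
by rewrite /Cw; field; rewrite gt_eqF.
Qed.

End TraceInequality.

(** * The kernel mean of a boundary function *)

Section InverseFourthPower.
Context {R : realType}.
Local Notation plane := (R * R)%type.
Local Notation edist := Defs.edist.
Implicit Types (x y : plane) (b : bool).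

(** The kernel [|y|^-4], written without the root so that smoothness off the origin is a matter of
    products and inverses. *)
Definition pw4 (y : plane) : R := (y.1 ^+ 2 + y.2 ^+ 2)^-1 ^+ 2.

Lemma enorm_gt0 y : y != 0 -> 0 < enorm y.
Proof.
move=> y0; rewrite lt_neqAle enorm_ge0 andbT; apply: contraNneq y0 => E; apply/eqP.
by apply: edist_eq0; rewrite edistE subr0.
Qed.

Lemma pw4E y : pw4 y = (enorm y)^-1 ^+ 4.
Proof. by rewrite /pw4 -sqr_enorm -exprVn -exprM. Qed.

Let sq_norm_neq0 y : (~` [set 0]) y -> y.1 ^+ 2 + y.2 ^+ 2 != 0.
Proof. by move=> /eqP y0; rewrite -sqr_enorm expf_neq0// gt_eqF// enorm_gt0. Qed.

Lemma smooth_on_pw4 : smooth_on (~` [set 0]) pw4.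
Proof.
move=> n; have o0 := @open_setC0 R.
have s1 := @smooth_on_fst R (~` [set 0]) n; have s2 := @smooth_on_snd R (~` [set 0]) n.
have sN : smooth_upto n (~` [set 0]) (fun y : plane => y.1 * y.1 + y.2 * y.2).
  by apply: smooth_upto_add => //; apply: smooth_upto_mul.
have sI : smooth_upto n (~` [set 0]) (fun y : plane => (y.1 * y.1 + y.2 * y.2)^-1).
  by apply: smooth_upto_inv => // y y0; rewrite -!expr2; exact: sq_norm_neq0.
by apply: eq_smooth_upto (smooth_upto_mul o0 sI sI) => // y _; rewrite /pw4 !expr2.
Qed.

Lemma is_derive_pw4 (c x : R) : x ^+ 2 + c != 0 ->
  is_derive x (1 : R) (fun x : R => (x ^+ 2 + c)^-1 ^+ 2) (- 4 * x * (x ^+ 2 + c)^-1 ^+ 3).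
Proof.
move=> xc0.
have d1 : is_derive x (1 : R) (fun x : R => x ^+ 2 + c) (2 * x).
  rewrite (_ : (fun x : R => x ^+ 2 + c) = (@id R ^+ 2) + cst c); last by apply/funext.
  by apply: is_derive_eq; rewrite /GRing.scale/= addr0 expr1 mulr1; ring.
have d2 : is_derive x (1 : R) (fun x : R => (x ^+ 2 + c)^-1) (- (x ^+ 2 + c) ^- 2 *: (2 * x)).
  exact: is_deriveV.
rewrite (_ : (fun x : R => (x ^+ 2 + c)^-1 ^+ 2) = (fun x : R => (x ^+ 2 + c)^-1) ^+ 2); last by apply/funext.
by apply: is_derive_eq; rewrite /GRing.scale/= expr1; field.
Qed.

Lemma partial_pw4 b y : y != 0 -> partial b pw4 y =
  - 4 * (if b then y.2 else y.1) * (y.1 ^+ 2 + y.2 ^+ 2)^-1 ^+ 3.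
Proof.
move=> /eqP y0; have dp : differentiable pw4 y by exact: (smooth_on_differentiable smooth_on_pw4).
have N0 := sq_norm_neq0 y0; rewrite (surjective_pairing y) in dp.
case: b.
  have H := @is_derive_path R pw4 (fun t => (y.1, t)) 0 1 y.2 dp (is_derive_cst _ _ _) (is_derive_id _ _).
  have D : is_derive y.2 (1 : R) (pw4 \o (fun t => (y.1, t))) (- 4 * y.2 * (y.1 ^+ 2 + y.2 ^+ 2)^-1 ^+ 3).
    rewrite addrC in N0 *; have := is_derive_pw4 N0.
    by rewrite (_ : (fun _ => _) = pw4 \o (fun t => (y.1, t)))//; apply/funext => t; rewrite /pw4/= addrC.
  have := @derive_val _ _ _ _ _ _ _ D; rewrite (@derive_val _ _ _ _ _ _ _ H).
  by rewrite mul0r add0r mul1r -surjective_pairing.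
have H := @is_derive_path R pw4 (fun t => (t, y.2)) 1 0 y.1 dp (is_derive_id _ _) (is_derive_cst _ _ _).
have D : is_derive y.1 (1 : R) (pw4 \o (fun t => (t, y.2))) (- 4 * y.1 * (y.1 ^+ 2 + y.2 ^+ 2)^-1 ^+ 3).
  exact: (is_derive_pw4 N0).
have := @derive_val _ _ _ _ _ _ _ D; rewrite (@derive_val _ _ _ _ _ _ _ H).
by rewrite mul0r addr0 mul1r -surjective_pairing.
Qed.

Lemma partial_pw4_le b y : y != 0 -> `|partial b pw4 y| <= 4 * (enorm y)^-1 ^+ 5.
Proof.
move=> y0; rewrite partial_pw4// -sqr_enorm -exprVn -exprM.
have n0 := enorm_gt0 y0.
have yb : `|if b then y.2 else y.1| <= enorm y.
  apply: le_trans (enorm_ge_norm _); case: b; [exact: plane_norm2|exact: plane_norm1].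
have nn : 0 <= (enorm y)^-1 ^+ (2 * 3) by rewrite exprn_ge0// invr_ge0 ltW.
rewrite (normrM (- 4 * _)) (normrM (- 4)) normrN (ger0_norm nn) normr_nat -mulrA ler_wpM2l//.
rewrite (exprS _ 5) mulrA ler_piMl ?exprn_ge0 ?invr_ge0 ?(ltW n0)//.
by rewrite ler_pdivrMr// mul1r.
Qed.

Lemma smooth_lipschitz (f : plane -> R) (B : R) : smooth f ->
  exists2 L, 0 <= L & forall x y, `|x| <= B -> `|y| <= B -> `|f x - f y| <= L * edist x y.
Proof.
move=> sf.
have cB : compact (`[(- B), B] `*` `[(- B), B] : set plane) by exact: closed_box_compact.
have inB x : `|x| <= B -> (`[(- B), B] `*` `[(- B), B]) x.
  by rewrite plane_norm_le !ler_norml /= !in_itv/= => /andP[-> ->].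
have bd b : exists C, forall x, `|x| <= B -> `|partial b f x| <= C.
  have [C HC] := continuous_compact_bound cB (fun x _ => @smooth_continuous R _ (smooth_partial b sf) x).
  by exists C => x /inB; exact: HC.
have [C0 HC0] := bd false; have [C1 HC1] := bd true.
exists (2 * (`|C0| + `|C1|)) => [|x y xB yB]; first by rewrite mulr_ge0// addr_ge0.
apply: (@le_trans _ _ (2 * (`|C0| + `|C1|) * `|x - y|)); last first.
  by rewrite ler_wpM2l ?mulr_ge0 ?addr_ge0// edistE enorm_ge_norm.
have -> : f x = f (y + (x - y)) by rewrite addrC subrK.
apply: mean_value_le => [s _|s b s01]; first exact: (sf [::]).
have segB : `|y + s *: (x - y)| <= B.
  have -> : y + s *: (x - y) = (1 - s) *: y + s *: x by rewrite scalerBr scalerBl scale1r; rewrite -addrA; congr (_ + _); rewrite addrC.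
  have /andP[s0 s1] := s01.
  apply: le_trans (ler_normD _ _) _; rewrite !normrZ !ger0_norm ?subr_ge0//.
  have -> : B = (1 - s) * B + s * B by ring.
  by apply: lerD; apply: ler_wpM2l; rewrite ?subr_ge0.
case: b; [apply: le_trans (HC1 _ segB) _|apply: le_trans (HC0 _ segB) _].
  by apply: le_trans (ler_norm _) _; rewrite lerDr.
by apply: le_trans (ler_norm _) _; rewrite lerDl.
Qed.

End InverseFourthPower.

Section BoundedIntegrable.
Context d (T : measurableType d) (R : realType) (mu : {finite_measure set T -> \bar R}).

Lemma bounded_integrable (f : T -> R) (C : R) : measurable_fun setT f ->
  (forall t, `|f t| <= C) -> mu.-integrable setT (EFin \o f).
Proof.
move=> mf fC; apply: (@le_integrable _ _ _ mu setT measurableT _ (cst C%:E)) => //.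
- exact/measurable_EFinP.
- by move=> t _ /=; rewrite lee_fin (le_trans (fC t))// ler_norm.
- by apply: finite_measure_integrable_cst.
Qed.

Lemma Rintegral_ge0E (f : T -> R) (C : R) : measurable_fun setT f ->
  (forall t, `|f t| <= C) -> (\int[mu]_t (f t)%:E)%E = (\int[mu]_t f t)%:E.
Proof. by move=> mf fC; rewrite fineK//; apply: integrable_fin_num => //; exact: bounded_integrable fC. Qed.

Lemma bounded_cauchy_schwarz (f g : T -> R) (Cf Cg : R) : measurable_fun setT f -> measurable_fun setT g ->
  (forall t, `|f t| <= Cf) -> (forall t, `|g t| <= Cg) ->
  (\int[mu]_t (f t * g t)) ^+ 2 <= (\int[mu]_t (f t ^+ 2)) * (\int[mu]_t (g t ^+ 2)).
Proof.
move=> mf mg fC gC.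
have sq (u : T -> R) C : measurable_fun setT u -> (forall t, `|u t| <= C) ->
    mu.-integrable setT (fun t => (u t ^+ 2)%:E).
  move=> mu' uC; apply: (@bounded_integrable _ (C ^+ 2)); first exact: measurable_funX.
  move=> t; rewrite normrX lerXn2r ?nnegrE//; exact: le_trans (normr_ge0 _) (uC t).
by apply: Rintegral_cauchy_schwarz => //; [exact: sq fC|exact: sq gC].
Qed.

End BoundedIntegrable.

Section KernelAverage.
Context {R : realType}.
Local Notation plane := (R * R)%type.
Local Notation P := (measurableTypeR R * measurableTypeR R)%type.
Local Notation leb2 := (@lebesgue_measure R \x @lebesgue_measure R)%E.
Local Notation edist := Defs.edist.
Context d (T : measurableType d) (mu : {finite_measure set T -> \bar R}).
Variables (G : T -> plane) (mG : measurable_fun setT (G : T -> P)) (pt : T).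
Variables (K : set plane) (h c1 C1 B : R).
Hypotheses (oK : open K) (diamK : forall x y, K x -> K y -> edist x y <= h).
Hypotheses (clG : forall t, closure K (G t)) (nKG : forall t, ~ K (G t)).
Hypotheses (GB : forall t, `|G t| <= B) (KB : forall x, K x -> `|x| <= B).
Hypothesis C1_ge0 : 0 <= C1.
Hypothesis reg : forall x s, 0 < s -> (mu [set t | (edist x (G t) < s)%R] <= (C1 * s)%:E)%E.
Hypothesis c1_gt0 : 0 < c1.
Hypothesis reg_lo : forall t0 s, 0 < s <= h ->
  ((c1 * s)%:E <= mu [set t | (edist (G t0) (G t) < s)%R])%E.
Variables (phi : plane -> R) (sphi : smooth phi).

Lemma sup_separated x : K x -> exists2 e, 0 < e & forall t, e <= `|x - G t|.
Proof.
move=> Kx; have /nbhs_ballP[e e0 He] : nbhs x K by exact: open_nbhs_nbhs (conj oK Kx).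
exists e => // t; rewrite leNgt; apply/negP => H; apply: (nKG (t := t)); apply: He.
rewrite -ball_normE /=; exact: H.
Qed.

Definition rho (x : plane) (t : T) : R := (edist x (G t))^-1.

Lemma rho_ge0 x t : 0 <= rho x t. Proof. by rewrite invr_ge0 edist_ge0. Qed.

Lemma measurable_rho x : measurable_fun setT (rho x).
Proof. by apply: measurable_inv; exact: measurable_edist. Qed.

Lemma edist_sep x : K x -> exists2 e, 0 < e & forall t, e <= edist x (G t).
Proof.
move=> /sup_separated[e e0 He]; exists e => // t.
by rewrite edistE; apply: le_trans (He t) (enorm_ge_norm _).
Qed.

Lemma edist_gt0 x t : K x -> 0 < edist x (G t).
Proof. by move=> /edist_sep[e e0 /(_ t)]; exact: lt_le_trans. Qed.

Lemma rho_bounded x : K x -> exists2 M, 0 < M & forall t, rho x t <= M.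
Proof.
move=> /edist_sep[e e0 He]; exists e^-1; rewrite ?invr_gt0// => t.
by rewrite lef_pV2 ?He// posrE// (lt_le_trans e0 (He t)).
Qed.

Lemma rho_mul_bounded x n (f : T -> R) (C : R) : K x -> (forall t, `|f t| <= C) ->
  exists C', forall t, `|rho x t ^+ n * f t| <= C'.
Proof.
move=> /rho_bounded[M M0 HM] fC; exists (M ^+ n * C) => t.
rewrite normrM normrX (ger0_norm (rho_ge0 x t)) ler_pM ?exprn_ge0 ?rho_ge0//.
by rewrite lerXn2r ?nnegrE ?rho_ge0 ?(ltW M0).
Qed.

(** The factor [1] gives the integrand the shape [h t * p (x - G t)] of the parametric integrals. *)
Definition kmass (x : plane) : R := \int[mu]_t (1 * pw4 (x - G t)).
Definition kmean_num (x : plane) : R := \int[mu]_t (phi (G t) * pw4 (x - G t)).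
Definition kmean (x : plane) : R := kmean_num x / kmass x.

Lemma pw4_rho x t : pw4 (x - G t) = rho x t ^+ 4.
Proof. by rewrite pw4E /rho edistE. Qed.

Lemma phiG_bounded : exists C, forall t, `|phi (G t)| <= C.
Proof.
have [L L0 HL] := smooth_lipschitz B sphi.
exists (`|phi 0| + L * (2 * B)) => t; rewrite -{1}(subrK (phi 0) (phi (G t))) addrC.
apply: le_trans (ler_normD _ _) _; rewrite lerD2l.
have B0 : 0 <= B := le_trans (normr_ge0 _) (GB t).
apply: le_trans (HL _ _ (GB t) _) _; first by rewrite normr0.
by rewrite ler_wpM2l// edistE subr0 (le_trans (enorm_le_norm _))// ler_wpM2l.
Qed.

Let mphiG : measurable_fun setT (fun t => phi (G t)).
Proof.
have mphi : measurable_fun setT (phi : P -> R) by exact: smooth_measurable.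
exact: (measurableT_comp mphi mG).
Qed.

Lemma kmassE x : kmass x = \int[mu]_t (rho x t ^+ 4).
Proof. by apply: eq_Rintegral => t _; rewrite mul1r pw4_rho. Qed.

Let mrho n x : measurable_fun setT (fun t => rho x t ^+ n).
Proof. by apply: measurable_funX; exact: measurable_rho. Qed.

Let rho_b n x : K x -> exists C, forall t, `|rho x t ^+ n| <= C.
Proof.
move=> Kx; have [C HC] := @rho_mul_bounded x n (cst 1) 1 Kx (fun=> ltac:(by rewrite normr1)).
by exists C => t; have := HC t; rewrite mulr1.
Qed.

(** With [s] the distance from [x] to [G t0], boundary points within [s] of [G t0] have mass at
    least [c1 * s] and lie within [2 * s] of [x], so they contribute at least
    [c1 * s / (2 * s)^4]. *)
Lemma kmass_ge x t0 : K x -> c1 / 16 * rho x t0 ^+ 3 <= kmass x.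
Proof.
move=> Kx; set s := edist x (G t0); have s0 : 0 < s by exact: edist_gt0.
have sh : s <= h by exact: (edist_closure_le diamK).
have [C HC] := rho_b 4 Kx.
rewrite -lee_fin kmassE -(Rintegral_ge0E mu (mrho 4 x) HC).
pose A := [set t | edist (G t0) (G t) < s].
have mA : measurable A.
  have md : measurable_fun setT (fun t => edist (G t0) (G t)) by exact: measurable_edist.
  rewrite (_ : A = setT `&` (fun t => edist (G t0) (G t)) @^-1` `]-oo, s[%classic).
    by apply: md => //; exact: measurable_itv.
  by apply/seteqP; split => [t Ht|t []] /=; rewrite in_itv.
have k0 : 0 <= ((2 * s)^-1) ^+ 4 by rewrite exprn_ge0// invr_ge0 mulr_ge0// ltW.
apply: (@le_trans _ _ (\int[mu]_(t in A) (cst (((2 * s)^-1) ^+ 4)%:E t))%E); last first.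
  apply: integral_subset_mono => // t; last by rewrite lee_fin exprn_ge0// rho_ge0.
  move=> At /=; rewrite lee_fin lerXn2r ?nnegrE ?rho_ge0 ?invr_ge0 ?mulr_ge0 ?(ltW s0)//.
  rewrite /rho lef_pV2 ?posrE ?edist_gt0 ?mulr_gt0//.
  apply: le_trans (edist_triangle (G t0) _ _) _; rewrite -/s; have := ltW At; lra.
rewrite integral_cst//; apply: (@le_trans _ _ ((((2 * s)^-1) ^+ 4)%:E * (c1 * s)%:E)%E).
  by rewrite -EFinM lee_fin /rho -/s le_eqVlt; apply/orP; left; apply/eqP; field; rewrite gt_eqF.
by apply: lee_wpmul2l; [rewrite lee_fin|apply: reg_lo; rewrite s0].
Qed.

Lemma rho_gt0 x t : K x -> 0 < rho x t.
Proof. by move=> Kx; rewrite invr_gt0 edist_gt0. Qed.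

Lemma kmass_gt0 x : K x -> 0 < kmass x.
Proof.
move=> Kx; apply: lt_le_trans (kmass_ge pt Kx).
by rewrite mulr_gt0 ?divr_gt0// exprn_gt0// rho_gt0.
Qed.

Let smooth_kint (f : T -> R) (C : R) : measurable_fun setT f -> (forall t, `|f t| <= C) ->
  smooth_on K (fun x => \int[mu]_t (f t * pw4 (x - G t))).
Proof.
move=> mf fC; apply: (smooth_on_param_integral mu mG mf GB fC oK sup_separated).
exact: smooth_on_pw4.
Qed.

Let one_bd (t : T) : `|(cst 1 : T -> R) t| <= 1. Proof. by rewrite normr1. Qed.

Lemma smooth_on_kmass : smooth_on K kmass.
Proof. exact: (smooth_kint (f := cst 1) _ one_bd). Qed.

Lemma smooth_on_kmean_num : smooth_on K kmean_num.
Proof. by have [C HC] := phiG_bounded; exact: (smooth_kint mphiG HC). Qed.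

Lemma smooth_on_kmean : smooth_on K kmean.
Proof.
move=> n; apply: smooth_upto_mul => //; first exact: smooth_on_kmean_num.
apply: smooth_upto_inv => //; last exact: smooth_on_kmass.
by move=> x Kx; rewrite gt_eqF// kmass_gt0.
Qed.

Let partial_kint (f : T -> R) (C : R) x b : measurable_fun setT f -> (forall t, `|f t| <= C) -> K x ->
  partial b (fun x => \int[mu]_t (f t * pw4 (x - G t))) x = \int[mu]_t (f t * partial b pw4 (x - G t)).
Proof.
move=> mf fC /sup_separated[e e0 xe].
have [_ p0 p1] := param_integral_derive mu mG mf GB fC smooth_on_pw4 e0 xe.
by case: b.
Qed.

Let sub_neq0 x t : K x -> x - G t != 0.
Proof. by move=> Kx; rewrite subr_eq0; apply/eqP => E; apply: (nKG (t := t)); rewrite -E. Qed.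

Lemma dpw4_le x b t : K x -> `|partial b pw4 (x - G t)| <= 4 * rho x t ^+ 5.
Proof. by move=> Kx; have := partial_pw4_le b (sub_neq0 t Kx); rewrite -edistE. Qed.

Lemma measurable_dpw4 x b : K x -> measurable_fun setT (fun t => partial b pw4 (x - G t)).
Proof.
move=> /sup_separated[e e0 xe].
have := kernel_measurable mG (h := cst 1) _ (smooth_on_partial b smooth_on_pw4) e0 xe.
by under eq_fun do rewrite mul1r; apply.
Qed.

Lemma partial_kmass_le x b : K x -> `|partial b kmass x| <= 4 * \int[mu]_t (rho x t ^+ 5).
Proof.
move=> Kx; rewrite (partial_kint (f := cst 1) b _ one_bd Kx)//.
have [C HC] := rho_b 5 Kx.
have mdp := measurable_dpw4 b Kx.
have dpC t : `|1 * partial b pw4 (x - G t)| <= 4 * C.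
  rewrite mul1r; apply: le_trans (dpw4_le b t Kx) _; rewrite ler_wpM2l//.
  by apply: le_trans (HC t); exact: ler_norm.
have m1 : measurable_fun setT (fun t => 1 * partial b pw4 (x - G t)) by exact: measurable_funM.
apply: le_trans (le_normr_Rintegral _ (bounded_integrable mu m1 dpC)) _ => //.
rewrite -RintegralZl//; last exact: bounded_integrable (mrho 5 x) HC.
apply: le_Rintegral => //.
- apply: (@bounded_integrable _ _ _ _ _ (4 * C)); first exact: measurableT_comp.
  by move=> t; rewrite normr_id.
- apply: (@bounded_integrable _ _ _ _ _ (4 * C)); first exact: measurable_funM.
  by move=> t; rewrite normrM ger0_norm// ler_wpM2l.
- by move=> t _; rewrite mul1r; exact: dpw4_le.
Qed.



Let bint := bounded_integrable.

Lemma phi_dev_bounded (x : plane) : exists C, forall t, `|phi (G t) - kmean x| <= C.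
Proof.
have [C HC] := phiG_bounded; exists (C + `|kmean x|) => t.
by apply: le_trans (ler_normB _ _) _; rewrite lerD2r.
Qed.

Let mdev (c : R) : measurable_fun setT (fun t => phi (G t) - c).
Proof. exact: measurable_funB. Qed.

Let int_rho n (f : T -> R) (C : R) x : K x -> measurable_fun setT f -> (forall t, `|f t| <= C) ->
  mu.-integrable setT (EFin \o (fun t => rho x t ^+ n * f t)).
Proof.
move=> Kx mf fC; have [C' HC'] := rho_mul_bounded n Kx fC.
by apply: bint HC'; exact: measurable_funM.
Qed.

Lemma kmean_numE x : kmean_num x = \int[mu]_t (rho x t ^+ 4 * phi (G t)).
Proof. by apply: eq_Rintegral => t _; rewrite pw4_rho mulrC. Qed.

Lemma kmass_kmean x : K x -> kmass x * kmean x = kmean_num x.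
Proof. by move=> Kx; rewrite /kmean mulrC divfK// gt_eqF// kmass_gt0. Qed.

Lemma kmass_dev x (c : R) : K x ->
  kmass x * (c - kmean x) = \int[mu]_t (rho x t ^+ 4 * (c - phi (G t))).
Proof.
move=> Kx; have [C HC] := phiG_bounded; have [C4 HC4] := rho_b 4 Kx.
rewrite mulrBr kmass_kmean// kmassE kmean_numE -RintegralZr//; last exact: bint HC4.
rewrite -RintegralB//; last exact: int_rho HC.
  by apply: eq_Rintegral => t _; rewrite mulrBr.
have [C' HC'] := @rho_mul_bounded x 4 (cst c) `|c| Kx (fun=> lexx _).
by apply: bint HC'; exact: measurable_funM.
Qed.

(** Jensen's inequality for the probability density [rho^4 / kmass], obtained by Cauchy-Schwarz with
    [rho^4] split evenly. *)
Lemma kmass_sqr_dev x (c : R) : K x ->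
  kmass x * (c - kmean x) ^+ 2 <= \int[mu]_t (rho x t ^+ 4 * (c - phi (G t)) ^+ 2).
Proof.
move=> Kx; have [C HC] := phiG_bounded; have [C2 HC2] := rho_b 2 Kx.
have D0 := kmass_gt0 Kx.
have cB t : `|c - phi (G t)| <= `|c| + C.
  by apply: le_trans (ler_normB _ _) _; rewrite lerD2l.
have mc : measurable_fun setT (fun t => c - phi (G t)) by exact: measurable_funB.
have [C' HC'] := rho_mul_bounded 2 Kx cB.
have m2 : measurable_fun setT (fun t => rho x t ^+ 2 * (c - phi (G t))) by exact: measurable_funM.
have := bounded_cauchy_schwarz mu (mrho 2 x) m2 HC2 HC'.
rewrite (_ : \int[mu]_t (rho x t ^+ 2 * (rho x t ^+ 2 * (c - phi (G t)))) =
    kmass x * (c - kmean x)); last first.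
  by rewrite kmass_dev//; apply: eq_Rintegral => t _; rewrite mulrA -exprD.
rewrite (_ : \int[mu]_t ((rho x t ^+ 2) ^+ 2) = kmass x); last first.
  by rewrite kmassE; apply: eq_Rintegral => t _; rewrite -exprM.
rewrite (_ : \int[mu]_t ((rho x t ^+ 2 * (c - phi (G t))) ^+ 2) =
    \int[mu]_t (rho x t ^+ 4 * (c - phi (G t)) ^+ 2)); last first.
  by apply: eq_Rintegral => t _; rewrite exprMn -exprM.
by rewrite exprMn expr2 -mulrA ler_pM2l.
Qed.

(** Differentiating [kmass * kmean = kmean_num] moves [kmean] inside the integral, so that only
    deviations of [phi] from its mean are seen by the gradient. *)
Lemma partial_kmean x b : K x ->
  kmass x * partial b kmean x = \int[mu]_t (partial b pw4 (x - G t) * (phi (G t) - kmean x)).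
Proof.
move=> Kx; have [C HC] := phiG_bounded; have D0 := kmass_gt0 Kx.
have dA := smooth_on_differentiable smooth_on_kmean_num Kx.
have dD := smooth_on_differentiable smooth_on_kmass Kx.
have dw := smooth_on_differentiable smooth_on_kmean Kx.
have E : partial b kmean_num x = partial b kmass x * kmean x + kmass x * partial b kmean x.
  have near_eq : \near x, kmean_num x = kmass x * kmean x.
    by apply: filterS (open_nbhs_nbhs (conj oK Kx)) => y Ky; rewrite kmass_kmean.
  rewrite /partial (near_eq_derive _ near_eq).
  rewrite (deriveM (diff_derivable dD) (diff_derivable dw)) addrC /GRing.scale/=.
  by congr (_ + _); rewrite mulrC.
have dpC : exists C', forall t, `|partial b pw4 (x - G t)| <= C'.
  have [C5 HC5] := rho_b 5 Kx; exists (4 * C5) => t; apply: le_trans (dpw4_le b t Kx) _.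
  by rewrite ler_wpM2l//; apply: le_trans (HC5 t); exact: ler_norm.
have [C' HC'] := dpC.
have mdp := measurable_dpw4 b Kx.
move/eqP: E; rewrite addrC -subr_eq => /eqP <-.
rewrite (partial_kint b mphiG HC Kx) (partial_kint (f := cst 1) b _ one_bd Kx)//.
have i1 : mu.-integrable setT (EFin \o (fun t => partial b pw4 (x - G t))) by exact: bint HC'.
rewrite (_ : \int[mu]_t (cst 1 t * partial b pw4 (x - G t)) = \int[mu]_t (partial b pw4 (x - G t))); last first.
  by apply: eq_Rintegral => t _; rewrite mul1r.
rewrite -RintegralZr// -RintegralB//.
- by apply: eq_Rintegral => t _; rewrite mulrBr mulrC.
- apply: (@bint _ _ _ _ _ (C * C')); first exact: measurable_funM.
  by move=> t; rewrite normrM ler_pM.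
- apply: (@bint _ _ _ _ _ (C' * `|kmean x|)); first exact: measurable_funM.
  by move=> t; rewrite normrM ler_pM.
Qed.

(** The derivative of the kernel is at most [4 rho^5], split as [4 rho^2] times [rho^3]: by
    Cauchy-Schwarz the first factor reproduces the mass and the second leaves [rho^6]. *)
Lemma sqr_partial_kmean_le x b : K x ->
  (kmass x * partial b kmean x) ^+ 2 <=
  16 * (kmass x * \int[mu]_t (rho x t ^+ 6 * (phi (G t) - kmean x) ^+ 2)).
Proof.
move=> Kx; have D0 := kmass_gt0 Kx; have [Cd HCd] := phi_dev_bounded x.
have [C2 HC2] := rho_b 2 Kx; have [C3 HC3] := rho_mul_bounded 3 Kx HCd.
rewrite partial_kmean//.
have mdp := measurable_dpw4 b Kx.
have mF : measurable_fun setT (fun t => partial b pw4 (x - G t) * (phi (G t) - kmean x)) by exact: measurable_funM.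
pose g3 t := `|rho x t ^+ 3 * (phi (G t) - kmean x)|.
pose g t := (4 * rho x t ^+ 2) * g3 t.
have Fg t : `|partial b pw4 (x - G t) * (phi (G t) - kmean x)| <= g t.
  rewrite normrM /g /g3 normrM (ger0_norm (exprn_ge0 3 (rho_ge0 x t))).
  rewrite mulrA -[X in _ <= X * _]mulrA -exprD ler_wpM2r//; exact: dpw4_le.
have C40 t : `|4 * rho x t ^+ 2| <= 4 * C2.
  by rewrite normrM ger0_norm// ler_wpM2l.
have HC3' t : `|g3 t| <= C3 by rewrite /g3 normr_id.
have gC t : g t <= (4 * C2) * C3.
  by rewrite /g ler_pM ?mulr_ge0 ?exprn_ge0 ?rho_ge0//; [exact: normr_ge0|apply: le_trans (C40 t); exact: ler_norm|apply: le_trans (HC3' t); exact: ler_norm].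
have m4 : measurable_fun setT (fun t => 4 * rho x t ^+ 2) by exact: measurable_funM.
have m3 : measurable_fun setT (fun t => rho x t ^+ 3 * (phi (G t) - kmean x)) by exact: measurable_funM.
have m3n : measurable_fun setT g3 by exact: measurableT_comp.
have g0 t : 0 <= g t by exact: mulr_ge0 (mulr_ge0 (ler0n _ 4) (exprn_ge0 2 (rho_ge0 x t))) (normr_ge0 _).
apply: (@le_trans _ _ ((\int[mu]_t g t) ^+ 2)).
  rewrite -[X in X <= _]real_normK ?num_real// lerXn2r ?nnegrE ?Rintegral_ge0//.
  have iF : mu.-integrable setT (EFin \o (fun t => partial b pw4 (x - G t) * (phi (G t) - kmean x))).
    by apply: (bint mu mF) => t; exact: le_trans (Fg t) (gC t).
  apply: le_trans (le_normr_Rintegral measurableT iF) _.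
  apply: le_Rintegral => //.
    apply: (@bint _ _ _ _ _ (4 * C2 * C3)); first exact: measurableT_comp.
    by move=> t; rewrite normr_id; exact: le_trans (Fg t) (gC t).
  apply: (@bint _ _ _ _ _ (4 * C2 * C3)); first exact: measurable_funM.
  by move=> t; rewrite ger0_norm.
apply: le_trans (bounded_cauchy_schwarz mu m4 m3n C40 HC3') _.
rewrite (_ : \int[mu]_t ((4 * rho x t ^+ 2) ^+ 2) = 16 * kmass x); last first.
  have [C4 HC4] := rho_b 4 Kx.
  rewrite kmassE -RintegralZl//; last exact: bint HC4.
  by apply: eq_Rintegral => t _; rewrite exprMn -exprM (_ : 4 ^+ 2 = 16)//; rewrite -natrX.
rewrite -mulrA ler_wpM2l// ler_wpM2l ?(ltW D0)//.
rewrite le_eqVlt; apply/orP; left; apply/eqP; apply: eq_Rintegral => t _.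
by rewrite /g3 real_normK ?num_real// exprMn -exprM.
Qed.

(** A second use of Jensen's inequality replaces the mean by the values [phi (G s)], at the price of
    the weight [rho^4] in [s]. This produces the differences that appear in the Gagliardo energy. *)
Lemma sqr_partial_kmean_leE x b : K x ->
  (((partial b kmean x) ^+ 2)%:E <= \int[mu]_t \int[mu]_s
     (16 * (kmass x)^-1 ^+ 2 * (rho x t ^+ 6 * (rho x s ^+ 4 * (phi (G t) - phi (G s)) ^+ 2)))%:E)%E.
Proof.
move=> Kx; have D0 := kmass_gt0 Kx; have [Cd HCd] := phi_dev_bounded x.
have HCd2 t : `|(phi (G t) - kmean x) ^+ 2| <= Cd ^+ 2.
  by rewrite normrX lerXn2r ?nnegrE// (le_trans _ (HCd t)).
have [C6 HC6] := rho_mul_bounded 6 Kx HCd2.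
have m6 : measurable_fun setT (fun t => rho x t ^+ 6 * (phi (G t) - kmean x) ^+ 2).
  by apply: measurable_funM => //; exact: measurable_funX.
set k := 16 * (kmass x)^-1 ^+ 2; have k0 : 0 <= k by rewrite mulr_ge0// exprn_ge0// invr_ge0 ltW.
apply: (@le_trans _ _ ((k * kmass x)%:E * \int[mu]_t (rho x t ^+ 6 * (phi (G t) - kmean x) ^+ 2)%:E)%E).
  rewrite (Rintegral_ge0E mu m6 HC6) -EFinM lee_fin.
  have := sqr_partial_kmean_le b Kx; rewrite exprMn mulrC -ler_pdivlMr ?exprn_gt0// => H.
  apply: le_trans H _; rewrite /k le_eqVlt; apply/orP; left; apply/eqP; field.
  by rewrite gt_eqF.
rewrite -ge0_integralZl//; first last.
- by rewrite lee_fin mulr_ge0 ?(ltW D0).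
- by move=> t _; rewrite lee_fin mulr_ge0 ?sqr_ge0 ?exprn_ge0 ?rho_ge0.
- exact/measurable_EFinP.
apply: ge0_integral_mono => t _.
  rewrite -EFinM lee_fin; apply: mulr_ge0; first by rewrite mulr_ge0 ?(ltW D0).
  by rewrite mulr_ge0 ?sqr_ge0 ?exprn_ge0 ?rho_ge0.
have [C HC] := phiG_bounded.
have HC2 s : `|(phi (G t) - phi (G s)) ^+ 2| <= (C + C) ^+ 2.
  rewrite normrX lerXn2r ?nnegrE ?addr_ge0//; [exact: le_trans (normr_ge0 _) (HC t)..|].
  by apply: le_trans (ler_normB _ _) _; rewrite lerD.
have [C4 HC4] := rho_mul_bounded 4 Kx HC2.
have m4 : measurable_fun setT (fun s => rho x s ^+ 4 * (phi (G t) - phi (G s)) ^+ 2).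
  by apply: measurable_funM => //; apply: measurable_funX; exact: measurable_funB.
apply: (@le_trans _ _ ((k * rho x t ^+ 6)%:E * \int[mu]_s (rho x s ^+ 4 * (phi (G t) - phi (G s)) ^+ 2)%:E)%E).
  rewrite (Rintegral_ge0E mu m4 HC4) -!EFinM lee_fin.
  rewrite (_ : k * kmass x * _ = k * rho x t ^+ 6 * (kmass x * (phi (G t) - kmean x) ^+ 2)); last by ring.
  by apply: ler_wpM2l; [exact: mulr_ge0 k0 (exprn_ge0 _ (rho_ge0 _ _))|exact: kmass_sqr_dev].
rewrite -ge0_integralZl//; first last.
- by rewrite lee_fin mulr_ge0 ?exprn_ge0 ?rho_ge0.
- by move=> s _; rewrite lee_fin mulr_ge0 ?sqr_ge0 ?exprn_ge0 ?rho_ge0.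
- exact/measurable_EFinP.
apply: ge0_integral_mono => s _; rewrite -EFinM lee_fin -mulrA//.
apply: mulr_ge0 k0 _; apply: mulr_ge0 (exprn_ge0 _ (rho_ge0 _ _)) _.
exact: mulr_ge0 (exprn_ge0 _ (rho_ge0 _ _)) (sqr_ge0 _).
Qed.



Let far (xi : plane) (e : R) : set plane := [set x | e <= edist x xi].

Lemma far_integral_le (xi : plane) (e : R) : 0 < e ->
  (\int[leb2]_(x in far xi e) ((edist x xi)^-1 ^+ 4)%:E <= (128 / e ^+ 2)%:E)%E.
Proof.
move=> e0.
have md : measurable_fun setT (fun x : P => edist x xi) by exact: (@measurable_edist _ _ _ (fun x => x) (cst xi)).
have b0 : 0 <= 16 / e ^+ 2 by rewrite divr_ge0// exprn_ge0// ltW.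
have -> : 128 / e ^+ 2 = 2 * (16 / e ^+ 2) * 4 by field; rewrite gt_eqF.
apply: (@integral_dyadic_le _ _ _ leb2 (fun x => edist x xi) (fun d => d^-1 ^+ 4) 2) => //.
- by apply: measurable_funX; exact: measurable_inv.
- by move=> s; rewrite (_ : 4%N = (2 * 2)%N)// exprM sqr_ge0.
- move=> s s0; apply: (@le_trans _ _ (leb2 (sup_box xi s))); last first.
    by rewrite sup_box_measure ?(ltW s0)// lee_fin exprMn (_ : 2 ^+ 2 = 4)// -natrX.
  apply: le_measure; rewrite ?inE.
  + rewrite (_ : [set _ | _] = setT `&` (fun x : P => edist x xi) @^-1` `]-oo, s[%classic).
      by apply: md => //; exact: measurable_itv.
    by apply/seteqP; split => [t Ht|t []] /=; rewrite in_itv.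
  + exact: measurable_sup_box.
  + move=> x /= xs; apply/sup_boxP; apply: ltW; apply: le_lt_trans xs.
    by rewrite edistE enorm_ge_norm.
- move=> k s; set a := 4 ^+ k * e; have a0 : 0 < a by rewrite mulr_gt0// exprn_gt0.
  move=> as_ _; have s0 : 0 < s by exact: lt_le_trans as_.
  apply: (@le_trans _ _ (a^-1 ^+ 4 * (4 ^+ k.+1 * e) ^+ 2)).
    rewrite ler_wpM2r ?sqr_ge0// lerXn2r ?nnegrE ?invr_ge0 ?(ltW a0) ?(ltW s0)//.
    by rewrite lef_pV2.
  have p0 : (4 : R) ^+ k != 0 by rewrite expf_neq0.
  rewrite (_ : a^-1 ^+ 4 * _ = 16 / e ^+ 2 * (4 ^+ k)^-1 ^+ 2); last first.
    by rewrite /a (exprS 4 k); field; rewrite p0 gt_eqF.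
  rewrite ler_wpM2l// -exprVn -exprM exprVn -exprVn.
  rewrite (_ : (4^-1 : R) = 2^-1 ^+ 2); last by field.
  rewrite -exprM; apply: ler_wiXn2l; rewrite ?invr_ge0// ?invf_le1//; first by rewrite ler1n.
  by clear; lia.
Qed.

(** The lower bound on the mass makes [kmass^-2 rho^6] bounded for the nearer of the two points. The
    farther one is at distance at least [e / 2] from [x], and its fourth power is integrable there.
    If [G s] is the nearer one, the exponents 6 and 4 are exchanged beforehand, which only enlarges
    the integrand. *)
Lemma kernel_pair_le t s : 0 < edist (G t) (G s) ->
  (\int[leb2]_(x in K) ((kmass x)^-1 ^+ 2 * (rho x t ^+ 6 * rho x s ^+ 4))%:E <=
   ((16 / c1) ^+ 2 * (2 ^+ 10 / edist (G t) (G s) ^+ 2))%:E)%E.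
Proof.
set e := edist _ _ => e0.
have e20 : 0 < e / 2 by rewrite divr_gt0.
pose g xi (x : plane) := ((edist x xi)^-1 ^+ 4 * \1_(far xi (e / 2)) x)%:E.
have g0 xi x : (0 <= g xi x)%E.
  by rewrite lee_fin mulr_ge0// (_ : 4%N = (2 * 2)%N)// exprM sqr_ge0.
have mfar xi : measurable (far xi (e / 2) : set P).
  have md : measurable_fun setT (fun x : P => edist x xi) by exact: (@measurable_edist _ _ _ (fun x => x) (cst xi)).
  rewrite (_ : far _ _ = setT `&` (fun x : P => edist x xi) @^-1` `[e / 2, +oo[%classic).
    by apply: md => //; exact: measurable_itv.
  by apply/seteqP; split => [u Hu|u []] /=; rewrite in_itv/= andbT.
have mg xi : measurable_fun setT (g xi : P -> \bar R).
  apply/measurable_EFinP; apply: measurable_funM; last exact: measurable_indic.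
  by apply: measurable_funX; apply: measurable_inv; exact: (@measurable_edist _ _ _ (fun x => x) (cst xi)).
have Ig xi : (\int[leb2]_x g xi x <= (2 ^+ 9 / e ^+ 2)%:E)%E.
  apply: (@le_trans _ _ (\int[leb2]_(x in far xi (e / 2)) ((edist x xi)^-1 ^+ 4)%:E)%E).
    rewrite [leRHS]integral_mkcond; apply: ge0_integral_mono => x _ //.
    by rewrite /g patchE indicE; case: ifP => _; rewrite ?mulr1 ?mulr0.
  apply: le_trans (far_integral_le xi e20) _; rewrite lee_fin le_eqVlt; apply/orP; left; apply/eqP.
  by field; rewrite gt_eqF.
have c0 : 0 <= (16 / c1) ^+ 2 by exact: sqr_ge0.
apply: (@le_trans _ _ (\int[leb2]_x (((16 / c1) ^+ 2)%:E * (g (G s) x + g (G t) x)))%E); last first.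
  rewrite ge0_integralZl//; first last.
  - by move=> x _; rewrite adde_ge0.
  - exact: emeasurable_funD.
  rewrite ge0_integralD// [leRHS]EFinM; apply: lee_wpmul2l; first by rewrite lee_fin.
  apply: le_trans (leeD (Ig _) (Ig _)) _; rewrite -EFinD lee_fin le_eqVlt; apply/orP; left; apply/eqP.
  by rewrite (exprS 2 9); field; rewrite gt_eqF.
apply: integral_subset_mono => // x; last first.
- by move=> _; apply: mule_ge0; [rewrite lee_fin|rewrite adde_ge0].
- move=> Kx; have D0 := kmass_gt0 Kx.
  have rt := rho_gt0 t Kx; have rs := rho_gt0 s Kx.
  have key u v : rho x u <= rho x v -> 0 < rho x u -> 0 < rho x v ->
      (kmass x)^-1 ^+ 2 * rho x v ^+ 6 <= (16 / c1) ^+ 2.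
    move=> _ ru rv; have H := kmass_ge v Kx.
    have : (kmass x)^-1 <= (c1 / 16 * rho x v ^+ 3)^-1.
      by rewrite lef_pV2// posrE mulr_gt0 ?divr_gt0// exprn_gt0.
    move=> H2; have : (kmass x)^-1 ^+ 2 <= ((c1 / 16 * rho x v ^+ 3)^-1) ^+ 2.
      by rewrite lerXn2r ?nnegrE ?invr_ge0 ?(ltW D0)// mulr_ge0 ?divr_ge0 ?exprn_ge0 ?(ltW rv) ?(ltW c1_gt0).
    move=> H3; apply: le_trans (ler_wpM2r (exprn_ge0 6 (ltW rv)) H3) _.
    by rewrite le_eqVlt; apply/orP; left; apply/eqP; field; rewrite !gt_eqF.
  have farE u v : edist (G u) (G v) = e -> edist x (G u) <= edist x (G v) -> far (G v) (e / 2) x.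
    move=> ee uv; rewrite /far/=.
    have := edist_triangle x (G u) (G v); rewrite ee (edistC (G u) x); lra.
  rewrite -EFinD -EFinM lee_fin /g.
  have gE v : (edist x (G v))^-1 ^+ 4 = rho x v ^+ 4 by [].
  rewrite !gE.
  have [le_ts|lt_st] := leP (edist x (G t)) (edist x (G s)).
    have fs : far (G s) (e / 2) x by exact: (farE t s).
    have rst : rho x s <= rho x t by rewrite /rho lef_pV2// posrE edist_gt0.
    rewrite [\1_(far (G s) _) x]indicE mem_set// mulr1 mulrA.
    apply: ler_pM => //; rewrite ?exprn_ge0 ?(ltW rs)//.
    + by apply: mulr_ge0; [exact: sqr_ge0|exact: exprn_ge0 (ltW rt)].
    + exact: (key s t).
    + by rewrite lerDl mulr_ge0// exprn_ge0// ltW.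
  have ft : far (G t) (e / 2) x by apply: (farE s t); [rewrite edistC|exact: ltW].
  have rts : rho x t <= rho x s by rewrite /rho lef_pV2// ?posrE ?edist_gt0// ltW.
  rewrite [\1_(far (G t) _) x]indicE mem_set// mulr1.
  apply: (@le_trans _ _ ((kmass x)^-1 ^+ 2 * rho x s ^+ 6 * rho x t ^+ 4)).
    rewrite -mulrA ler_wpM2l ?sqr_ge0//.
    have H : rho x t ^+ 2 <= rho x s ^+ 2 by rewrite lerXn2r ?nnegrE ?(ltW rt) ?(ltW rs).
    have p1 := exprn_gt0 4 rt; have p2 := exprn_gt0 4 rs.
    have -> : rho x t ^+ 6 * rho x s ^+ 4 = (rho x s ^+ 4 * rho x t ^+ 4) * rho x t ^+ 2 by ring.
    have -> : rho x s ^+ 6 * rho x t ^+ 4 = (rho x s ^+ 4 * rho x t ^+ 4) * rho x s ^+ 2 by ring.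
    by rewrite ler_wpM2l// mulr_ge0 ?ltW.
  apply: ler_pM => //; rewrite ?exprn_ge0 ?(ltW rt)//.
  + by apply: mulr_ge0; [exact: sqr_ge0|exact: exprn_ge0 (ltW rs)].
  + exact: (key t s).
  + by rewrite lerDr mulr_ge0// exprn_ge0// ltW.
- move=> Kx; rewrite lee_fin; apply: mulr_ge0; first exact: sqr_ge0.
  exact: mulr_ge0 (exprn_ge0 _ (rho_ge0 _ _)) (exprn_ge0 _ (rho_ge0 _ _)).
Qed.



Definition gagliardo : \bar R :=
  (\int[mu]_t \int[mu]_s ((phi (G t) - phi (G s)) ^+ 2 / edist (G t) (G s) ^+ 2)%:E)%E.

(** Tonelli brings the integration in [x] innermost, where [kernel_pair_le] turns the weight of a
    pair into the Gagliardo kernel. *)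
Lemma integral_grad_kmean_le b :
  (\int[leb2]_(x in K) (((partial b kmean x) ^+ 2)%:E) <=
   (16 * (16 / c1) ^+ 2 * 2 ^+ 10)%:E * gagliardo)%E.
Proof.
have mK : measurable (K : set P) by exact: open_plane_measurable.
pose F (q : P * T * T) : \bar R := (16 * (kmass q.1.1)^-1 ^+ 2 *
   (rho q.1.1 q.1.2 ^+ 6 * (rho q.1.1 q.2 ^+ 4 * (phi (G q.1.2) - phi (G q.2)) ^+ 2)))%:E.
have mx : measurable_fun setT ((fun q : P * T * T => q.1.1) : _ -> P).
  exact: measurableT_comp measurable_fst measurable_fst.
have mt : measurable_fun setT (fun q : P * T * T => q.1.2).
  exact: measurableT_comp measurable_snd measurable_fst.
have ms : measurable_fun setT (fun q : P * T * T => q.2) by exact: measurable_snd.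
have mrho_of (a : P * T * T -> T) : measurable_fun setT a -> measurable_fun setT (fun q => rho q.1.1 (a q)).
  by move=> ma; apply: measurable_inv; apply: measurable_edist => //; exact: (measurableT_comp mG ma).
have mkm : measurable_fun setT (kmass : P -> R).
  have mq : measurable_fun setT (fun q : P * T => (rho q.1 q.2 ^+ 4)%:E).
    apply/measurable_EFinP; apply: measurable_funX; apply: measurable_inv.
    apply: measurable_edist; first exact: measurable_fst.
    exact: (measurableT_comp mG measurable_snd).
  have q0 (q : P * T) : (0 <= (rho q.1 q.2 ^+ 4)%:E)%E by rewrite lee_fin exprn_ge0// rho_ge0.
  have mI := measurable_fun_integral_setX mu measurableT mq q0.
  rewrite (_ : kmass = fun x => fine (\int[mu]_s (rho x s ^+ 4)%:E)%E); last first.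
    by apply/funext => x; rewrite kmassE.
  exact: measurableT_comp mI.
have mF : measurable_fun setT F.
  apply/measurable_EFinP; apply: measurable_funM.
    apply: measurable_funM => //; apply: measurable_funX; apply: measurable_inv.
    exact: (measurableT_comp mkm mx).
  apply: measurable_funM; first by apply: measurable_funX; exact: mrho_of.
  apply: measurable_funM; first by apply: measurable_funX; exact: mrho_of.
  apply: measurable_funX; apply: measurable_funB; [exact: (measurableT_comp mphiG mt)|exact: (measurableT_comp mphiG ms)].
have F0 q : (0 <= F q)%E.
  rewrite lee_fin; apply: mulr_ge0; first by apply: mulr_ge0 => //; exact: sqr_ge0.
  apply: mulr_ge0 (exprn_ge0 _ (rho_ge0 _ _)) _.
  exact: mulr_ge0 (exprn_ge0 _ (rho_ge0 _ _)) (sqr_ge0 _).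
apply: (@le_trans _ _ (\int[leb2]_(x in K) \int[mu]_t \int[mu]_s F ((x, t), s))%E).
  by apply: ge0_integral_mono => x Kx; [rewrite lee_fin sqr_ge0|exact: sqr_partial_kmean_leE].
have mI := measurable_fun_integral_setX mu measurableT mF F0.
have I0 (q : P * T) : (0 <= \int[mu]_s F (q, s))%E by exact: integral_ge0.
rewrite (tonelli_setX plane_lebesgue mu mK measurableT mI I0) /gagliardo.
have mgag : measurable_fun setT (fun p : T * T =>
    ((phi (G p.1) - phi (G p.2)) ^+ 2 / edist (G p.1) (G p.2) ^+ 2)%:E).
  apply/measurable_EFinP; apply: measurable_funM.
    apply: measurable_funX; apply: measurable_funB.
      exact: (measurableT_comp mphiG measurable_fst).
    exact: (measurableT_comp mphiG measurable_snd).
  apply: measurable_inv; apply: measurable_funX; apply: measurable_edist.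
    exact: (measurableT_comp mG measurable_fst).
  exact: (measurableT_comp mG measurable_snd).
have gag0 (p : T * T) : (0 <= ((phi (G p.1) - phi (G p.2)) ^+ 2 / edist (G p.1) (G p.2) ^+ 2)%:E)%E.
  by rewrite lee_fin divr_ge0 ?sqr_ge0.
set c := 16 * (16 / c1) ^+ 2 * 2 ^+ 10.
have c0 : 0 <= c by apply: mulr_ge0 (exprn_ge0 _ (ler0n _ 2)); apply: mulr_ge0 (sqr_ge0 _); exact: ler0n.
rewrite -ge0_integralZl//; first last.
- by move=> t _; apply: integral_ge0 => s _; exact: (gag0 (t, s)).
- exact: (measurable_fun_integral_setX mu measurableT mgag gag0).
apply: ge0_integral_mono => t _; first by apply: integral_ge0 => x _; exact: I0.
have mFt : measurable_fun setT (fun q : P * T => F ((q.1, t), q.2)).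
  have mp : measurable_fun setT (fun q : P * T => ((q.1, t), q.2)).
    apply: measurable_fun_pair; last exact: measurable_snd.
    by apply: measurable_fun_pair; [exact: measurable_fst|exact: measurable_cst].
  exact: (measurableT_comp mF mp).
rewrite (tonelli_setX plane_lebesgue mu mK measurableT mFt (fun q => F0 _)).
rewrite -ge0_integralZl//; first last.
- by move=> s _; exact: (gag0 (t, s)).
- exact: (measurableT_comp mgag (measurable_pair1 t)).
apply: ge0_integral_mono => s _; first by apply: integral_ge0 => x _; exact: F0.
pose a := 16 * (phi (G t) - phi (G s)) ^+ 2.
have a0 : 0 <= a by apply: mulr_ge0 (sqr_ge0 _).
have mker : measurable_fun (K : set P) (fun x => ((kmass x)^-1 ^+ 2 * (rho x t ^+ 6 * rho x s ^+ 4))%:E).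
  have mr u n : measurable_fun setT ((fun x => rho x u ^+ n) : P -> R).
    by apply: measurable_funX; apply: measurable_inv; apply: (@measurable_edist _ _ _ (fun x => x) (cst (G u))).
  apply: measurable_funTS; apply/measurable_EFinP; apply: measurable_funM; last by apply: measurable_funM.
  by apply: measurable_funX; exact: measurable_inv.
have -> : (\int[leb2]_(x in K) F ((x, t), s) =
    a%:E * \int[leb2]_(x in K) ((kmass x)^-1 ^+ 2 * (rho x t ^+ 6 * rho x s ^+ 4))%:E)%E.
  rewrite -ge0_integralZl//.
  - by apply: eq_integral => x _; rewrite /F/= -EFinM /a; congr EFin; ring.
  - move=> x _; rewrite lee_fin; apply: mulr_ge0 (sqr_ge0 _) _.
    exact: mulr_ge0 (exprn_ge0 _ (rho_ge0 _ _)) (exprn_ge0 _ (rho_ge0 _ _)).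
have := edist_ge0 (G t) (G s); rewrite le_eqVlt => /predU1P[d0|d0].
  rewrite /a (edist_eq0 (esym d0)) subrr expr0n/= mulr0 mul0e mul0r mule0; exact: lexx.
apply: le_trans (lee_wpmul2l _ (kernel_pair_le d0)) _; first by rewrite lee_fin.
rewrite -!EFinM lee_fin le_eqVlt; apply/orP; left; apply/eqP; rewrite /a /c; field.
by rewrite !gt_eqF.
Qed.

(** The infimum of the distances is positive, so some point comes within twice it; this stands in
    for a nearest boundary point. *)
Lemma near_minimiser x : K x -> exists t0, forall t, edist x (G t0) <= 2 * edist x (G t).
Proof.
move=> Kx; have [e e0 He] := edist_sep Kx.
pose S := [set edist x (G t) | t in setT].
have hS : has_inf S.
  by split; [exists (edist x (G pt)), pt|exists e => _ [t _ <-]].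
have i0 : e <= inf S by apply: lb_le_inf; [exists (edist x (G pt)), pt|move=> _ [t _ <-]].
have [_ [t0 _ <-] Ht0] := inf_adherent (lt_le_trans e0 i0) hS.
exists t0 => t; have : inf S <= edist x (G t) by apply: ge_inf; [exact: hS.2|exists t].
by lra.
Qed.

(* Near the boundary [partial b kmass] is of order [kmass] divided by the
   distance, and [phi - kmean] is of the order of that distance. *)
Lemma dev_mul_partial_kmass_le : exists2 C, 0 <= C &
  forall x b, K x -> `|(phi x - kmean x) * partial b kmass x| <= C * kmass x.
Proof.
have [L L0 HL] := smooth_lipschitz B sphi.
exists (L * (8 * C1) * (4 * (8 * (16 / c1)))).
  have c16 : 0 <= 8 * (16 / c1) by rewrite mulr_ge0// divr_ge0// ltW.
  exact: mulr_ge0 (mulr_ge0 L0 (mulr_ge0 (ler0n _ 8) C1_ge0)) (mulr_ge0 (ler0n _ 4) c16).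
move=> x b Kx; have D0 := kmass_gt0 Kx.
have [t0 Ht0] := near_minimiser Kx.
pose dl := edist x (G t0) / 2; have dl0 : 0 < dl by rewrite divr_gt0// edist_gt0.
have dlt t : dl <= edist x (G t) by rewrite /dl ler_pdivrMr// mulrC.
have rdl t : rho x t <= dl^-1 by rewrite lef_pV2// posrE edist_gt0.
have dlD : dl^-1 ^+ 3 <= 8 * (16 / c1) * kmass x.
  have := kmass_ge t0 Kx; rewrite (_ : rho x t0 = dl^-1 / 2); last first.
    by rewrite /rho /dl; field; rewrite gt_eqF// edist_gt0.
  have cc : 0 <= 8 * (16 / c1) by rewrite mulr_ge0// divr_ge0// ltW.
  move=> /(ler_wpM2l cc) H; apply: le_trans _ H.
  by rewrite le_eqVlt; apply/orP; left; apply/eqP; field; rewrite !gt_eqF.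
have [C5 HC5] := rho_b 5 Kx; have [C4 HC4] := rho_b 4 Kx; have [C3 HC3] := rho_b 3 Kx.
have r5 : \int[mu]_t (rho x t ^+ 5) <= dl^-1 * kmass x.
  rewrite kmassE -RintegralZl//; last exact: bint HC4.
  apply: le_Rintegral => //; first exact: bint HC5.
    apply: (@bint _ _ _ _ _ (dl^-1 * C4)); first exact: measurable_funM.
    by move=> t; rewrite normrM ger0_norm ?invr_ge0 ?(ltW dl0)// ler_wpM2l// invr_ge0 ltW.
  by move=> t _; rewrite exprS ler_wpM2r// exprn_ge0// rho_ge0.
have r3 : \int[mu]_t (rho x t ^+ 3) <= 8 * C1 * dl^-1 ^+ 2.
  rewrite -lee_fin -(Rintegral_ge0E mu (mrho 3 x) HC3).
  have -> : (\int[mu]_t (rho x t ^+ 3)%:E =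
      \int[mu]_(t in [set t | (dl <= edist x (G t))%R]) ((edist x (G t))^-1 ^+ 3)%:E)%E.
    by congr (integral _ _ _); apply/seteqP; split => // t _ /=; exact: dlt.
  have md : measurable_fun setT (fun t => edist x (G t)) by exact: measurable_edist.
  have b0 : 0 <= 4 * dl^-1 ^+ 2 by rewrite mulr_ge0// sqr_ge0.
  rewrite (_ : 8 * C1 * dl^-1 ^+ 2 = 2 * (4 * dl^-1 ^+ 2) * C1); last by ring.
  pose g (u : R) := `|u^-1 ^+ 3|.
  have gE t : (edist x (G t))^-1 ^+ 3 = g (edist x (G t)).
    by rewrite /g ger0_norm// exprn_ge0// invr_ge0 edist_ge0.
  under eq_integral do rewrite gE.
  apply: (@integral_dyadic_le _ _ _ mu (fun t => edist x (G t)) g 1) => //.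
  - rewrite (_ : _ \o _ = fun t => (edist x (G t))^-1 ^+ 3); last by apply/funext => t /=; rewrite -gE.
    by apply: measurable_funX; exact: measurable_inv.
  - by move=> s; exact: normr_ge0.
  - by move=> s s0; rewrite expr1; exact: reg.
  - move=> k s; set a := 4 ^+ k * dl; have a0 : 0 < a by rewrite mulr_gt0// exprn_gt0.
    move=> as_ _; have s0 : 0 < s by exact: lt_le_trans as_.
    apply: (@le_trans _ _ (a^-1 ^+ 3 * (4 ^+ k.+1 * dl) ^+ 1)).
      apply: ler_wpM2r; [exact: exprn_ge0 (mulr_ge0 (exprn_ge0 _ (ler0n _ 4)) (ltW dl0))|].
      rewrite /g ger0_norm ?exprn_ge0 ?invr_ge0 ?(ltW s0)//.
      by rewrite lerXn2r ?nnegrE ?invr_ge0 ?(ltW a0) ?(ltW s0)// lef_pV2.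
    have p0 : (4 : R) ^+ k != 0 by rewrite expf_neq0.
    rewrite (_ : a^-1 ^+ 3 * _ = 4 * dl^-1 ^+ 2 * (4 ^+ k)^-1 ^+ 2); last first.
      by rewrite /a (exprS 4 k); field; rewrite p0 gt_eqF.
    rewrite ler_wpM2l// -exprVn -exprM.
    rewrite (_ : (4^-1 : R) = 2^-1 ^+ 2); last by field.
    rewrite -exprM; apply: ler_wiXn2l; rewrite ?invr_ge0// ?invf_le1//; first by rewrite ler1n.
    by clear; lia.
(* The Lipschitz bound trades one power of [rho] for [L], leaving the integral of [rho^3]. Together
   with [r5] the product is of order [dl^-3], which [dlD] bounds by the mass. *)
have dev : `|phi x - kmean x| * kmass x <= L * (8 * C1 * dl^-1 ^+ 2).
  rewrite -[X in _ * X](gtr0_norm D0) -normrM mulrC kmass_dev//.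
  have [C HC] := phiG_bounded.
  have cB t : `|phi x - phi (G t)| <= `|phi x| + C.
    by apply: le_trans (ler_normB _ _) _; rewrite lerD2l.
  have mc : measurable_fun setT (fun t => phi x - phi (G t)) by exact: measurable_funB.
  have iF := int_rho 4 Kx mc cB.
  apply: le_trans (le_normr_Rintegral measurableT iF) _.
  apply: (@le_trans _ _ (L * \int[mu]_t (rho x t ^+ 3))); last by rewrite ler_wpM2l.
  rewrite -RintegralZl//; last exact: bint HC3.
  apply: le_Rintegral => //.
  - have [C' HC'] := rho_mul_bounded 4 Kx cB.
    apply: (@bint _ _ _ _ _ C'); last by move=> t; rewrite normr_id.
    by apply: measurableT_comp => //; exact: measurable_funM.
  - apply: (@bint _ _ _ _ _ (L * C3)); first exact: measurable_funM.
    by move=> t; rewrite normrM ger0_norm// ler_wpM2l.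
  - move=> t _; rewrite normrM (ger0_norm (exprn_ge0 4 (rho_ge0 x t))).
    apply: (@le_trans _ _ (rho x t ^+ 4 * (L * edist x (G t)))).
      by rewrite ler_wpM2l ?exprn_ge0 ?rho_ge0//; apply: HL; [exact: KB|exact: GB].
    rewrite /rho le_eqVlt; apply/orP; left; apply/eqP; field.
    by rewrite gt_eqF// edist_gt0.
rewrite normrM.
have H1 := partial_kmass_le b Kx.
have n0 : 0 <= `|phi x - kmean x| by exact: normr_ge0.
have H2 : `|partial b kmass x| <= 4 * (dl^-1 * kmass x).
  by apply: le_trans H1 _; rewrite ler_wpM2l.
apply: le_trans (ler_wpM2l n0 H2) _.
rewrite (_ : `|phi x - kmean x| * (4 * (dl^-1 * kmass x)) =
   (`|phi x - kmean x| * kmass x) * (4 * dl^-1)); last by ring.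
apply: le_trans (ler_wpM2r _ dev) _; first by rewrite mulr_ge0// invr_ge0 ltW.
rewrite (_ : L * (8 * C1 * dl^-1 ^+ 2) * (4 * dl^-1) = L * (8 * C1) * 4 * dl^-1 ^+ 3); last by ring.
rewrite (_ : _ * kmass x = L * (8 * C1) * 4 * (8 * (16 / c1) * kmass x)); last by ring.
by rewrite ler_wpM2l// mulr_ge0// mulr_ge0// mulr_ge0.
Qed.


End KernelAverage.

Section ChainRule.
Context {R : realType}.
Local Notation plane := (R * R)%type.

Lemma partial_comp (f : plane -> R) (h : R -> R) (h' : R) (x : plane) b : differentiable f x ->
  is_derive (f x) (1 : R) h h' -> partial b (fun y => h (f y)) x = h' * partial b f x.
Proof.
move=> df dh; have dhd : differentiable h (f x) by apply/derivable1_diffP; exact: ex_derive.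
rewrite /partial (@deriveE _ _ _ (fun y => h (f y))); last exact: differentiable_comp.
rewrite (@diff_comp _ _ _ _ f h)//= -(@deriveE _ _ _ f)//.
have := @deriveE _ _ _ h (f x) 1 dhd; rewrite (@derive_val _ _ _ _ _ _ _ dh) => hE.
set y := 'D_(Defs.basis b) f x.
have -> : 'd h (f x) y = 'd h (f x) (y *: (1 : R)) by rewrite /GRing.scale/= mulr1.
by rewrite linearZ/= -hE /GRing.scale/= mulrC.
Qed.

End ChainRule.

(** * Orthogonality to the kernel mean *)

Section Orthogonality.
Context {R : realType}.
Local Notation plane := (R * R)%type.
Local Notation P := (measurableTypeR R * measurableTypeR R)%type.
Local Notation leb2 := (@lebesgue_measure R \x @lebesgue_measure R)%E.
Local Notation edist := Defs.edist.
Context d (T : measurableType d) (mu : {finite_measure set T -> \bar R}).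
Variables (G : T -> plane) (mG : measurable_fun setT (G : T -> P)) (pt : T).
Variables (K : set plane) (h c1 C1 B : R).
Hypotheses (oK : open K) (bK : bounded_set K).
Hypothesis diamK : forall x y, K x -> K y -> edist x y <= h.
Hypotheses (clG : forall t, closure K (G t)) (nKG : forall t, ~ K (G t)).
Hypothesis frG : forall x, closure K x -> ~ K x -> exists t, x = G t.
Hypotheses (GB : forall t, `|G t| <= B) (KB : forall x, K x -> `|x| <= B).
Hypothesis C1_ge0 : 0 <= C1.
Hypothesis reg : forall x s, 0 < s -> (mu [set t | (edist x (G t) < s)%R] <= (C1 * s)%:E)%E.
Hypothesis c1_gt0 : 0 < c1.
Hypothesis reg_lo : forall t0 s, 0 < s <= h ->
  ((c1 * s)%:E <= mu [set t | (edist (G t0) (G t) < s)%R])%E.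
Variables (phi : plane -> R) (sphi : smooth phi).

Let D := kmass mu G.
Let w := kmean mu G phi.
Let mK : measurable (K : set P). Proof. exact: open_plane_measurable. Qed.
Let D_gt0 x : K x -> 0 < D x.
Proof. by move=> Kx; exact: (kmass_gt0 mG pt oK diamK clG nKG c1_gt0 reg_lo Kx). Qed.
Let sD : smooth_on K D. Proof. exact: (smooth_on_kmass mu mG oK nKG GB). Qed.
Let sw : smooth_on K w.
Proof. exact: (smooth_on_kmean mG pt oK diamK clG nKG GB c1_gt0 reg_lo sphi). Qed.
Let sphiK : smooth_on K phi.
Proof. by move=> n; apply: smooth_uptoS (subsetT K) _; move/smooth_onT: sphi; exact. Qed.

(* [D] blows up at the boundary, so that the factor [expinv 0] has compact
   support in [K]; it tends to the constant [expinv 0 2] as [M] grows. *)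
Definition cutoff (M : R) (x : plane) : R :=
  if x \in K then expinv 0 (2 - D x / M) * (phi x - w x) else 0.

Let sublevel M : set plane := [set x | K x /\ D x <= 2 * M].

(** At a limit point inside [K] continuity of the mass suffices. A limit point on the boundary is
    excluded, since [kmass_ge] makes the mass unbounded near it. *)
Let sublevel_closed M : 0 < M -> closed (sublevel M).
Proof.
move=> M0 x clx; have clKx : closure K x by apply: closure_subset clx => y [].
have [Kx|nKx] := pselect (K x).
  split => //; rewrite leNgt; apply/negP => Dx.
  have cD : D y @[y --> x] --> D x by apply: (smooth_on_continuous sD); exact/mem_set.
  have nb : \forall y \near x, 2 * M < D y by exact: (cvgr_gt _ cD).
  by have [y [[_ yM] /=]] := clx _ nb; rewrite ltNge yM.
have [t xE] := frG clKx nKx; exfalso.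
(* [rho > 1] allows [rho^3] to be replaced by [rho], and [rho > 32 * M / c1] then makes the lower
   bound [c1 / 16 * rho] exceed [2 * M]. *)
pose m := Num.max 1 (32 * M / c1).
have m0 : 0 < m by rewrite lt_max ltr01.
have [y [Ky yM] yx] := closure_near clx (divr_gt0 ltr01 m0).
have rt : 0 < rho G y t by rewrite invr_gt0 (edist_gt0 oK nKG).
have rm : m < rho G y t.
  rewrite /rho -[m]invrK ltf_pV2 ?posrE ?invr_gt0 ?(edist_gt0 oK nKG)//.
  by move: yx; rewrite xE div1r.
have r1 : 1 < rho G y t by apply: le_lt_trans rm; rewrite le_max lexx.
have rM : 32 * M / c1 < rho G y t by apply: le_lt_trans rm; rewrite le_max lexx orbT.
have := kmass_ge mG oK diamK clG nKG reg_lo t Ky; rewrite -/(D y) => H.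
have : c1 / 16 * rho G y t ^+ 3 <= 2 * M by exact: le_trans H yM.
rewrite leNgt => /negP; apply.
apply: (@lt_le_trans _ _ (c1 / 16 * rho G y t)).
  rewrite ltr_pdivrMr// in rM; lra.
by rewrite ler_wpM2l ?divr_ge0 ?(ltW c1_gt0)// exprS ler_peMr ?(ltW rt)// exprn_ege1// ltW.
Qed.

Let cutoff_sublevel M x : 0 < M -> cutoff M x != 0 -> sublevel M x.
Proof.
move=> M0; rewrite /cutoff; case: ifPn => [/set_mem Kx|_]; last by rewrite eqxx.
rewrite mulf_eq0 negb_or => /andP[H _]; split => //; rewrite leNgt; apply/negP => DM.
move/negP: H; apply; apply/eqP/expinv_le0.
by rewrite subr_le0 ler_pdivlMr// ltW.
Qed.

Let cutoffE M x : K x -> cutoff M x = expinv 0 (2 - D x / M) * (phi x - w x).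
Proof. by move=> Kx; rewrite /cutoff mem_set. Qed.

Let smooth_argument M : smooth_on K (fun x => 2 - D x / M).
Proof.
move=> n; apply: (@eq_smooth_upto _ _ _ (fun x => 2 + (- M^-1) * D x)) => //.
  by move=> x _; rewrite mulNr mulrC.
apply: smooth_upto_add => //; first exact: smooth_upto_cst.
by apply: smooth_upto_mul => //; exact: smooth_upto_cst.
Qed.

Let smooth_dev : smooth_on K (fun x => phi x - w x).
Proof.
move=> n; apply: (@eq_smooth_upto _ _ _ (fun x => phi x + (-1) * w x)) => //.
  by move=> x _; rewrite mulN1r.
apply: (smooth_upto_add oK (sphiK n)).
by apply: (smooth_upto_mul oK _ (sw n)); exact: smooth_upto_cst.
Qed.

(** Two open sets cover the plane: [K], where the defining product is smooth, and the complement of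
    the closed sublevel set, where the function is zero. *)
Lemma test_fun_cutoff M : 0 < M -> test_fun K (cutoff M).
Proof.
move=> M0; apply: (@test_fun_supported _ _ (sublevel M)).
- apply: (@plane_bounded_closed_compact _ _ B (sublevel_closed M0)) => x [Kx _]; exact: KB.
- by move=> x [].
- by move=> x; exact: cutoff_sublevel.
apply/smooth_onT => n; apply: (@smooth_uptoS _ _ (K `|` ~` sublevel M)).
  move=> x _; have [Kx|nKx] := pselect (K x); first by left.
  by right => -[].
apply: smooth_uptoU.
  apply: (@eq_smooth_upto _ _ _ (fun x => expinv 0 (2 - D x / M) * (phi x - w x))) => //.
    by move=> x Kx; rewrite cutoffE.
  apply: (smooth_upto_mul oK _ (smooth_dev n)).
  by apply: (smooth_upto_comp oK (fun k t => is_derive_expinv k t)); exact: smooth_argument.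
apply: (@eq_smooth_upto _ _ _ (cst 0)); last exact: smooth_upto_cst.
  by rewrite openC; exact: sublevel_closed.
by move=> x nS; apply/esym/eqP; apply: contra_notT nS; exact: cutoff_sublevel.
Qed.

Lemma partial_cutoff M x b : K x -> partial b (cutoff M) x =
  expinv 1 (2 - D x / M) * (- (partial b D x / M)) * (phi x - w x) +
  expinv 0 (2 - D x / M) * (partial b phi x - partial b w x).
Proof.
move=> Kx.
have nE : \near x, cutoff M x = expinv 0 (2 - D x / M) * (phi x - w x).
  by apply: filterS (open_nbhs_nbhs (conj oK Kx)) => y Ky; rewrite cutoffE.
have da := smooth_on_differentiable (smooth_argument M) Kx.
have ddev := smooth_on_differentiable smooth_dev Kx.
have dD := smooth_on_differentiable sD Kx.
have dphi := smooth_on_differentiable sphiK Kx.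
have dw := smooth_on_differentiable sw Kx.
have de : differentiable (fun x => expinv 0 (2 - D x / M)) x.
  apply: (@differentiable_comp _ _ _ _ (fun x => 2 - D x / M) (expinv 0)) => //.
  by apply/derivable1_diffP; exact: (@ex_derive _ _ _ _ _ _ _ (is_derive_expinv 0 _)).
rewrite /partial (near_eq_derive _ nE).
rewrite (deriveM (diff_derivable de) (diff_derivable ddev)) /GRing.scale/= addrC; congr (_ + _).
  have := partial_comp b da (is_derive_expinv 0 (2 - D x / M)); rewrite /partial => ->.
  rewrite mulrC; congr (_ * _ * _).
  rewrite (_ : (fun x => 2 - D x / M) = cst 2 - (M^-1 \*: D)); last first.
    by apply/funext => y; rewrite /= mulrC.
  have dDb : derivable D x (Defs.basis b) by exact: diff_derivable dD.
  have dc : derivable (cst (2 : R)) x (Defs.basis b) by exact: derivable_cst.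
  have dz : derivable (M^-1 \*: D) x (Defs.basis b) by exact: derivableZ.
  rewrite (deriveB dc dz) derive_cst sub0r (deriveZ _ dDb).
  by rewrite /GRing.scale/= mulrC.
by congr (_ * _); rewrite (deriveB (diff_derivable dphi) (diff_derivable dw)).
Qed.

Let gag : \bar R := gagliardo mu G phi.
Variables (g : R) (gagE : gag = g%:E).

Let g0 : 0 <= g.
Proof.
rewrite -lee_fin -gagE; apply: integral_ge0 => t _; apply: integral_ge0 => s _.
by rewrite lee_fin divr_ge0 ?sqr_ge0.
Qed.

Let Cg := 16 * (16 / c1) ^+ 2 * 2 ^+ 10.

Let mpw b : measurable_fun (K : set P) (partial b w : P -> R).
Proof.
by apply: open_continuous_plane_measurable_fun => //; exact: smooth_on_continuous (smooth_on_partial b sw).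
Qed.

Let L2pw b : L2 K (partial b w).
Proof.
split => //; rewrite /sq_norm2.
apply: le_lt_trans (integral_grad_kmean_le mG pt oK diamK clG nKG GB c1_gt0 reg_lo sphi b) _.
by rewrite -/gag gagE -EFinM ltry.
Qed.

Let pw_le b : \int[leb2]_(x in K) (partial b w x ^+ 2) <= Cg * g.
Proof.
rewrite -lee_fin fineK; last by apply: integrable_fin_num => //; exact: L2_integrable.
by rewrite EFinM -gagE; exact: (integral_grad_kmean_le mG pt oK diamK clG nKG GB c1_gt0 reg_lo sphi b).
Qed.

Variables (V : bool -> plane -> R) (VL2 : forall b, L2 K (V b)).
Hypothesis Vorth : forall psi, test_fun K psi ->
  \int[leb2]_(x in K) (\sum_(b : bool) V b x * partial b psi x) = 0.

Let mV b : measurable_fun (K : set P) (V b : P -> R). Proof. by have [] := VL2 b. Qed.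
Let V2 b : leb2.-integrable (K : set P) (fun x => (V b x ^+ 2)%:E). Proof. exact: L2_integrable. Qed.

Let iVL2 b (f : plane -> R) : L2 K f -> leb2.-integrable (K : set P) (fun x => (V b x * f x)%:E).
Proof. by move=> fL; apply: integrable_mul_L2 => //; [by case: fL|exact: L2_integrable]. Qed.

Let mpphi b : measurable_fun (K : set P) (partial b phi : P -> R).
Proof. by apply: smooth_measurable; exact: smooth_partial. Qed.

Let L2pphi b : L2 K (partial b phi). Proof. by apply: smooth_L2 => //; exact: smooth_partial. Qed.

(** Dominated convergence along [M = n.+1]. The term in which the cut-off is differentiated is at
    most [E1 * C * D / M], with [D < 2 * M] wherever it is nonzero, and it tends to zero pointwise.
    The other term tends to [expinv 0 2] times the gradient of [phi - w], and that constant is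
    divided out at the end. *)
Lemma orthogonal_kmean :
  \int[leb2]_(x in K) (\sum_(b : bool) V b x * partial b phi x) =
  \int[leb2]_(x in K) (\sum_(b : bool) V b x * partial b w x).
Proof.
have [C C0 HC] := dev_mul_partial_kmass_le mG pt oK diamK clG nKG GB KB C1_ge0 reg c1_gt0 reg_lo sphi.
have [E1 E10 HE1] := @expinv1_le R.
pose f_ n (x : P) := \sum_(b : bool) V b x * partial b (cutoff n.+1%:R) x.
pose f (x : P) := \sum_(b : bool) V b x * (expinv 0 2 * (partial b phi x - partial b w x)).
pose dom b (x : P) : R := `|V b x| * (E1 * (2 * C)) + (`|V b x * partial b phi x| + `|V b x * partial b w x|).
have tst n : test_fun K (cutoff n.+1%:R) by exact: test_fun_cutoff.
have mf_ n : measurable_fun (K : set P) (f_ n).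
  apply: measurable_sum => b; apply: measurable_funM => //.
  by apply: smooth_measurable; apply: smooth_partial; exact: test_fun_smooth (tst n).
have mf : measurable_fun (K : set P) f.
  apply: measurable_sum => b; apply: measurable_funM => //; apply: measurable_funM => //.
  exact: measurable_funB.
have idom b : leb2.-integrable (K : set P) (EFin \o dom b).
  have iV : leb2.-integrable (K : set P) (EFin \o V b) by exact: L2_integrable1.
  have i1 : leb2.-integrable (K : set P) (fun x => (`|V b x| * (E1 * (2 * C)))%:E).
    apply: (@eq_integrable _ _ _ _ _ mK (fun x => (E1 * (2 * C))%:E * `|(EFin \o V b) x|)%E).
      by move=> x _; rewrite /= -EFinM mulrC.
    by apply: integrableZl => //; exact: integrable_abse.
  have i2 : leb2.-integrable (K : set P) (fun x => `|(V b x * partial b phi x)%:E|%E).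
    exact/integrable_abse/iVL2/L2pphi.
  have i3 : leb2.-integrable (K : set P) (fun x => `|(V b x * partial b w x)%:E|%E).
    exact/integrable_abse/iVL2/L2pw.
  exact: (integrableD mK i1 (integrableD mK i2 i3)).
have ig : leb2.-integrable (K : set P) (EFin \o (fun x => dom true x + dom false x)).
  exact: (integrableD mK (idom true) (idom false)).
have bnd n x b : K x -> `|V b x * partial b (cutoff n.+1%:R) x| <= dom b x.
  move=> Kx; have Dx := D_gt0 Kx; rewrite partial_cutoff// mulrDr.
  set a := 2 - D x / n.+1%:R.
  apply: le_trans (ler_normD _ _) _; apply: lerD.
    rewrite normrM ler_wpM2l// (_ : _ * _ * _ = - (expinv 1 a / n.+1%:R * ((phi x - w x) * partial b D x))); last by ring.
    rewrite normrN normrM.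
    have H := HC x b Kx; rewrite -/w -/D in H.
    apply: (@le_trans _ _ (`|expinv 1 a / n.+1%:R| * (C * D x))); first by rewrite ler_wpM2l.
    have [a0|a0] := leP a 0; first by rewrite expinv_le0// mul0r normr0 mul0r !mulr_ge0.
    rewrite normrM (ger0_norm (_ : 0 <= n.+1%:R^-1)) ?invr_ge0// -mulrA ler_pM//.
      by rewrite !mulr_ge0// ?invr_ge0// ltW.
    rewrite mulrCA [leRHS]mulrC ler_wpM2l// mulrC ltW//.
    by move: a0; rewrite /a subr_gt0.
  rewrite mulrCA normrM (ger0_norm (expinv0_ge0 _)) mulrBr.
  apply: (@le_trans _ _ (1 * `|V b x * partial b phi x - V b x * partial b w x|)).
    by rewrite ler_wpM2r// expinv0_le1.
  by rewrite mul1r ler_normB.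
have bound n x : K x -> `|f_ n x| <= dom true x + dom false x.
  move=> Kx; rewrite /f_ big_bool; apply: le_trans (ler_normD _ _) _.
  by apply: lerD; exact: bnd.
have cv x : K x -> f_ n x @[n --> \oo] --> f x.
  move=> Kx.
  have invn : (n.+1%:R^-1 : R) @[n --> \oo] --> (0 : R).
    have := @cvg_harmonic R; exact.
  have ca : (2 - D x / n.+1%:R) @[n --> \oo] --> (2 : R).
    rewrite -[X in _ --> X]subr0 -(mulr0 (D x)).
    by apply: cvgB; [exact: cvg_cst|apply: cvgM; [exact: cvg_cst|exact: invn]].
  have ce k : expinv k (2 - D x / n.+1%:R) @[n --> \oo] --> expinv k 2.
    apply: continuous_cvg ca; apply: differentiable_continuous; apply/derivable1_diffP.
    exact: (@ex_derive _ _ _ _ _ _ _ (is_derive_expinv k _)).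
  rewrite (_ : (fun n => f_ n x) = fun n => V true x * partial true (cutoff n.+1%:R) x + V false x * partial false (cutoff n.+1%:R) x); last first.
    by apply/funext => n; rewrite /f_ big_bool.
  rewrite /f big_bool.
  have c1b b : partial b (cutoff n.+1%:R) x @[n --> \oo] --> expinv 0 2 * (partial b phi x - partial b w x).
    rewrite (_ : (fun n => _) = fun n => expinv 1 (2 - D x / n.+1%:R) * (- (partial b D x / n.+1%:R)) * (phi x - w x) +
      expinv 0 (2 - D x / n.+1%:R) * (partial b phi x - partial b w x)); last first.
      by apply/funext => n; rewrite partial_cutoff.
    rewrite -[X in _ --> X]add0r -(mul0r (phi x - w x)) -(mulr0 (expinv 1 2)) -oppr0 -(mulr0 (partial b D x)).
    apply: cvgD; apply: cvgM; try exact: cvg_cst; last exact: ce.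
    apply: cvgM; first exact: ce.
    by apply: cvgN; apply: cvgM; [exact: cvg_cst|exact: invn].
  by apply: cvgD; apply: cvgM; try exact: cvg_cst; exact: c1b.
have [if_ cvI] := Rintegral_dominated_cvg mK mf_ mf cv ig bound.
have f_0 n : \int[leb2]_(x in K) f_ n x = 0 by exact: Vorth.
have f0 : \int[leb2]_(x in K) f x = 0.
  move: cvI; rewrite (_ : (fun n => \int[leb2]_(x in K) f_ n x) = cst 0); last exact/funext.
  by move=> /(cvg_lim (@norm_hausdorff _ _)); rewrite lim_cst.
have isum (q : bool -> plane -> R) : (forall b, L2 K (q b)) ->
    leb2.-integrable (K : set P) (EFin \o (fun x => \sum_(b : bool) V b x * q b x)).
  move=> qL; have := integrableD mK (iVL2 true (qL true)) (iVL2 false (qL false)).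
  by apply: eq_integrable => // x _; rewrite /= big_bool.
have i1 := isum _ L2pphi; have i2 := isum _ L2pw.
apply/eqP; rewrite -subr_eq0 -RintegralB//.
have e0 : expinv 0 (2 : R) != 0 by rewrite gt_eqF// expinv0_gt0.
rewrite -(inj_eq (mulfI e0)) mulr0 -RintegralZl//; last exact: (integrableB mK i1 i2).
rewrite -[X in _ == X]f0; apply/eqP; rewrite /Rintegral; congr fine; apply: eq_integral => x _.
rewrite /f !big_bool /=; congr EFin.
move: (expinv 0 2) (V true x) (V false x) (partial true phi x) (partial false phi x)
  (partial true w x) (partial false w x) => e a b p q u v; ring.
Qed.

Lemma orthogonal_sqr_le :
  (\int[leb2]_(x in K) (\sum_(b : bool) V b x * partial b phi x)) ^+ 2 <=
  2 * (Cg * g) * \int[leb2]_(x in K) (\sum_(b : bool) V b x ^+ 2).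
Proof.
rewrite orthogonal_kmean.
have i b := iVL2 b (L2pw b).
have -> : \int[leb2]_(x in K) (\sum_(b : bool) V b x * partial b w x) =
   \int[leb2]_(x in K) (V true x * partial true w x) + \int[leb2]_(x in K) (V false x * partial false w x).
  rewrite -RintegralD; [|exact: mK|exact: i|exact: i]; rewrite /Rintegral; congr fine; apply: eq_integral => x _; by rewrite big_bool.
have -> : \int[leb2]_(x in K) (\sum_(b : bool) V b x ^+ 2) =
   \int[leb2]_(x in K) (V true x ^+ 2) + \int[leb2]_(x in K) (V false x ^+ 2).
  rewrite -RintegralD; [|exact: mK|exact: V2|exact: V2]; rewrite /Rintegral; congr fine; by apply: eq_integral => x _; rewrite big_bool.
have cs b : (\int[leb2]_(x in K) (V b x * partial b w x)) ^+ 2 <= (Cg * g) * \int[leb2]_(x in K) (V b x ^+ 2).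
  have w2 : leb2.-integrable (K : set P) (fun x => (partial b w x ^+ 2)%:E) by exact: L2_integrable.
  apply: le_trans (Rintegral_cauchy_schwarz mK (mV b) (mpw b) (V2 b) w2) _.
  rewrite mulrC ler_wpM2r//; apply: Rintegral_ge0 => x _; exact: sqr_ge0.
have alg (k p q u v : R) : p ^+ 2 <= k * u -> q ^+ 2 <= k * v -> (p + q) ^+ 2 <= 2 * k * (u + v).
  by have := sqr_ge0 (p - q); nra.
exact: (alg _ _ _ _ _ (cs true) (cs false)).
Qed.

End Orthogonality.

Section TwoAdd.
Context d (T : measurableType d) (R : realType) (mu : {measure set T -> \bar R}).

Lemma ge0_integral_two_add (D : set T) (f g : T -> \bar R) : measurable D ->
  measurable_fun D f -> (forall x, 0 <= f x)%E -> measurable_fun D g -> (forall x, 0 <= g x)%E ->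
  (\int[mu]_(x in D) (2%:E * f x + 2%:E * g x) =
   2%:E * \int[mu]_(x in D) f x + 2%:E * \int[mu]_(x in D) g x)%E.
Proof.
move=> mD mf f0 mg g0.
rewrite ge0_integralD//; [|by move=> s _; rewrite mule_ge0|exact: measurable_funeM
  |by move=> s _; rewrite mule_ge0|exact: measurable_funeM].
by rewrite !ge0_integralZl.
Qed.

End TwoAdd.

(** * Passing to the trace *)

Section KernelEnergy.
Context d (T : measurableType d) (R : realType) (mu : {finite_measure set T -> \bar R}).
Variables (q : T -> T -> R) (mq : measurable_fun setT (fun p : T * T => q p.1 p.2)).
Hypothesis q0 : forall t s, 0 <= q t s.
Implicit Types (u v : T -> R).

(** The kernel is left abstract to cover both the Gagliardo kernel and its bounded
    regularisations. *)
Definition energy u : \bar R := (\int[mu]_t \int[mu]_s ((u t - u s) ^+ 2 * q t s)%:E)%E.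

Lemma measurable_energy_integrand u : measurable_fun setT u ->
  measurable_fun setT (fun p : T * T => ((u p.1 - u p.2) ^+ 2 * q p.1 p.2)%:E).
Proof.
move=> mu'; apply/measurable_EFinP; apply: measurable_funM => //.
apply: measurable_funX; apply: measurable_funB.
  exact: (measurableT_comp mu' measurable_fst).
exact: (measurableT_comp mu' measurable_snd).
Qed.

Lemma energy_integrand_ge0 u t s : (0 <= ((u t - u s) ^+ 2 * q t s)%:E)%E.
Proof. by rewrite lee_fin mulr_ge0// sqr_ge0. Qed.

Lemma integral2_add (f g : T -> T -> \bar R) (a b : R) : 0 <= a -> 0 <= b ->
  measurable_fun setT (fun p : T * T => f p.1 p.2) -> measurable_fun setT (fun p : T * T => g p.1 p.2) ->
  (forall t s, 0 <= f t s)%E -> (forall t s, 0 <= g t s)%E ->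
  (\int[mu]_t \int[mu]_s (a%:E * f t s + b%:E * g t s) =
   a%:E * \int[mu]_t \int[mu]_s f t s + b%:E * \int[mu]_t \int[mu]_s g t s)%E.
Proof.
move=> a0 b0 mf mg f0 g0.
have mfs t : measurable_fun setT (f t) by exact: (measurableT_comp mf (measurable_pair1 t)).
have mgs t : measurable_fun setT (g t) by exact: (measurableT_comp mg (measurable_pair1 t)).
have mIf : measurable_fun setT (fun t => \int[mu]_s f t s)%E.
  exact: (measurable_fun_integral_setX mu measurableT mf (fun p => f0 _ _)).
have mIg : measurable_fun setT (fun t => \int[mu]_s g t s)%E.
  exact: (measurable_fun_integral_setX mu measurableT mg (fun p => g0 _ _)).
have If0 t : (0 <= \int[mu]_s f t s)%E by exact: integral_ge0.
have Ig0 t : (0 <= \int[mu]_s g t s)%E by exact: integral_ge0.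
transitivity (\int[mu]_t (a%:E * \int[mu]_s f t s + b%:E * \int[mu]_s g t s))%E.
  apply: eq_integral => t _.
  rewrite ge0_integralD//; [|by move=> s _; rewrite mule_ge0|exact: measurable_funeM
    |by move=> s _; rewrite mule_ge0|exact: measurable_funeM].
  by rewrite !ge0_integralZl.
rewrite ge0_integralD//; [|by move=> s _; rewrite mule_ge0|exact: measurable_funeM
  |by move=> s _; rewrite mule_ge0|exact: measurable_funeM].
by rewrite !ge0_integralZl.
Qed.

Lemma energy_triangle u v : measurable_fun setT u -> measurable_fun setT v ->
  (energy u <= 2%:E * energy v + 2%:E * energy (fun t => (u t - v t)%R))%E.
Proof.
move=> mu' mv.
have muv : measurable_fun setT (fun t => u t - v t) by exact: measurable_funB.
rewrite /energy -(@integral2_add (fun t s => ((v t - v s) ^+ 2 * q t s)%:E)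
  (fun t s => ((u t - v t - (u s - v s)) ^+ 2 * q t s)%:E) 2 2) //; first last.
- by move=> t s; exact: (energy_integrand_ge0 (fun t => u t - v t)).
- by move=> t s; exact: energy_integrand_ge0.
- exact: (measurable_energy_integrand muv).
- exact: (measurable_energy_integrand mv).
apply: ge0_integral_mono => t _.
  by apply: integral_ge0 => s _; exact: energy_integrand_ge0.
apply: ge0_integral_mono => s _; first exact: energy_integrand_ge0.
rewrite -!EFinM -EFinD lee_fin !mulrA -mulrDl ler_wpM2r//.
have := sqr_ge0 ((v t - v s) - (u t - v t - (u s - v s))); nra.
Qed.

Lemma energyN u : energy (fun t => - u t) = energy u.
Proof.
apply: eq_integral => t _; apply: eq_integral => s _; congr EFin; congr (_ * _).
by rewrite -opprD sqrrN.
Qed.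

Lemma energy_L2_le u (M : R) : (forall t s, q t s <= M) -> measurable_fun setT u ->
  (energy u <= (4 * M)%:E * (mu setT * \int[mu]_t ((u t) ^+ 2)%:E))%E.
Proof.
move=> qM mu'.
have mu2 : measurable_fun setT (fun p : T * T => (u p.1 ^+ 2)%:E).
  apply/measurable_EFinP; apply: measurable_funX; exact: (measurableT_comp mu' measurable_fst).
have u20 (t s : T) : (0 <= (u t ^+ 2)%:E)%E by rewrite lee_fin sqr_ge0.
(* An empty [T] is set apart because the sign of [M] is read off at a point. *)
have [pt|] := pselect (exists t : T, True); last first.
  move=> nT; rewrite /energy integral0_eq//; last by move=> t; exfalso; apply: nT; exists t.
  rewrite [X in (_ * (_ * X))%E]integral0_eq; last by move=> t; exfalso; apply: nT; exists t.
  by rewrite !mule0.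
have M0 : 0 <= M by have [t _] := pt; exact: le_trans (q0 t t) (qM t t).
apply: (@le_trans _ _ (\int[mu]_t \int[mu]_s (M%:E * (2%:E * (u t ^+ 2)%:E + 2%:E * (u s ^+ 2)%:E)))%E).
  apply: ge0_integral_mono => t _.
    by apply: integral_ge0 => s _; exact: energy_integrand_ge0.
  apply: ge0_integral_mono => s _; first exact: energy_integrand_ge0.
  rewrite (_ : (M%:E * _)%E = (M * (2 * u t ^+ 2 + 2 * u s ^+ 2))%:E); last first.
    by rewrite EFinM EFinD !EFinM.
  rewrite lee_fin mulrC.
  apply: ler_pM => //; first exact: sqr_ge0.
  have := sqr_ge0 (u t + u s); nra.
have := integral_symmetrize mu mu2 u20.
pose H (t s : T) := (2%:E * (u t ^+ 2)%:E + 2%:E * (u s ^+ 2)%:E)%E.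
have mu2' : measurable_fun setT (fun p : T * T => (u p.2 ^+ 2)%:E).
  apply/measurable_EFinP; apply: measurable_funX; exact: (measurableT_comp mu' measurable_snd).
have mH : measurable_fun setT (fun p : T * T => H p.1 p.2).
  by apply: emeasurable_funD; exact: measurable_funeM.
have H0 t s : (0 <= H t s)%E.
  by apply: adde_ge0; apply: mule_ge0; rewrite ?lee_fin ?sqr_ge0.
have E : (\int[mu]_t \int[mu]_s (M%:E * H t s + 0%:E * H t s) = M%:E * \int[mu]_t \int[mu]_s H t s)%E.
  by rewrite integral2_add// mul0e adde0.
have -> : (\int[mu]_t \int[mu]_s (M%:E * H t s) = M%:E * \int[mu]_t \int[mu]_s H t s)%E.
  by rewrite -E; apply: eq_integral => t _; apply: eq_integral => s _; rewrite mul0e adde0.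
rewrite /H => ->; rewrite muleA -EFinM (mulrC M); apply: lee_wpmul2l; first by rewrite lee_fin mulr_ge0.
have -> : (\int[mu]_t \int[mu]_s (u t ^+ 2)%:E = \int[mu]_t (mu setT * (u t ^+ 2)%:E))%E.
  by apply: eq_integral => t _; rewrite integral_cst// muleC.
have mut : measurable_fun setT (fun t => (u t ^+ 2)%:E) by apply/measurable_EFinP; exact: measurable_funX.
rewrite ge0_integralZl; [exact: lexx|exact: measurableT|exact: mut|by move=> t _; exact: (u20 t t)|exact: measure_ge0].
Qed.

End KernelEnergy.

(** * The Gagliardo kernel as a monotone limit of bounded kernels *)

Section GagliardoLimit.
Context {R : realType}.
Local Notation plane := (R * R)%type.
Local Notation P := (measurableTypeR R * measurableTypeR R)%type.
Local Notation edist := Defs.edist.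
Context d (T : measurableType d) (mu : {finite_measure set T -> \bar R}).
Variables (G : T -> plane) (mG : measurable_fun setT (G : T -> P)).

Definition gagk (t s : T) : R := (edist (G t) (G s) ^+ 2)^-1.
(* A bounded kernel, for which the energy passes to L2 limits; the limit in [k]
   is then taken by monotone convergence. *)
Definition gagk_reg (k : nat) (t s : T) : R := (edist (G t) (G s) ^+ 2 + k.+1%:R^-1)^-1.

Lemma measurable_GG : measurable_fun setT (fun p : T * T => edist (G p.1) (G p.2)).
Proof.
by apply: measurable_edist; [exact: (measurableT_comp mG measurable_fst)|exact: (measurableT_comp mG measurable_snd)].
Qed.

Lemma measurable_gagk : measurable_fun setT (fun p : T * T => gagk p.1 p.2).
Proof. by apply: measurable_inv; apply: measurable_funX; exact: measurable_GG. Qed.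

Lemma measurable_gagk_reg k : measurable_fun setT (fun p : T * T => gagk_reg k p.1 p.2).
Proof.
apply: measurable_inv; apply: measurable_funD; last exact: measurable_cst.
by apply: measurable_funX; exact: measurable_GG.
Qed.

Lemma gagk_ge0 t s : 0 <= gagk t s. Proof. by rewrite invr_ge0 sqr_ge0. Qed.

Lemma gagk_reg_ge0 k t s : 0 <= gagk_reg k t s.
Proof. by rewrite invr_ge0 addr_ge0 ?sqr_ge0// invr_ge0. Qed.

Lemma gagk_reg_le k t s : gagk_reg k t s <= k.+1%:R.
Proof.
rewrite -[leRHS]invrK lef_pV2 ?posrE ?invr_gt0//; first by rewrite lerDr sqr_ge0.
by rewrite ltr_wpDl ?sqr_ge0// invr_gt0.
Qed.

Lemma gagliardo_energy (u : plane -> R) : gagliardo mu G u = energy mu gagk (u \o G).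
Proof. by []. Qed.

Lemma energy_reg_le k (u : plane -> R) : (energy mu (gagk_reg k) (u \o G) <= gagliardo mu G u)%E.
Proof.
apply: ge0_integral_mono => t _.
  by apply: integral_ge0 => s _; rewrite lee_fin mulr_ge0 ?sqr_ge0 ?gagk_reg_ge0.
apply: ge0_integral_mono => s _; first by rewrite lee_fin mulr_ge0 ?sqr_ge0 ?gagk_reg_ge0.
rewrite lee_fin; have := edist_ge0 (G t) (G s); rewrite le_eqVlt => /predU1P[d0|d0].
  by rewrite /= (edist_eq0 (esym d0)) subrr expr0n/= !mul0r.
rewrite ler_wpM2l ?sqr_ge0// lef_pV2 ?posrE ?exprn_gt0//.
  by rewrite lerDl invr_ge0.
by rewrite ltr_wpDr ?exprn_gt0// invr_ge0.
Qed.

(** The regularised kernels increase to [gagk] where [G t] and [G s] differ; where they coincide the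
    squared difference is zero. Monotone convergence is applied to the inner and then to the outer
    integral. *)
Lemma gagliardo_le_lim (u : plane -> R) (M : \bar R) : measurable_fun setT (u \o G) ->
  (forall k, energy mu (gagk_reg k) (u \o G) <= M)%E -> (gagliardo mu G u <= M)%E.
Proof.
move=> mu' HM.
pose F k t s : \bar R := ((u (G t) - u (G s)) ^+ 2 * gagk_reg k t s)%:E.
have F0 k t s : (0 <= F k t s)%E by exact: (energy_integrand_ge0 (gagk_reg_ge0 k) (u \o G)).
have mF k : measurable_fun setT (fun p : T * T => F k p.1 p.2).
  exact: (measurable_energy_integrand (measurable_gagk_reg k) mu').
have mFs k t : measurable_fun setT (F k t) by exact: (measurableT_comp (mF k) (measurable_pair1 t)).
have mIF k : measurable_fun setT (fun t => \int[mu]_s F k t s)%E.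
  exact: (measurable_fun_integral_setX mu measurableT (mF k) (fun p => F0 k _ _)).
have Fnd t s : {homo (fun k => F k t s) : m n / (m <= n)%N >-> (m <= n)%E}.
  move=> m n mn; rewrite lee_fin ler_wpM2l ?sqr_ge0// lef_pV2 ?posrE.
  - by rewrite lerD2l lef_pV2 ?posrE// ler_nat.
  - by rewrite ltr_wpDl ?sqr_ge0// invr_gt0.
  - by rewrite ltr_wpDl ?sqr_ge0// invr_gt0.
have Fcv t s : F k t s @[k --> \oo] --> ((u (G t) - u (G s)) ^+ 2 * gagk t s)%:E.
  apply/fine_cvgP; split; first exact: nearW.
  have := edist_ge0 (G t) (G s); rewrite le_eqVlt => /predU1P[d0|d0].
    rewrite (_ : fine \o _ = cst 0); last first.
      by apply/funext => k; rewrite /= (edist_eq0 (esym d0)) subrr expr0n/= mul0r.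
    by rewrite (edist_eq0 (esym d0)) subrr expr0n/= mul0r; exact: cvg_cst.
  apply: cvgM; first exact: cvg_cst.
  rewrite /gagk -[edist _ _ ^+ 2]addr0; apply: cvgV; first by rewrite addr0 gt_eqF// exprn_gt0.
  by apply: cvgD; [exact: cvg_cst|exact: (@cvg_harmonic R)].
have inner t : (\int[mu]_s F k t s)%E @[k --> \oo] --> (\int[mu]_s ((u (G t) - u (G s)) ^+ 2 * gagk t s)%:E)%E.
  have := cvg_monotone_convergence (mu := mu) measurableT (fun k => mFs k t) (fun k s _ => F0 k t s)
    (fun s _ => Fnd t s).
  rewrite (_ : (\int[mu]_x (limn (fun k => F k t x)) = \int[mu]_s ((u (G t) - u (G s)) ^+ 2 * gagk t s)%:E)%E)//.
  by apply: eq_integral => s _; apply/cvg_lim => //; exact: Fcv.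
have outer : (\int[mu]_t \int[mu]_s F k t s)%E @[k --> \oo] --> gagliardo mu G u.
  have nd t : {homo (fun k => \int[mu]_s F k t s)%E : m n / (m <= n)%N >-> (m <= n)%E}.
    by move=> m n mn; apply: ge0_integral_mono => s _ //; exact: Fnd.
  have := cvg_monotone_convergence (mu := mu) measurableT mIF (fun k t _ => integral_ge0 _ (fun s _ => F0 k t s))
    (fun t _ => nd t).
  rewrite (_ : (\int[mu]_x (limn (fun k => \int[mu]_s F k x s)) = gagliardo mu G u)%E)//.
  by apply: eq_integral => t _; apply/cvg_lim => //; exact: inner.
have cv := cvg_lim (@ereal_hausdorff R) outer.
rewrite -cv; apply: lime_le; first by apply/cvg_ex; exists (gagliardo mu G u).
by apply: nearW => k; exact: HM.
Qed.

End GagliardoLimit.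

(** * Energy estimates for the trace by approximation *)

Section TraceEquivalence.
Context {R : realType}.
Local Notation plane := (R * R)%type.
Local Notation P := (measurableTypeR R * measurableTypeR R)%type.
Local Notation leb2 := (@lebesgue_measure R \x @lebesgue_measure R)%E.
Local Notation edist := Defs.edist.

Lemma smooth_sub (f g : plane -> R) : smooth f -> smooth g -> smooth (fun x => f x - g x).
Proof.
move=> /smooth_onT sf /smooth_onT sg; apply/smooth_onT => n.
apply: (@eq_smooth_upto _ _ _ (fun x => f x + (-1) * g x)); first exact: openT.
  by move=> x _; rewrite mulN1r.
apply: (smooth_upto_add openT (sf n)); apply: (smooth_upto_mul openT _ (sg n)).
exact: smooth_upto_cst.
Qed.

Lemma partial_sub (f g : plane -> R) b x : smooth f -> smooth g ->
  partial b (fun x => f x - g x) x = partial b f x - partial b g x.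
Proof.
move=> sf sg; rewrite /partial; apply: deriveB; apply: diff_derivable.
  exact: (sf [::]).
exact: (sg [::]).
Qed.

Lemma sqr_add_le (a b X Y e : R) : a ^+ 2 <= X * e -> b ^+ 2 <= Y * e ->
  (a + b) ^+ 2 <= 2 * (e * (X + Y)).
Proof. by have := sqr_ge0 (a - b); nra. Qed.

Lemma sqr_sub_le (a b X Y : R) : a ^+ 2 <= X -> b ^+ 2 <= Y -> (a - b) ^+ 2 <= 2 * X + 2 * Y.
Proof. by have := sqr_ge0 (a + b); nra. Qed.

Lemma cvg0_small (f g : nat -> \bar R) (e : R) :
  f n @[n --> \oo] --> 0%E -> g n @[n --> \oo] --> 0%E -> 0 < e ->
  exists n, (f n <= e%:E)%E /\ (g n <= e%:E)%E.
Proof.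
have small (u : nat -> \bar R) : u n @[n --> \oo] --> 0%E -> 0 < e -> \forall n \near \oo, (u n <= e%:E)%E.
  move=> /fine_cvgP[fin cv] e0.
  have lt : \forall n \near \oo, fine (u n) < e by exact: (cvgr_lt _ cv).
  by near=> n; rewrite -[u n]fineK ?lee_fin; [apply: ltW; near: n|near: n].
move=> cf cg e0; have [n _ Hn] : \forall n \near \oo, (f n <= e%:E)%E /\ (g n <= e%:E)%E.
  by near=> n; split; near: n; exact: small.
by exists n; apply: Hn => /=.
Unshelve. all: by end_near.
Qed.

Context d (T : measurableType d) (mu : {finite_measure set T -> \bar R}).
Variables (G : T -> plane) (mG : measurable_fun setT (G : T -> P)) (pt : T).
Variables (K : set plane) (z : plane) (r h c1 C1 B : R).
Hypotheses (oK : open K) (bK : bounded_set K).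
Hypotheses (r0 : 0 < r) (rh : r <= 2 * h) (star : star_shaped_ball K z r).
Hypothesis diamK : forall x y, K x -> K y -> edist x y <= h.
Hypotheses (clG : forall t, closure K (G t)) (nKG : forall t, ~ K (G t)).
Hypothesis frG : forall x, closure K x -> ~ K x -> exists t, x = G t.
Hypotheses (GB : forall t, `|G t| <= B) (KB : forall x, K x -> `|x| <= B).
Hypothesis C1_ge0 : 0 <= C1.
Hypothesis reg : forall x s, 0 < s -> (mu [set t | (edist x (G t) < s)%R] <= (C1 * s)%:E)%E.
Hypothesis c1_gt0 : 0 < c1.
Hypothesis reg_lo : forall t0 s, 0 < s <= h ->
  ((c1 * s)%:E <= mu [set t | (edist (G t0) (G t) < s)%R])%E.
Variables (V : bool -> plane -> R) (VL2 : forall b, L2 K (V b)).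
Hypothesis Vorth : forall psi, test_fun K psi ->
  \int[leb2]_(x in K) (\sum_(b : bool) V b x * partial b psi x) = 0.
Variables (u : plane -> R) (muG : measurable_fun setT (u \o G)).
Variables (phi : nat -> plane -> R) (sphi : forall n, smooth (phi n)).
Hypothesis grad_cvg :
  (\int[leb2]_(x in K) (\sum_(b : bool) (partial b (phi n) x - V b x) ^+ 2)%R%:E)%E
    @[n --> \oo] --> 0%E.
Hypothesis bd_cvg : (\int[mu]_t ((phi n (G t) - u (G t)) ^+ 2)%R%:E)%E @[n --> \oo] --> 0%E.

Let CA := 2 ^+ 6 * (512 * h ^+ 2 * C1 / r) * (48 * C1 * h ^+ 6 / r ^+ 5) / r ^+ 2.
Let CB := 2 * (16 * (16 / c1) ^+ 2 * 2 ^+ 10).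

Let h0 : 0 < h. Proof. by have := lt_le_trans r0 rh; lra. Qed.

Let CA0 : 0 <= CA.
Proof.
apply: divr_ge0 (sqr_ge0 _); apply: mulr_ge0.
  apply: mulr_ge0 (exprn_ge0 _ (ler0n _ 2)) _; apply: divr_ge0 (ltW r0).
  by apply: mulr_ge0 C1_ge0; apply: mulr_ge0 (ler0n _ _) (sqr_ge0 _).
apply: divr_ge0 (exprn_ge0 _ (ltW r0)); apply: mulr_ge0 (exprn_ge0 _ (ltW h0)).
exact: mulr_ge0 (ler0n _ _) C1_ge0.
Qed.

Let mK : measurable (K : set P). Proof. exact: open_plane_measurable. Qed.
Let mV b : measurable_fun (K : set P) (V b : P -> R). Proof. by have [] := VL2 b. Qed.
Let V2 b : leb2.-integrable (K : set P) (fun x => (V b x ^+ 2)%:E). Proof. exact: L2_integrable. Qed.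
Let mpphi n b : measurable_fun (K : set P) (partial b (phi n) : P -> R).
Proof. by apply: smooth_measurable; exact: smooth_partial. Qed.

Let err n : \bar R := (\int[leb2]_(x in K) (\sum_(b : bool) (partial b (phi n) x - V b x) ^+ 2)%R%:E)%E.
Let berr n : \bar R := (\int[mu]_t ((phi n (G t) - u (G t)) ^+ 2)%R%:E)%E.
Let N := \int[leb2]_(x in K) (\sum_(b : bool) V b x ^+ 2).

Let err_ge0 n : (0 <= err n)%E.
Proof. by apply: integral_ge0 => x _; rewrite lee_fin sumr_ge0// => b _; exact: sqr_ge0. Qed.

Let mphiG n : measurable_fun setT (phi n \o G).
Proof.
have mphi : measurable_fun setT (phi n : P -> R) by exact: smooth_measurable.
exact: (measurableT_comp mphi mG).
Qed.

Let partA (f : plane -> R) : smooth f ->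
  (gagliardo mu G f <= CA%:E * \int[leb2]_(x in K) (grad_sq f x)%:E)%E.
Proof. by move=> sf; exact: (gagliardo_le_grad mG oK r0 rh star diamK clG nKG C1_ge0 reg sf). Qed.

Let merr n : measurable_fun (K : set P) (fun x => (\sum_(b : bool) (partial b (phi n) x - V b x) ^+ 2)%:E).
Proof.
apply/measurable_EFinP; apply: measurable_sum => b; apply: measurable_funX.
exact: measurable_funB.
Qed.

Let err_integrand_ge0 n x : (0 <= (\sum_(b : bool) (partial b (phi n) x - V b x) ^+ 2)%:E)%E.
Proof. by rewrite lee_fin sumr_ge0// => b _; exact: sqr_ge0. Qed.

Let grad_diff_le n m : (\int[leb2]_(x in K) (grad_sq (fun x => phi n x - phi m x) x)%:E <=
   2%:E * err n + 2%:E * err m)%E.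
Proof.
rewrite /err -(ge0_integral_two_add _ mK (merr n) (err_integrand_ge0 n) (merr m) (err_integrand_ge0 m)).
apply: ge0_integral_mono => x _; first by rewrite lee_fin grad_sq_ge0.
rewrite -!EFinM -EFinD lee_fin grad_sqE !big_bool !partial_sub//=.
move: (partial true (phi n) x) (partial true (phi m) x) (partial false (phi n) x)
  (partial false (phi m) x) (V true x) (V false x) => a a' b b' c c'.
have := sqr_ge0 (a - c + (a' - c)); have := sqr_ge0 (b - c' + (b' - c')); nra.
Qed.

Let NE : (\int[leb2]_(x in K) (\sum_(b : bool) V b x ^+ 2)%:E = N%:E)%E.
Proof.
rewrite fineK//; apply: integrable_fin_num => //.
have := integrableD mK (V2 true) (V2 false); apply: eq_integrable => // x _.
by rewrite /= big_bool.
Qed.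

Let grad_le n : (\int[leb2]_(x in K) (grad_sq (phi n) x)%:E <= 2%:E * N%:E + 2%:E * err n)%E.
Proof.
have mVV : measurable_fun (K : set P) (fun x => (\sum_(b : bool) V b x ^+ 2)%:E).
  by apply/measurable_EFinP; apply: measurable_sum => b; exact: measurable_funX.
have VV0 x : (0 <= (\sum_(b : bool) V b x ^+ 2)%:E)%E.
  by rewrite lee_fin sumr_ge0// => b _; exact: sqr_ge0.
rewrite /err -NE -(ge0_integral_two_add _ mK mVV VV0 (merr n) (err_integrand_ge0 n)).
apply: ge0_integral_mono => x _; first by rewrite lee_fin grad_sq_ge0.
rewrite -!EFinM -EFinD lee_fin grad_sqE !big_bool /=.
move: (partial true (phi n) x) (partial false (phi n) x) (V true x) (V false x) => a b c c'.
have := sqr_ge0 (c - (a - c)); have := sqr_ge0 (c' - (b - c')); nra.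
Qed.

(** The trace inequality is known for smooth functions and [u] is not one, so the difference is
    split through [phi m] for a large [m]. The smooth part [phi n - phi m] is covered by the
    inequality; [phi m - u] is small in L2 only, which controls its energy for a bounded kernel.
    Hence the regularised kernel is fixed before [m] is chosen. *)
Lemma gagliardo_err_le n : (gagliardo mu G (fun x => (phi n x - u x)%R) <= (4 * CA)%:E * err n)%E.
Proof.
have mdiff k : measurable_fun setT ((fun x => phi k x - u x) \o G) by exact: (measurable_funB (mphiG k) muG).
apply: gagliardo_le_lim => // k.
have [M M0 muT] : exists2 M : R, 0 <= M & mu setT = M%:E.
  exists (fine (mu setT)); first by rewrite fine_ge0.
  by rewrite fineK// fin_num_measure.
have kR : 0 <= (k.+1%:R : R) by [].
(* The coefficient of [ep] in the final bound, when both errors at [m] are at most [ep]. *)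
pose c := 2 * (CA * 2) + 2 * (4 * k.+1%:R * M).
have c_ge0 : 0 <= c.
  by apply: addr_ge0; apply: mulr_ge0 => //; apply: mulr_ge0 => //; exact: mulr_ge0.
apply/lee_addgt0Pr => eps eps0.
have cp : 0 < c + 1 by rewrite ltr_wpDl.
have [m [em bm]] := cvg0_small grad_cvg bd_cvg (divr_gt0 eps0 cp).
set ep := eps / (c + 1) in em bm.
apply: le_trans (energy_triangle mu (measurable_gagk_reg mG k) (gagk_reg_ge0 G k)
  (mdiff n) (v := (fun x => phi n x - phi m x) \o G) _) _.
  by apply: measurable_funB; exact: mphiG.
have b1 : (energy mu (gagk_reg G k) ((fun x => (phi n x - phi m x)%R) \o G) <=
    CA%:E * (2%:E * err n + 2%:E * ep%:E))%E.
  apply: le_trans (energy_reg_le mu G k (fun x => (phi n x - phi m x)%R)) _.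
  apply: le_trans (partA (smooth_sub (sphi n) (sphi m))) _.
  apply: lee_wpmul2l; first by rewrite lee_fin.
  by apply: le_trans (grad_diff_le n m) _; apply: leeD => //; apply: lee_wpmul2l.
have b2 : (energy mu (gagk_reg G k) (fun t => (((fun x => phi n x - u x) \o G) t -
      ((fun x => phi n x - phi m x) \o G) t)%R) <= (4 * k.+1%:R)%:E * (M%:E * ep%:E))%E.
  rewrite (_ : (fun t => _) = (fun x => phi m x - u x) \o G); last first.
    by apply/funext => t /=; ring.
  have H2 := energy_L2_le mu (gagk_reg_ge0 G k) (gagk_reg_le G k) (mdiff m).
  apply: (le_trans H2).
  rewrite muT; apply: lee_wpmul2l; first by rewrite lee_fin mulr_ge0.
  by apply: lee_wpmul2l; [rewrite lee_fin|exact: bm].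
apply: le_trans (leeD (lee_wpmul2l _ b1) (lee_wpmul2l _ b2)) _ => //.
have -> : (2%:E * (CA%:E * (2%:E * err n + 2%:E * ep%:E)) + 2%:E * ((4 * k.+1%:R)%:E * (M%:E * ep%:E)) =
   (4 * CA)%:E * err n + (c * ep)%:E)%E.
  rewrite ge0_muleDr ?mule_ge0 ?lee_fin//; last by rewrite divr_ge0 ?(ltW eps0)// ltW.
  rewrite ge0_muleDr ?mule_ge0 ?lee_fin//; last by rewrite divr_ge0 ?(ltW eps0)// ltW.
  rewrite -addeA; congr (_ + _)%E.
    by rewrite !muleA -!EFinM; congr (_%:E * _)%E; ring.
  by rewrite -!EFinM -EFinD; congr EFin; rewrite /c; ring.
rewrite leeD2l// lee_fin /ep mulrA ler_pdivrMr// mulrC ler_wpM2l ?(ltW eps0)//.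
by rewrite lerDl.
Qed.

Lemma gagliardo_trace_le : (gagliardo mu G u <= (4 * CA * N)%:E)%E.
Proof.
apply/lee_addgt0Pr => eps eps0.
(* [12 * CA] collects [4 * CA] from the energy of [phi m] and [8 * CA] from that of [phi m - u]. *)
have cp : 0 < 12 * CA + 1 by rewrite ltr_wpDl// mulr_ge0.
have [m [em _]] := cvg0_small grad_cvg bd_cvg (divr_gt0 eps0 cp).
set ep := eps / (12 * CA + 1) in em.
have mdiff : measurable_fun setT ((fun x => phi m x - u x) \o G) by exact: (measurable_funB (mphiG m) muG).
have E0 v : (0 <= gagliardo mu G v)%E.
  by apply: integral_ge0 => t _; apply: integral_ge0 => s _; rewrite lee_fin divr_ge0 ?sqr_ge0.
have ep0 : 0 <= ep by rewrite divr_ge0 ?(ltW eps0)// ltW.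
have := energy_triangle mu (measurable_gagk mG) (gagk_ge0 G) muG (mphiG m).
rewrite -gagliardo_energy => H; apply: le_trans H _.
rewrite -gagliardo_energy (_ : (fun t => _) = fun t => - ((fun x => phi m x - u x) \o G) t); last first.
  by apply/funext => t /=; rewrite opprB.
rewrite energyN -gagliardo_energy.
have b1 : (gagliardo mu G (phi m) <= CA%:E * (2%:E * N%:E + 2%:E * ep%:E))%E.
  apply: le_trans (partA (sphi m)) _; apply: lee_wpmul2l; first by rewrite lee_fin.
  by apply: le_trans (grad_le m) _; apply: leeD => //; apply: lee_wpmul2l.
have b2 : (gagliardo mu G (fun x => (phi m x - u x)%R) <= (4 * CA)%:E * ep%:E)%E.
  apply: le_trans (gagliardo_err_le m) _; apply: lee_wpmul2l => //.
  by rewrite lee_fin mulr_ge0.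
apply: le_trans (leeD (lee_wpmul2l _ b1) (lee_wpmul2l _ b2)) _ => //.
have -> : (2%:E * (CA%:E * (2%:E * N%:E + 2%:E * ep%:E)) + 2%:E * ((4 * CA)%:E * ep%:E) =
    (4 * CA * N + 12 * CA * ep)%:E)%E.
  rewrite (_ : 4 * CA * N + 12 * CA * ep = 2 * (CA * (2 * N + 2 * ep)) + 2 * ((4 * CA) * ep)); last by ring.
  by rewrite [in RHS]EFinD (EFinM 2) (EFinM CA) EFinD !EFinM.
rewrite -EFinD lee_fin.
have : (12 * CA) * ep <= eps.
  rewrite /ep mulrA ler_pdivrMr// mulrC ler_wpM2l ?(ltW eps0)//; by rewrite lerDl.
by move=> H'; rewrite lerD2l.
Qed.

Let CB0 : 0 <= CB.
Proof.
apply: mulr_ge0 (ler0n _ 2) _; apply: mulr_ge0 (exprn_ge0 _ (ler0n _ 2)).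
exact: mulr_ge0 (ler0n _ _) (sqr_ge0 _).
Qed.

Let N0 : 0 <= N.
Proof. by apply: Rintegral_ge0 => x _; apply: sumr_ge0 => b _; exact: sqr_ge0. Qed.

(** [N] is the integral of [V . grad (phi m)] minus that of [V . (grad (phi m) - V)]. Orthogonality
    bounds the square of the first by [N] times the energy of [phi m], Cauchy-Schwarz the square of
    the second by [N] times a small error. Dividing [N^2] by [N] and letting the error vanish gives
    the claim. The upper bound on the energy of [u] comes in beforehand, to make it a real
    number. *)
Lemma grad_le_gagliardo_trace : (N%:E <= (4 * CB)%:E * gagliardo mu G u)%E.
Proof.
have gfin : gagliardo mu G u \is a fin_num.
  apply/fin_numPlt; rewrite (lt_le_trans (ltNyr 0))/=; last first.
    by apply: integral_ge0 => t _; apply: integral_ge0 => s _; rewrite lee_fin divr_ge0 ?sqr_ge0.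
  by apply: le_lt_trans gagliardo_trace_le _; rewrite ltry.
set g := fine (gagliardo mu G u).
have gE : gagliardo mu G u = g%:E by rewrite fineK.
rewrite gE -EFinM lee_fin.
have step eps : 0 < eps -> N ^+ 2 <= (4 * CB * g + (16 * CB * CA + 4) * eps) * N.
  move=> eps0; have [m [em _]] := cvg0_small grad_cvg bd_cvg eps0.
  have gm_le : (gagliardo mu G (phi m) <= (2 * g + 8 * CA * eps)%:E)%E.
    have := energy_triangle mu (measurable_gagk mG) (gagk_ge0 G) (mphiG m) muG.
    rewrite -gagliardo_energy => H; apply: le_trans H _; rewrite -gagliardo_energy gE.
    rewrite (_ : energy _ _ _ = gagliardo mu G (fun x => (phi m x - u x)%R))//.
    have b2 : (gagliardo mu G (fun x => (phi m x - u x)%R) <= (4 * CA)%:E * eps%:E)%E.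
      apply: le_trans (gagliardo_err_le m) _; apply: lee_wpmul2l => //.
      by rewrite lee_fin mulr_ge0.
    apply: le_trans (leeD2l _ (lee_wpmul2l _ b2)) _ => //.
    by rewrite -!EFinM -EFinD lee_fin le_eqVlt; apply/orP; left; apply/eqP; ring.
  have gmfin : gagliardo mu G (phi m) \is a fin_num.
    apply/fin_numPlt; rewrite (lt_le_trans (ltNyr 0))/=; last first.
      by apply: integral_ge0 => t _; apply: integral_ge0 => s _; rewrite lee_fin divr_ge0 ?sqr_ge0.
    by apply: le_lt_trans gm_le _; rewrite ltry.
  set gm := fine (gagliardo mu G (phi m)).
  have gmE : gagliardo mu G (phi m) = gm%:E by rewrite fineK.
  have gm_leR : gm <= 2 * g + 8 * CA * eps by rewrite -lee_fin -gmE.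
  have orth := orthogonal_sqr_le mG pt oK bK diamK clG nKG frG GB KB C1_ge0 reg c1_gt0 reg_lo (sphi m) gmE VL2 Vorth.
  have pL2 b : L2 K (partial b (phi m)) by apply: smooth_L2 => //; exact: smooth_partial.
  have dL2 b : L2 K (fun x => partial b (phi m) x - V b x) by exact: L2_sub.
  have md b : measurable_fun (K : set P) ((fun x => partial b (phi m) x - V b x) : P -> R) by exact: measurable_funB.
  have d2 b : leb2.-integrable (K : set P) (fun x => ((partial b (phi m) x - V b x) ^+ 2)%:E) by exact: L2_integrable.
  have iVd b : leb2.-integrable (K : set P) (fun x => (V b x * (partial b (phi m) x - V b x))%:E).
    by apply: integrable_mul_L2.
  have p2 b : leb2.-integrable (K : set P) (fun x => (partial b (phi m) x ^+ 2)%:E) by exact: L2_integrable.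
  have iVp b : leb2.-integrable (K : set P) (fun x => (V b x * partial b (phi m) x)%:E).
    by apply: integrable_mul_L2.
  pose Id b := \int[leb2]_(x in K) (V b x * (partial b (phi m) x - V b x)).
  pose Ip b := \int[leb2]_(x in K) (V b x * partial b (phi m) x).
  pose IV b := \int[leb2]_(x in K) (V b x ^+ 2).
  pose IE b := \int[leb2]_(x in K) ((partial b (phi m) x - V b x) ^+ 2).
  have NE2 : N = IV true + IV false.
    rewrite -RintegralD; [|exact: mK|exact: V2|exact: V2].
    by rewrite /N /Rintegral; congr fine; apply: eq_integral => x _; rewrite big_bool.
  have IpE : \int[leb2]_(x in K) (\sum_(b : bool) V b x * partial b (phi m) x) = Ip true + Ip false.
    rewrite -RintegralD; [|exact: mK|exact: iVp|exact: iVp].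
    by rewrite /Rintegral; congr fine; apply: eq_integral => x _; rewrite big_bool.
  have IdE b : Id b = Ip b - IV b.
    rewrite /Ip /IV -RintegralB; [|exact: mK|exact: iVp|exact: V2].
    by rewrite /Id /Rintegral; congr fine; apply: eq_integral => x _; rewrite mulrBr expr2.
  have errE : IE true + IE false <= eps.
    rewrite -lee_fin; apply: le_trans em; rewrite le_eqVlt; apply/orP; left; apply/eqP.
    rewrite EFinD !fineK; [|apply: integrable_fin_num; [exact: mK|exact: d2]|apply: integrable_fin_num; [exact: mK|exact: d2]].
    rewrite -integralD; [|exact: mK|exact: d2|exact: d2].
    by apply: eq_integral => x _; rewrite big_bool.
  have cs b : Id b ^+ 2 <= IV b * IE b.
    exact: (Rintegral_cauchy_schwarz mK (mV b) (md b) (V2 b) (d2 b)).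
  have IV0 b : 0 <= IV b by apply: Rintegral_ge0 => x _; exact: sqr_ge0.
  have IE0 b : 0 <= IE b by apply: Rintegral_ge0 => x _; exact: sqr_ge0.
  rewrite IpE in orth.
  have orth2 : (Ip true + Ip false) ^+ 2 <= CB * (2 * g + 8 * CA * eps) * N.
    apply: le_trans orth _; rewrite -/N ler_wpM2r// mulrA.
    by apply: ler_wpM2l.
  have csd : (Id true + Id false) ^+ 2 <= 2 * (eps * N).
    have e1 : IE true <= eps by apply: le_trans errE; rewrite lerDl.
    have e2 : IE false <= eps by apply: le_trans errE; rewrite lerDr.
    have f1 : Id true ^+ 2 <= IV true * eps by apply: le_trans (cs true) _; rewrite ler_wpM2l.
    have f2 : Id false ^+ 2 <= IV false * eps by apply: le_trans (cs false) _; rewrite ler_wpM2l.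
    rewrite NE2; exact: sqr_add_le f1 f2.
  have NE3 : N = (Ip true + Ip false) - (Id true + Id false) by rewrite !IdE NE2; move: (Ip true) (Ip false) (IV true) (IV false) => a b a' b'; ring.
  rewrite {1}NE3; apply: le_trans (sqr_sub_le orth2 csd) _.
  by rewrite le_eqVlt; apply/orP; left; apply/eqP; ring.
have [N_eq0|N_neq0] := eqVneq N 0.
  rewrite N_eq0; apply: mulr_ge0; first by apply: mulr_ge0.
  rewrite -lee_fin -gE; apply: integral_ge0 => t _; apply: integral_ge0 => s _.
  by rewrite lee_fin divr_ge0 ?sqr_ge0.
have Npos : 0 < N by rewrite lt_neqAle eq_sym N_neq0.
apply/ler_addgt0Pr => e e0.
have cc : 0 < 16 * CB * CA + 4 by rewrite ltr_wpDl// mulr_ge0// mulr_ge0.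
have := step _ (divr_gt0 e0 cc); rewrite expr2 ler_pM2r// => H.
apply: le_trans H _; rewrite lerD2l mulrCA mulfV ?mulr1//; by rewrite gt_eqF.
Qed.

(** When the mean vanishes the cross term of the double integral of [(u(G t) - u(G s))^2] drops out,
    leaving [2 * mu setT] times the L2 norm squared. Dividing the integrand by the squared distance,
    which is at most [h ^+ 2], produces the Gagliardo energy. *)
Lemma zero_mean_L2_le : (\int[mu]_t ((u (G t)) ^+ 2)%:E < +oo)%E -> \int[mu]_t (u (G t)) = 0 ->
  ((2 * fine (mu setT))%:E * \int[mu]_t ((u (G t)) ^+ 2)%:E <= (h ^+ 2)%:E * gagliardo mu G u)%E.
Proof.
move=> fin2 mean0.
have diamG (t s : T) : edist (G t) (G s) <= h.
  apply/ler_addgt0Pr => e e0.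
  have [y Ky yt] := closure_near (clG (t:=t)) e0.
  apply: le_trans (edist_triangle y _ _) _; rewrite (edistC (G t)) addrC lerD ?(ltW yt)//.
  exact: (edist_closure_le diamK).
pose v := u \o G.
have v2 : mu.-integrable setT (fun t => (v t ^+ 2)%:E).
  apply/integrableP; split; first by apply/measurable_EFinP; exact: measurable_funX.
  by under eq_integral do rewrite gee0_abs ?lee_fin ?sqr_ge0//.
have i1 : mu.-integrable setT (EFin \o cst (1 : R)) by exact: finite_measure_integrable_cst.
have iv : mu.-integrable setT (EFin \o v).
  have := integrable_mul_L2 (mu := mu) measurableT muG (measurable_cst (1 : R)) v2.
  move=> H; have := H _; rewrite (_ : (fun x => (v x * cst 1 x)%:E) = EFin \o v); last by apply/funext => t; rewrite /= mulr1.
  apply; rewrite (_ : (fun x => _) = EFin \o cst (1 : R))//.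
  by apply/funext => t; rewrite /= expr1n.
set M := fine (mu setT); have M0 : 0 <= M by rewrite fine_ge0.
set Q := \int[mu]_t (v t ^+ 2).
have mean0' : \int[mu]_t v t = 0 by exact: mean0.
have QE : (\int[mu]_t ((u (G t)) ^+ 2)%:E = Q%:E)%E.
  by rewrite fineK//; apply: integrable_fin_num.
have sec t : (\int[mu]_s ((v t - v s) ^+ 2)%:E = (v t ^+ 2 * M + Q)%:E)%E.
  have a1 : mu.-integrable setT (EFin \o (fun s => v t ^+ 2 * 1)).
    rewrite (_ : EFin \o _ = EFin \o cst (v t ^+ 2)); last by apply/funext => s; rewrite /= mulr1.
    exact: finite_measure_integrable_cst.
  have a2 : mu.-integrable setT (EFin \o (fun s => (2 * v t) * v s)).
    rewrite (_ : EFin \o _ = fun s => ((2 * v t)%:E * (EFin \o v) s)%E); last by apply/funext => s.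
    exact: integrableZl.
  have a12 : mu.-integrable setT (EFin \o (fun s => v t ^+ 2 * 1 - (2 * v t) * v s)).
    exact: integrableB a1 a2.
  have a3 : mu.-integrable setT (EFin \o (fun s => (v t ^+ 2 * 1 - (2 * v t) * v s) + v s ^+ 2)).
    exact: integrableD a12 v2.
  transitivity ((\int[mu]_s ((v t ^+ 2 * 1 - (2 * v t) * v s) + v s ^+ 2))%:E).
    rewrite fineK; last exact: integrable_fin_num.
    by apply: eq_integral => s _; congr EFin; ring.
  rewrite RintegralD; [|exact: measurableT|exact: a12|exact: v2].
  rewrite RintegralB; [|exact: measurableT|exact: a1|exact: a2].
  rewrite [X in _ - X]RintegralZl; [|exact: measurableT|exact: iv].
  rewrite mean0' mulr0 subr0; congr EFin; congr (_ + _).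
  by rewrite mulr1 Rintegral_cst.
rewrite QE.
have -> : ((2 * M)%:E * Q%:E = \int[mu]_t \int[mu]_s ((v t - v s) ^+ 2)%:E)%E.
  under eq_integral do rewrite sec.
  have b1 : mu.-integrable setT (EFin \o (fun t => v t ^+ 2 * M)).
    rewrite (_ : EFin \o _ = fun s => (M%:E * (v s ^+ 2)%:E)%E); last by apply/funext => s; rewrite /= mulrC EFinM.
    exact: integrableZl.
  have b2 : mu.-integrable setT (EFin \o cst Q) by exact: finite_measure_integrable_cst.
  transitivity ((\int[mu]_t (v t ^+ 2 * M + cst Q t))%:E); last first.
    by rewrite fineK//; apply: integrable_fin_num => //; exact: integrableD b1 b2.
  by rewrite RintegralD// RintegralZr// Rintegral_cst// -EFinM; congr EFin; rewrite -/Q -/M; ring.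
have mgag := measurable_energy_integrand (measurable_gagk mG) muG.
have gag0 := energy_integrand_ge0 (gagk_ge0 G) v.
rewrite /gagliardo -ge0_integralZl//; first last.
- by rewrite lee_fin sqr_ge0.
- by move=> t _; apply: integral_ge0 => s _; exact: gag0.
- exact: (measurable_fun_integral_setX mu measurableT mgag (fun p => gag0 _ _)).
apply: ge0_integral_mono => t _; first by apply: integral_ge0 => s _; rewrite lee_fin sqr_ge0.
rewrite -ge0_integralZl//; first last.
- by rewrite lee_fin sqr_ge0.
- by move=> s _; exact: gag0.
- exact: (measurableT_comp mgag (measurable_pair1 t)).
apply: ge0_integral_mono => s _; first by rewrite lee_fin sqr_ge0.
rewrite -EFinM lee_fin /v /=; have := edist_ge0 (G t) (G s); rewrite le_eqVlt => /predU1P[d0|d0].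
  by rewrite (edist_eq0 (esym d0)) subrr expr0n/= mul0r mulr0.
rewrite mulrA ler_pdivlMr ?exprn_gt0// mulrC ler_wpM2r ?sqr_ge0//.
by rewrite lerXn2r ?nnegrE ?edist_ge0 ?(ltW h0).
Qed.

End TraceEquivalence.

Section NatProduct.
Context d (X : measurableType d) d' (Y : measurableType d').

Lemma measurable_fun_natX (f : nat * X -> Y) :
  (forall i, measurable_fun setT (fun x => f (i, x))) -> measurable_fun setT f.
Proof.
move=> mf _ A mA; rewrite setTI.
rewrite (_ : f @^-1` A = \bigcup_i ([set i] `*` ((fun x => f (i, x)) @^-1` A))); last first.
  apply/seteqP; split => [[i x] Afx|[i x] [j _ [/= -> ]]//].
  by exists i.
apply: bigcup_measurable => i _; apply: measurableX => //.
by rewrite -[X in measurable X]setTI; exact: mf.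
Qed.

End NatProduct.

(** * The boundary of a polygon *)

Section Boundary.
Context {R : realType}.
Local Notation plane := (R * R)%type.
Local Notation MR := (measurableTypeR R).
Local Notation P := (measurableTypeR R * measurableTypeR R)%type.
Local Notation leb := (@lebesgue_measure R).
Local Notation edist := Defs.edist.
Variable Q : polygon R.

Local Notation n := (size (verts Q)).
Local Notation T := (nat * MR)%type.

Lemma edge_len_ge0 i : 0 <= edge_len Q i. Proof. exact: edist_ge0. Qed.

Definition edge_inj (i : nat) (t : MR) : T := (i, t).

Lemma measurable_edge_inj i : measurable_fun setT (edge_inj i).
Proof. by apply: measurable_fun_pair; [exact: measurable_cst|exact: measurable_id]. Qed.

(** Arc length on one edge: the uniform law of the parameter, scaled by the length of the edge and
    carried to the slice of index [i]. *)
Definition edge_measure (i : nat) : {measure set T -> \bar R} :=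
  mscale (NngNum (edge_len_ge0 i))
    (measure_function_pushforward__canonical__measure_function_Measure
       (uniform_prob (@ltr01 R)) (@measurable_edge_inj i)).

(* The boundary is parametrised by all of [nat * R]; the measure is carried by
   the pairs (edge number, parameter in [0, 1]). *)
Definition boundary_measure : set T -> \bar R := msum edge_measure n.

HB.instance Definition _ := Measure.copy boundary_measure (msum edge_measure n).

Lemma ge0_integral_boundary (f : T -> \bar R) : measurable_fun setT f -> (forall x, 0 <= f x)%E ->
  (\int[boundary_measure]_x f x =
   \sum_(i < n) (edge_len Q i)%:E * \int[leb]_(t in `[0%R, 1%R]) f (nat_of_ord i, t))%E.
Proof.
move=> mf f0; rewrite /boundary_measure ge0_integral_measure_sum//.
apply: eq_bigr => i _; rewrite ge0_integral_mscale//; congr (_ * _)%E.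
rewrite ge0_integral_pushforward//; last exact: measurable_edge_inj.
rewrite preimage_setT integral_uniform//.
- by rewrite subr0 invr1 mul1e.
- by apply: measurableT_comp => //; exact: measurable_edge_inj.
- by move=> t; exact: f0.
Qed.

Lemma boundary_measureE (A : set T) : measurable A ->
  (boundary_measure A = \sum_(i < n) (edge_len Q i)%:E *
     leb (`[0%R, 1%R]%classic `&` [set t | A (nat_of_ord i, t)]))%E.
Proof.
move=> mA; have := @integral_indic _ _ _ boundary_measure setT measurableT A mA; rewrite setIT => <-.
rewrite ge0_integral_boundary//; last by apply/measurable_EFinP; exact: measurable_indic.
apply: eq_bigr => i _; congr (_ * _)%E.
have mAi : measurable [set t : MR | A (nat_of_ord i, t)].
  by rewrite -[X in measurable X]setTI; exact: (@measurable_edge_inj i measurableT _ mA).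
by rewrite setIC -integral_indic.
Qed.

Let boundary_finite : fin_num_fun boundary_measure.
Proof.
move=> A mA; rewrite ge0_fin_numE// boundary_measureE//.
apply: lte_sum_pinfty => i _; rewrite lte_mul_pinfty//; first by rewrite lee_fin edge_len_ge0.
apply: (@le_lt_trans _ _ (leb `[0%R, 1%R])); last by rewrite lebesgue_measure_itv/= lte_fin ltr01 ltry.
apply: le_measure; rewrite ?inE//.
apply: measurableI => //.
by rewrite -[X in measurable X]setTI; exact: (@measurable_edge_inj i measurableT _ mA).
Qed.

HB.instance Definition _ := Measure_isFinite.Build _ _ _ boundary_measure boundary_finite.

Definition clamp (t : R) : R := Num.max 0 (Num.min 1 t).

Lemma clamp_itv t : 0 <= clamp t <= 1.
Proof. by rewrite /clamp le_max lexx/= ge_max ler01/= ge_min lexx. Qed.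

Lemma clamp_id t : 0 <= t <= 1 -> clamp t = t.
Proof. by move=> /andP[t0 t1]; rewrite /clamp min_r// max_r. Qed.

Lemma measurable_clamp : measurable_fun setT (clamp : MR -> R).
Proof. by apply: measurable_maxr => //; apply: measurable_minr. Qed.

(** Reducing the index and clamping the parameter makes every element of [T] a boundary point, so
    that statements about all of [T] hold without reference to the support of the measure. *)
Definition bpt (p : T) : plane := edge_pt (verts Q) (p.1 %% n) (clamp p.2).

Lemma size_verts_gt0 : (0 < n)%N. Proof. exact: leq_ltn_trans (verts_size Q). Qed.

Lemma bptE i t : (i < n)%N -> 0 <= t <= 1 -> bpt (i, t) = edge_pt (verts Q) i t.
Proof. by move=> iN t01; rewrite /bpt/= modn_small// clamp_id. Qed.

Lemma measurable_bpt_comp (u : plane -> R) :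
  (forall i, (i < n)%N -> measurable_fun (`[0, 1]%classic : set MR) (fun t => u (edge_pt (verts Q) i t))) ->
  measurable_fun setT (u \o bpt).
Proof.
move=> mu; apply: measurable_fun_natX => i.
have iN : (i %% n < n)%N by rewrite ltn_pmod// size_verts_gt0.
apply: (@measurable_comp _ _ _ _ _ _ (`[0, 1]%classic : set MR)
   (fun t => u (edge_pt (verts Q) (i %% n) t)) _ clamp) => //.
- by move=> _ [t _ <-]; rewrite /= in_itv/=; exact: clamp_itv.
- exact: mu.
- exact: measurable_clamp.
Qed.

Lemma edge_ptE i t : edge_pt (verts Q) i t = edge_pt (verts Q) i 0 +
  t *: (edge_pt (verts Q) i 1 - edge_pt (verts Q) i 0).
Proof.
rewrite /edge_pt /segpt scale0r addr0 scale1r; congr (_ + _ *: _).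
by rewrite [RHS]addrAC subrr add0r.
Qed.

Lemma measurable_bpt : measurable_fun setT (bpt : T -> P).
Proof.
apply: measurable_fun_natX => i; rewrite /bpt /=.
have -> : (fun t : MR => edge_pt (verts Q) (i %% n) (clamp t)) = fun t => edge_pt (verts Q) (i %% n) 0 +
  clamp t *: (edge_pt (verts Q) (i %% n) 1 - edge_pt (verts Q) (i %% n) 0).
  by apply/funext => t; rewrite edge_ptE.
apply: (measurable_plane_add (f := cst _)); first exact: measurable_cst.
by apply: (measurable_plane_scale (f := cst _)); [exact: measurable_clamp|exact: measurable_cst].
Qed.

Lemma bd_intE (f : plane -> \bar R) : measurable_fun setT (f \o bpt) -> (forall x, 0 <= f x)%E ->
  (bd_int Q f = \int[boundary_measure]_t f (bpt t))%E.
Proof.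
move=> mf f0; rewrite (ge0_integral_boundary mf (fun t => f0 _)) /bd_int.
apply: eq_bigr => i _; congr (_ * _)%E; apply: eq_integral => t /set_mem/=.
by rewrite in_itv/= => t01; rewrite bptE.
Qed.

Lemma edge_edist i t s : edist (edge_pt (verts Q) i t) (edge_pt (verts Q) i s) = `|t - s| * edge_len Q i.
Proof.
have E : edge_pt (verts Q) i t - edge_pt (verts Q) i s =
    (t - s) *: (edge_pt (verts Q) i 1 - edge_pt (verts Q) i 0).
  rewrite (edge_ptE i t) (edge_ptE i s).
  by apply: injective_projections; rewrite /= /GRing.scale/=; ring.
rewrite edistE E /edge_len edistC edistE.
have [ts|ts] := leP 0 (t - s); first by rewrite ger0_norm// enormZ.
rewrite ltr0_norm// -(@enormZ R (- (t - s))); last by rewrite oppr_ge0 ltW.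
by rewrite scaleNr enormN.
Qed.

Lemma measurable_near (x : plane) (s : R) : measurable [set p | edist x (bpt p) < s].
Proof.
have md : measurable_fun setT (fun p => edist x (bpt p)).
  by apply: measurable_edist => //; exact: measurable_bpt.
rewrite (_ : [set _ | _] = setT `&` (fun p => edist x (bpt p)) @^-1` `]-oo, s[%classic).
  by apply: md => //; exact: measurable_itv.
by apply/seteqP; split => [p Hp|p []] /=; rewrite in_itv.
Qed.

(** Two points of an edge of length [L] in a disc of radius [s] have parameters less than
    [2 * s / L] apart, so the disc meets each edge in length at most [4 * s], and there are at most
    [N] edges. *)
Lemma boundary_reg (N : nat) (x : plane) (s : R) : (n <= N)%N -> 0 < s ->
  (boundary_measure [set p | (edist x (bpt p) < s)%R] <= (4 * N%:R * s)%:E)%E.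
Proof.
move=> nN s0; rewrite boundary_measureE; last exact: measurable_near.
apply: (@le_trans _ _ (\sum_(i < n) (4 * s)%:E)%E); last first.
  rewrite sumEFin lee_fin sumr_const card_ord -[(4 * s) *+ n]mulr_natr mulrAC.
  by rewrite ler_wpM2r ?(ltW s0)// ler_wpM2l// ler_nat.
apply: lee_sum => i _; set L := edge_len Q i; have L0 : 0 <= L by exact: edge_len_ge0.
set A := (_ `&` _).
have [->|/set0P[t0 At0]] := eqVneq A set0.
  by rewrite measure0 mule0 lee_fin mulr_ge0// ltW.
have [L_eq0|L_neq0] := eqVneq L 0; first by rewrite L_eq0 mul0e lee_fin mulr_ge0// ltW.
have Lp : 0 < L by rewrite lt_neqAle eq_sym L_neq0.
have sub : A `<=` `[t0 - 2 * s / L, t0 + 2 * s / L]%classic.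
  move=> t [/= t01 Ht]; have [/= t001 Ht0] := At0.
  move: t01 t001; rewrite !in_itv/= => t01 t001.
  rewrite !bptE// in Ht Ht0.
  have : `|t - t0| * L < 2 * s.
    rewrite -edge_edist; apply: le_lt_trans (edist_triangle x _ _) _.
    rewrite (edistC _ x) mulr_natl mulr2n; exact: ltrD.
  rewrite -ltr_pdivlMr// => /ltW; rewrite ler_distl => /andP[H1 H2].
  by apply/andP; split; [exact: H1|exact: H2].
apply: (@le_trans _ _ (L%:E * (4 * s / L)%:E)%E).
  apply: lee_wpmul2l; first by rewrite lee_fin.
  apply: (@le_trans _ _ (leb `[t0 - 2 * s / L, t0 + 2 * s / L])).
    apply: le_measure; rewrite ?inE//.
    apply: measurableI => //; rewrite -[X in measurable X]setTI.
    exact: (@measurable_edge_inj i measurableT _ (measurable_near x s)).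
  rewrite lebesgue_measure_itv/= lte_fin; case: ifPn => _; last by rewrite lee_fin !mulr_ge0 ?invr_ge0 ?(ltW s0).
  by rewrite -EFinD lee_fin le_eqVlt; apply/orP; left; apply/eqP; field; rewrite gt_eqF.
by rewrite -EFinM lee_fin mulrC divfK.
Qed.

(** The edge carrying the centre is enough: it contains an interval of parameters of length [m] with
    the centre as an endpoint. Its length [m * L] is [s], or at least half of [rho0 * h], which is
    at least [rho0 * s / 2] because [s <= h]. *)
Lemma boundary_reg_lo (h rho0 : R) (p0 : T) (s : R) : 0 < rho0 <= 1 ->
  (forall i, (i < n)%N -> rho0 * h <= edge_len Q i) -> 0 < s <= h ->
  ((rho0 / 2 * s)%:E <= boundary_measure [set p | (edist (bpt p0) (bpt p) < s)%R])%E.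
Proof.
move=> /andP[rho00 rho01] HL /andP[s0 sh]; rewrite boundary_measureE; last exact: measurable_near.
have iN : (p0.1 %% n < n)%N by rewrite ltn_pmod// size_verts_gt0.
rewrite (bigD1 (Ordinal iN))//=; apply: (@le_trans _ _ ((edge_len Q (p0.1 %% n))%:E * leb
  (`[0%R, 1%R]%classic `&` [set t : MR | (edist (bpt p0) (bpt ((p0.1 %% n)%N, t)) < s)%R]))%E); last first.
  rewrite leeDl//; apply: sume_ge0 => i _; apply: mule_ge0; first by rewrite lee_fin edge_len_ge0.
  exact: measure_ge0.
set i := (p0.1 %% n)%N in iN *; set L := edge_len Q i.
have h0 : 0 < h by exact: lt_le_trans sh.
have Lh : rho0 * h <= L by exact: HL.
have Lp : 0 < L by apply: lt_le_trans Lh; rewrite mulr_gt0.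
pose m := Num.min (s / L) (2^-1).
have m0 : 0 < m by rewrite lt_min divr_gt0//= invr_gt0.
have m2 : m <= 2^-1 by rewrite ge_min lexx orbT.
have mL : m * L <= s by rewrite -ler_pdivlMr// ge_min lexx.
pose c := clamp p0.2; have /andP[c0 c1] := clamp_itv p0.2.
(* The interval extends to the right of [c] in the left half of the edge and to the left in the
   right half; as [m <= 1/2] it stays in [[0, 1]]. *)
pose a := if c <= 2^-1 then c else c - m.
have a01 : 0 <= a /\ a + m <= 1.
  rewrite /a; case: (leP c (2^-1)) => cc; rewrite -/c in c0 c1; split; lra.
have near t : `]a, (a + m)[%classic t -> 0 <= t <= 1 /\ `|c - t| < m.
  rewrite /= in_itv/= => /andP[at_ tam]; have [a0 am] := a01; split.
    by apply/andP; split; lra.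
  rewrite ltr_norml; move: at_ tam; rewrite /a; case: ifP => _ at_ tam; apply/andP; split; lra.
apply: (@le_trans _ _ (L%:E * leb `]a, (a + m)%R[)%E).
  rewrite lebesgue_measure_itv/= lte_fin ltrDl m0 -EFinB -EFinM lee_fin addrAC subrr add0r.
  rewrite /m; have [mm|mm] := leP (s / L) (2^-1).
    rewrite [leRHS]mulrC divfK ?gt_eqF//; have := s0; nra.
  apply: (@le_trans _ _ (rho0 * h / 2)); last by rewrite ler_wpM2r.
  by rewrite mulrAC ler_wpM2r// ler_wpM2l// ltW.
apply: lee_wpmul2l; first by rewrite lee_fin ltW.
apply: le_measure; rewrite ?inE//.
  apply: measurableI => //; rewrite -[X in measurable X]setTI.
  exact: (@measurable_edge_inj i measurableT _ (measurable_near (bpt p0) s)).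
move=> t /near[t01 ct]; split; first by rewrite /= in_itv.
rewrite /= bptE// /bpt -/c -/i edge_edist -/L; apply: lt_le_trans mL; by rewrite ltr_pM2r.
Qed.

Lemma bpt_frontier p : frontier (inner Q) (bpt p).
Proof.
rewrite inner_frontier; exists (p.1 %% n)%N => /=; first by rewrite ltn_pmod// size_verts_gt0.
by exists (clamp p.2) => //; rewrite /= in_itv/=; exact: clamp_itv.
Qed.

Lemma bpt_closure p : closure (inner Q) (bpt p). Proof. by have [] := bpt_frontier p. Qed.

Lemma bpt_notin p : ~ inner Q (bpt p).
Proof.
move=> Qp; have [_] := bpt_frontier p; apply.
exact: open_nbhs_nbhs (conj (@inner_open _ Q) Qp).
Qed.

Lemma frontier_bpt x : closure (inner Q) x -> ~ inner Q x -> exists p, x = bpt p.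
Proof.
move=> clx nx; have : frontier (inner Q) x by split => // /interior_subset.
rewrite inner_frontier => -[i /= iN [t t01 <-]]; exists (i, t); by rewrite bptE.
Qed.

(** An infinite integral over an edge of positive length would make the whole sum infinite. On an
    edge of length zero it would be hidden by [0 * +oo = 0]. *)
Lemma ge0_integral_boundary_fin (f : T -> \bar R) : (forall i, (i < n)%N -> 0 < edge_len Q i) ->
  measurable_fun setT f -> (forall x, 0 <= f x)%E -> (\int[boundary_measure]_x f x < +oo)%E ->
  exists2 A : nat -> R, (\int[boundary_measure]_x f x)%E = (\sum_(i < n) edge_len Q i * A i)%:E &
    forall i, (i < n)%N -> (\int[leb]_(t in `[0%R, 1%R]) f (i, t))%E = (A i)%:E.
Proof.
move=> L0 mf f0; rewrite ge0_integral_boundary// => fin.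
pose a i : \bar R := (\int[leb]_(t in `[0%R, 1%R]) f (i, t))%E.
have a0 i : (0 <= a i)%E by apply: integral_ge0 => t _; exact: f0.
have afin i : (i < n)%N -> a i \is a fin_num.
  move=> iN; rewrite ge0_fin_numE// ltNge; apply/negP; rewrite leye_eq => /eqP aoo.
  move: fin; rewrite (bigD1 (Ordinal iN))//= -/(a i) aoo mulry gtr0_sg ?L0// mul1e.
  have rest0 : (0 <= \sum_(j < n | j != Ordinal iN) (edge_len Q j)%:E * a j)%E.
    by apply: sume_ge0 => j _; apply: mule_ge0; [rewrite lee_fin edge_len_ge0|exact: a0].
  by rewrite addye ?ltxx// gt_eqF// (lt_le_trans (ltNyr 0)).
exists (fun i => fine (a i)) => [|i iN]; last by rewrite fineK//; exact: afin.
by rewrite -sumEFin; apply: eq_bigr => i _; rewrite EFinM fineK//; exact: afin.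
Qed.

(** The mean condition is about a signed function. Positive and negative parts are treated
    separately, and finiteness on every edge excludes a difference of infinities. *)
Lemma integral_boundary (f : T -> R) : (forall i, (i < n)%N -> 0 < edge_len Q i) ->
  boundary_measure.-integrable setT (EFin \o f) ->
  (\int[boundary_measure]_x (f x)%:E =
   \sum_(i < n) (edge_len Q i)%:E * \int[leb]_(t in `[0%R, 1%R]) (f (nat_of_ord i, t))%:E)%E.
Proof.
move=> L0 intf; have mf := measurable_int _ intf.
have fp : (\int[boundary_measure]_x (EFin \o f)^\+ x < +oo)%E.
  by have /integrableP[] := integrable_funepos measurableT intf; under eq_integral do rewrite gee0_abs//.
have fn : (\int[boundary_measure]_x (EFin \o f)^\- x < +oo)%E.
  by have /integrableP[] := integrable_funeneg measurableT intf; under eq_integral do rewrite gee0_abs//.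
have [A EA HA] := ge0_integral_boundary_fin L0 (measurable_funepos mf) (fun x => funepos_ge0 _ _) fp.
have [A' EA' HA'] := ge0_integral_boundary_fin L0 (measurable_funeneg mf) (fun x => funeneg_ge0 _ _) fn.
rewrite (integralE _ _ (fun x => (f x)%:E)) EA EA' -EFinB -sumrB -sumEFin; apply: eq_bigr => i _.
rewrite (integralE _ _ (fun t => (f (nat_of_ord i, t))%:E)).
rewrite (_ : integral _ _ _^\+ = (A i)%:E)%E; last first.
  by rewrite -HA//; apply: eq_integral => t _; rewrite !funeposE.
rewrite (_ : integral _ _ _^\- = (A' i)%:E)%E; last first.
  by rewrite -HA'//; apply: eq_integral => t _; rewrite !funenegE.
by rewrite -EFinB -EFinM mulrBr.
Qed.

Lemma bd_int_mean (u : plane -> R) : (forall i, (i < n)%N -> 0 < edge_len Q i) ->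
  boundary_measure.-integrable setT (EFin \o (u \o bpt)) ->
  (bd_int Q (fun x => (u x)%:E) = (\int[boundary_measure]_t u (bpt t))%:E)%E.
Proof.
move=> L0 iu; rewrite fineK; last exact: integrable_fin_num.
rewrite [RHS](integral_boundary (f := u \o bpt))// /bd_int.
apply: eq_bigr => i _; congr (_ * _)%E; apply: eq_integral => t /set_mem/=.
by rewrite in_itv/= => t01; rewrite bptE.
Qed.

End Boundary.

(** * Diameters *)

Section Diameter.
Context {R : realType}.
Local Notation plane := (R * R)%type.
Local Notation edist := Defs.edist.
Implicit Types A : set plane.

Lemma edist_le_ediam A x y : bounded_set A -> A x -> A y -> edist x y <= ediam A.
Proof.
move=> /bounded_plane[M M0 HM] Ax Ay; apply: ub_le_sup; last by exists x, y.
exists (4 * M) => _ [a [b [Aa Ab ->]]]; rewrite edistE.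
apply: le_trans (enorm_le_norm _) _; have := ler_normB a b.
have := HM _ Aa; have := HM _ Ab; lra.
Qed.

Lemma ediam_gt0 A : open A -> A !=set0 -> bounded_set A -> 0 < ediam A.
Proof.
move=> oA [x Ax] bA; have /nbhs_ballP[e /= e0 He] : nbhs x A by exact: open_nbhs_nbhs (conj oA Ax).
pose y : plane := x + (e / 2, 0).
have Ay : A y.
  apply: He; rewrite -ball_normE /= /y opprD addrA subrr sub0r normrN.
  rewrite /Num.norm/= gt_max normr0 e0 andbT ger0_norm ?divr_ge0 ?(ltW e0)//.
  by rewrite ltr_pdivrMr// ltr_pMr// ltr1n.
apply: lt_le_trans (edist_le_ediam bA Ay Ax); rewrite edistE.
apply: lt_le_trans (enorm_ge_norm _); rewrite normr_gt0 /y addrAC subrr add0r.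
by apply/eqP => -[E]; move: e0; lra.
Qed.

Lemma ediam_subset A A' : A `<=` A' -> A !=set0 -> bounded_set A' -> ediam A <= ediam A'.
Proof.
move=> AA' [x Ax] bA'; apply: ge_sup; first by exists (edist x x), x, x.
move=> _ [a [b [Aa Ab ->]]]; apply: edist_le_ediam => //; exact: AA'.
Qed.

Lemma star_shaped_ball_le A z r r' : r' <= r -> star_shaped_ball A z r -> star_shaped_ball A z r'.
Proof.
move=> rr' [bA sA]; have sub : eball z r' `<=` eball z r.
  by move=> x; rewrite /eball/= => xz; exact: lt_le_trans rr'.
split; first exact: subset_trans bA.
by move=> x y /sub; exact: sA.
Qed.

Lemma closure_norm_le A (M : R) x : (forall y, A y -> `|y| <= M) -> closure A x -> `|x| <= M.
Proof.
move=> HM clx; apply/ler_addgt0Pr => e e0.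
have [y Ay yx] := closure_near clx e0.
have -> : x = y - (y - x) by rewrite opprB addrC subrK.
apply: le_trans (ler_normB _ _) _; apply: lerD; first exact: HM.
by apply: le_trans (enorm_ge_norm _) _; rewrite -edistE ltW.
Qed.

End Diameter.

(** * The equivalence on one element *)

Section ElementBound.
Context {R : realType}.
Local Notation plane := (R * R)%type.
Local Notation P := (measurableTypeR R * measurableTypeR R)%type.
Local Notation leb2 := (@lebesgue_measure R \x @lebesgue_measure R)%E.
Local Notation edist := Defs.edist.

(* The constants of [gagliardo_le_grad] and [orthogonal_sqr_le] for an element
   of diameter [h] in which [r = rho0 * h], [C1 = 4 * N] and [c1 = rho0 / 2]:
   all powers of [h] cancel. *)
Definition const_A (rho0 : R) (N : nat) : R :=
  2 ^+ 6 * 512 * 48 * (4 * N%:R) ^+ 2 / rho0 ^+ 8.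

Definition const_B (rho0 : R) : R := 2 * (16 * (16 / (rho0 / 2)) ^+ 2 * 2 ^+ 10).

Lemma const_B_gt0 rho0 : 0 < rho0 -> 0 < const_B rho0.
Proof.
move=> r0; apply: mulr_gt0 => //; apply: mulr_gt0; last by rewrite exprn_gt0.
by apply: mulr_gt0 => //; rewrite exprn_gt0// divr_gt0// divr_gt0.
Qed.

Lemma const_AE rho0 N h : 0 < rho0 -> 0 < h ->
  2 ^+ 6 * (512 * h ^+ 2 * (4 * N%:R) / (rho0 * h)) *
    (48 * (4 * N%:R) * h ^+ 6 / (rho0 * h) ^+ 5) / (rho0 * h) ^+ 2 = const_A rho0 N.
Proof.
move=> r0 h0; have r0' : rho0 != 0 by rewrite gt_eqF.
have h0' : h != 0 by rewrite gt_eqF.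
rewrite /const_A; move: (N%:R : R) => M; field.
by rewrite r0' h0'.
Qed.

Variables (Q : polygon R) (rho0 : R) (N : nat).
Hypotheses (Hrho0 : 0 < rho0 < 2^-1) (Hreg : shape_regular rho0 N Q).
Variables (p : nat) (v : plane -> R) (Hv : kerPi Q p v).

Let K := inner Q.
Let h := ediam K.
Let g := trace Q v.
Let V (b : bool) : plane -> R := weak_partial K v b.
Let mu : {finite_measure set (nat * measurableTypeR R)%type -> \bar R} := boundary_measure Q.
Let G := bpt Q.

Let rho0_gt0 : 0 < rho0. Proof. by case/andP: Hrho0. Qed.
Let oK : open K. Proof. exact: inner_open. Qed.
Let bK : bounded_set K. Proof. exact: inner_bounded. Qed.
Let h0 : 0 < h. Proof. by apply: ediam_gt0 => //; exact: inner_nonempty. Qed.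
Let edges i : (i < size (verts Q))%N -> rho0 * h <= edge_len Q i.
Proof. by have [_ H _] := Hreg; exact: H. Qed.
Let edges_gt0 i : (i < size (verts Q))%N -> 0 < edge_len Q i.
Proof. by move=> iN; apply: lt_le_trans (edges iN); rewrite mulr_gt0. Qed.

Let trace_v : is_trace Q v g.
Proof.
have [[_ _ [g0 [tg0 _ _]]] _] := Hv; rewrite /g /trace.
by case: xgetP => [? _ //|/(_ g0)]; exact.
Qed.

Let H1v : H1 K v. Proof. by have [[]] := Hv. Qed.

Let VL2 b : L2 K (V b). Proof. by have [] := weak_partialP b H1v. Qed.

Let Vorth psi : test_fun K psi ->
  \int[leb2]_(x in K) (\sum_(b : bool) V b x * partial b psi x) = 0.
Proof. by have [[_ hv _] _] := Hv; exact: hv. Qed.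

Let mgG : measurable_fun setT (g \o G).
Proof. by apply: measurable_bpt_comp => i iN; have [[mg _] _] := trace_v; exact: mg. Qed.

Let gL2E : (bd_int Q (fun x => ((g x) ^+ 2)%:E) = \int[mu]_t ((g (G t)) ^+ 2)%:E)%E.
Proof.
apply: bd_intE; last by move=> x; rewrite lee_fin sqr_ge0.
by apply/measurable_EFinP; exact: measurable_funX.
Qed.

Let gL2 : (\int[mu]_t ((g (G t)) ^+ 2)%:E < +oo)%E.
Proof. by rewrite -gL2E; have [[_]] := trace_v. Qed.

Let SKE : (SK Q v v = \int[mu]_t ((g (G t)) ^+ 2)%:E + gagliardo mu G g)%E.
Proof.
rewrite /SK /ip_half -/g -gL2E; congr (_ + _)%E.
have me := measurable_energy_integrand (measurable_gagk (measurable_bpt Q)) mgG.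
have e0 := energy_integrand_ge0 (gagk_ge0 G) (g \o G).
have q_ge0 x y : (0 <= ((g x - g y) * (g x - g y) / edist x y ^+ 2)%:E)%E.
  by rewrite lee_fin -expr2 divr_ge0 ?sqr_ge0.
have inner x : (bd_int Q (fun y => ((g x - g y) * (g x - g y) / edist x y ^+ 2)%:E) =
    \int[mu]_s ((g x - g (G s)) ^+ 2 / edist x (G s) ^+ 2)%:E)%E.
  rewrite bd_intE//; apply/measurable_EFinP; apply: measurable_funM.
    by apply: measurable_funM; exact: measurable_funB.
  apply: measurable_inv; apply: measurable_funX; apply: measurable_edist; first exact: measurable_cst.
  exact: measurable_bpt.
rewrite (_ : (fun x => bd_int Q _) = fun x => \int[mu]_s ((g x - g (G s)) ^+ 2 / edist x (G s) ^+ 2)%:E)%E; last first.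
  by apply/funext => x; exact: inner.
rewrite bd_intE//.
  exact: (measurable_fun_integral_setX mu measurableT me (fun q => e0 _ _)).
by move=> x; apply: integral_ge0 => s _; rewrite lee_fin divr_ge0 ?sqr_ge0.
Qed.

Let seminormE : sq_seminorm_H1 K v =
  (\int[leb2]_(x in K) (\sum_(b : bool) V b x ^+ 2))%:E.
Proof.
have mK : measurable (K : set P) by exact: open_plane_measurable.
rewrite fineK//; apply: integrable_fin_num => //.
have := integrableD mK (L2_integrable oK bK (VL2 true)) (L2_integrable oK bK (VL2 false)).
by apply: eq_integrable => // x _; rewrite /= big_bool.
Qed.

Let diamK x y : K x -> K y -> edist x y <= h.
Proof. exact: edist_le_ediam. Qed.

Let frG x : closure K x -> ~ K x -> exists t, x = G t.
Proof. exact: frontier_bpt. Qed.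

Let C1 : R := 4 * N%:R.
Let C1_ge0 : 0 <= C1. Proof. exact: mulr_ge0. Qed.

Let reg x s : 0 < s -> (mu [set t | (edist x (G t) < s)%R] <= (C1 * s)%:E)%E.
Proof. by move=> s0; apply: boundary_reg => //; have [] := Hreg. Qed.

Let c1_gt0 : 0 < rho0 / 2. Proof. by rewrite divr_gt0. Qed.

Let reg_lo t0 s : 0 < s <= h -> ((rho0 / 2 * s)%:E <= mu [set t | (edist (G t0) (G t) < s)%R])%E.
Proof.
by apply: boundary_reg_lo => //; have := Hrho0; move=> /andP[-> H]/=; apply: ltW; lra.
Qed.

Let r0 : 0 < rho0 * h. Proof. exact: mulr_gt0. Qed.
Let rh : rho0 * h <= 2 * h.
Proof. by rewrite ler_wpM2r ?(ltW h0)//; case/andP: Hrho0 => _; lra. Qed.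

Let bounded_closure : exists2 M : R, (forall t, `|G t| <= M) & forall x, K x -> `|x| <= M.
Proof.
have [M M0 HM] := bounded_plane bK; exists M => // t.
by apply: closure_norm_le HM _; exact: bpt_closure.
Qed.

Lemma trace_energy_bounds :
  (gagliardo mu G g <= (4 * const_A rho0 N)%:E * sq_seminorm_H1 K v)%E /\
  (sq_seminorm_H1 K v <= (4 * const_B rho0)%:E * gagliardo mu G g)%E.
Proof.
have [_ [phi [sphi Hphi bphi]]] := trace_v.
have [[z [r [rle star]]] _ _] := Hreg.
(* The ball is shrunk to radius exactly [rho0 * h], so that the constants depend on [rho0] and [N]
   alone. *)
have star' : star_shaped_ball K z (rho0 * h) by exact: star_shaped_ball_le star.
have [M GM KM] := bounded_closure.
have grad_cvg : (\int[leb2]_(x in K) (\sum_(b : bool) (partial b (phi n) x - V b x) ^+ 2)%R%:E)%E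
    @[n --> \oo] --> 0%E.
  apply: (@squeeze_cvge _ _ _ _ (cst 0%E) _ (fun n => sq_norm_H1 K (phi n \- v)%R)) => //; last exact: cvg_cst.
  apply: nearW => n; apply/andP; split.
    by apply: integral_ge0 => x _; rewrite lee_fin sumr_ge0// => b _; exact: sqr_ge0.
  rewrite -(sq_seminorm_H1_sub oK bK (sphi n) H1v) /sq_norm_H1 leeDr//.
  by apply: integral_ge0 => x _; rewrite lee_fin sqr_ge0.
have bd_cvg : (\int[mu]_t ((phi n (G t) - g (G t)) ^+ 2)%R%:E)%E @[n --> \oo] --> 0%E.
  move: bphi; rewrite (_ : (fun n => bd_int Q _) = fun n => \int[mu]_t ((phi n (G t) - g (G t)) ^+ 2)%R%:E)%E//.
  apply/funext => n; apply: bd_intE; last by move=> x; rewrite lee_fin sqr_ge0.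
  apply/measurable_EFinP; apply: measurable_funX; apply: measurable_funB => //.
  have mphi : measurable_fun setT (phi n : P -> R) by exact: smooth_measurable.
  exact: (measurableT_comp mphi (measurable_bpt Q)).
have := gagliardo_trace_le (measurable_bpt Q) oK bK r0 rh star' diamK (@bpt_closure _ Q)
  (@bpt_notin _ Q) C1_ge0 reg VL2 mgG sphi grad_cvg bd_cvg.
have := grad_le_gagliardo_trace (measurable_bpt Q) (0%N, 0) oK bK r0 rh star' diamK (@bpt_closure _ Q)
  (@bpt_notin _ Q) frG GM KM C1_ge0 reg c1_gt0 reg_lo VL2 Vorth mgG sphi grad_cvg bd_cvg.
rewrite -seminormE /C1 const_AE// => lo up; split; last exact: lo.
by rewrite seminormE -EFinM.
Qed.

Lemma boundary_measure_ge : rho0 * h <= fine (mu setT).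
Proof.
rewrite -lee_fin fineK ?fin_num_measure//.
have -> : mu setT = boundary_measure Q setT by [].
rewrite boundary_measureE//.
have n0 := size_verts_gt0 Q; rewrite (bigD1 (Ordinal n0))//=.
apply: (@le_trans _ _ ((edge_len Q 0)%:E * 1%:E)%E).
  by rewrite mule1 lee_fin; exact: edges.
rewrite (_ : `[0%R, 1%R]%classic `&` _ = `[0%R, 1%R]%classic :> set R); last by rewrite setIT.
rewrite lebesgue_measure_itv/= lte_fin ltr01 oppr0 adde0 leeDl// sume_ge0// => i _.
by rewrite mule_ge0// lee_fin edge_len_ge0.
Qed.

(** The zero mean of the trace is the boundary condition in [is_PiNabla] for the projection [0]. The
    perimeter is at least the length of one edge, so [h^2 / (2 * mu setT)] is at most
    [h / (2 * rho0)]. *)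
Lemma trace_L2_le : (\int[mu]_t ((g (G t)) ^+ 2)%:E <= (h / (2 * rho0))%:E * gagliardo mu G g)%E.
Proof.
have [_ [_ _ mean]] := Hv.
have vE : v \- cst 0 = v by apply/funext => x /=; rewrite subr0.
rewrite vE -/g in mean.
have ig : mu.-integrable setT (EFin \o (g \o G)).
  have v2 : mu.-integrable setT (fun t => ((g (G t)) ^+ 2)%:E).
    apply/integrableP; split; first by apply/measurable_EFinP; exact: measurable_funX.
    by under eq_integral do rewrite gee0_abs ?lee_fin ?sqr_ge0//.
  have i1 : mu.-integrable setT (fun t => ((cst (1 : R) t) ^+ 2)%:E).
    rewrite (_ : (fun t => _) = EFin \o cst (1 : R)); first exact: finite_measure_integrable_cst.
    by apply/funext => t; rewrite /= expr1n.
  have := integrable_mul_L2 (mu := mu) measurableT mgG (measurable_cst (1 : R)) v2 i1.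
  by apply: eq_integrable => // t _; rewrite /= mulr1.
have mean0 : \int[mu]_t g (G t) = 0.
  by have := bd_int_mean edges_gt0 ig; rewrite mean => -[].
have star := zero_mean_L2_le (measurable_bpt Q) r0 rh diamK (@bpt_closure _ Q) mgG gL2 mean0.
set M := fine (mu setT) in star; have Mge : rho0 * h <= M by exact: boundary_measure_ge.
have M0 : 0 < M by exact: lt_le_trans Mge.
have gag0 : (0 <= gagliardo mu G g)%E.
  by apply: integral_ge0 => t _; apply: integral_ge0 => s _; rewrite lee_fin divr_ge0 ?sqr_ge0.
have -> : (\int[mu]_t ((g (G t)) ^+ 2)%:E =
    ((2 * M)^-1)%:E * ((2 * M)%:E * \int[mu]_t ((g (G t)) ^+ 2)%:E))%E.
  by rewrite muleA -EFinM mulVf ?mul1e// gt_eqF// mulr_gt0.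
apply: le_trans (lee_wpmul2l _ star) _; first by rewrite lee_fin invr_ge0 mulr_ge0// ltW.
rewrite muleA -EFinM; apply: lee_wpmul2r => //; rewrite lee_fin.
rewrite [leRHS](_ : _ = (2 * (rho0 * h))^-1 * h ^+ 2); last by field; rewrite !gt_eqF.
by rewrite ler_wpM2r ?sqr_ge0// lef_pV2 ?posrE ?mulr_gt0// ler_wpM2l.
Qed.

Lemma SK_seminorm_equiv (H : R) : h <= H ->
  (((4 * const_B rho0)^-1)%:E * sq_seminorm_H1 K v <= SK Q v v)%E /\
  (SK Q v v <= ((H / (2 * rho0) + 1) * (4 * const_A rho0 N))%:E * sq_seminorm_H1 K v)%E.
Proof.
move=> hH; have [up lo] := trace_energy_bounds; have l2 := trace_L2_le.
have B0 : 0 < 4 * const_B rho0 by rewrite mulr_gt0// const_B_gt0.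
have gag0 : (0 <= gagliardo mu G g)%E.
  by apply: integral_ge0 => t _; apply: integral_ge0 => s _; rewrite lee_fin divr_ge0 ?sqr_ge0.
rewrite SKE; split.
  apply: (@le_trans _ _ (gagliardo mu G g)).
    apply: le_trans (lee_wpmul2l _ lo) _; first by rewrite lee_fin invr_ge0 ltW.
    by rewrite muleA -EFinM mulVf ?gt_eqF// mul1e.
  by rewrite leeDr//; apply: integral_ge0 => t _; rewrite lee_fin sqr_ge0.
have Hr : 0 <= H / (2 * rho0).
  by apply: divr_ge0; [exact: le_trans (ltW h0) hH|rewrite mulr_ge0// ltW].
apply: (@le_trans _ _ ((H / (2 * rho0) + 1)%:E * gagliardo mu G g)%E).
  rewrite EFinD ge0_muleDl ?lee_fin// mul1e; apply: leeD => //; apply: le_trans l2 _.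
  apply: lee_wpmul2r => //; rewrite lee_fin ler_wpM2r// invr_ge0 mulr_ge0// ltW//.
rewrite EFinM -muleA; apply: lee_wpmul2l => //; by rewrite lee_fin addr_ge0.
Qed.

End ElementBound.

(** * Constants common to all elements of all decompositions *)

Theorem lemma3p4 (R : realType) (Omega : set (R * R)%type) (rho0 : R) (N : nat)
    (HOmega : polygonal_domain Omega) (Hrho0 : 0 < rho0 < 2^-1) :
  exists c_low c_up : R, [/\ 0 < c_low, c_low <= c_up &
    forall (m : nat) (T : 'I_m -> polygon R),
      polygonal_decomposition Omega T ->
      (forall k, shape_regular rho0 N (T k)) ->
      forall (k : 'I_m) (p : nat) (v : (R * R)%type -> R),
        kerPi (T k) p v ->
        (c_low%:E * sq_seminorm_H1 (inner (T k)) v <= SK (T k) v v)%E /\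
        (SK (T k) v v <= c_up%:E * sq_seminorm_H1 (inner (T k)) v)%E].
Proof.
have rho0_gt0 : 0 < rho0 by case/andP: Hrho0.
pose H := ediam Omega.
pose c_low := (4 * const_B rho0)^-1.
pose c := (H / (2 * rho0) + 1) * (4 * const_A rho0 N).
(* The maximum secures [c_low <= c_up] even where no element exists to compare the two: for [N = 0]
   the constant [c] is zero. *)
exists c_low, (Num.max c_low c); split.
- by rewrite invr_gt0 mulr_gt0// const_B_gt0.
- by rewrite le_max lexx.
move=> m T [TOmega _ _] Hreg k p v Hv.
have hH : ediam (inner (T k)) <= H.
  have [_ _ _ bOmega _] := HOmega; apply: ediam_subset => //.
  exact: inner_nonempty.
have [lo up] := SK_seminorm_equiv Hrho0 (Hreg k) Hv hH; split => //.
apply: le_trans up _; apply: lee_wpmul2r; last by rewrite lee_fin le_max lexx orbT.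
by apply: integral_ge0 => x _; rewrite lee_fin sumr_ge0// => b _; exact: sqr_ge0.
Qed.
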